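(* Let $\Gamma$ be a connected finite graph. There is a topological subspace $\check{\mathcal D}\subset\mathcal M_\Gamma$ such that $$\check L\mathcal M_\Gamma=L(\mathcal M_\Gamma\setminus\check{\mathcal D}),$$ where $\check L\mathcal M_\Gamma\subset L\mathcal M_\Gamma$ is the space of intrinsically robust loops and $L(\mathcal M_\Gamma\setminus\check{\mathcal D})$ is the space of smooth unbased loops in $\mathcal M_\Gamma$ with image in $\mathcal M_\Gamma\setminus\check{\mathcal D}$. Consequently, the space of intrinsically robust loops is a loop space.
   Context: Graph. $\Gamma=(\Gamma_0,\Gamma_1)$ is a connected finite graph with vertex set $\Gamma_0$ and edge set $\Gamma_1$ (multiple edges and loop edges allowed). Fix a total ordering of $\Gamma_0$; the face maps $d_0,d_1:\Gamma_1\to\Gamma_0$ give the endpoints of an edge, with $d_0(\alpha)\le d_1(\alpha)$ and equality iff $\alpha$ is a loop edge. $C_i(\Gamma;\mathbb R)$ ($i=0,1$) is the real vector space with basis $\Gamma_i$; $\partial:C_1(\Gamma;\mathbb R)\to C_0(\Gamma;\mathbb R)$ is $\partial\alpha=d_0(\alpha)-d_1(\alpha)$ and $\partial^*$ is its adjoint for the standard inner products. $H_1(\Gamma;\mathbb R)=\ker\partial$. $\bar C_0(\Gamma;\mathbb R)$ (resp. $\tilde C_0(\Gamma;\mathbb R)$) is the set of $\mathbf p\in C_0(\Gamma;\mathbb R)$ with $\sum_i\mathbf p_i=1$ (resp. $=0$). Parameters. $\mathcal M_\Gamma$ is the real vector space of pairs $(E,W)$ of functions $E:\Gamma_0\to\mathbb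 R$, $W:\Gamma_1\to\mathbb R$. $L\mathcal M_\Gamma$ is the space of smooth unbased loops $\gamma$ in $\mathcal M_\Gamma$ (smooth 1-periodic maps, parametrized by $[0,1]$) with the Whitney $C^\infty$ topology. Current. For $\beta>0$ and $(E,W)\in\mathcal M_\Gamma$ let $\hat g$ be the diagonal operator on $C_1(\Gamma;\mathbb R)$ with entries $e^{\beta W_\alpha}$, $\hat\kappa$ the diagonal operator on $C_0(\Gamma;\mathbb R)$ with entries $e^{\beta E_i}$, and $H=-\partial\hat g^{-1}\partial^*\hat\kappa$ the master operator. For $\gamma\in L\mathcal M_\Gamma$ and $\tau_D>0$ sufficiently large, the master equation $\dot{\mathbf p}(t)=\tau_DH(\gamma(t))\mathbf p(t)$, $t\in[0,1]$, has a unique solution $\rho$ in $\bar C_0(\Gamma;\mathbb R)$ with $\rho(0)=\rho(1)$. Put $\mathbf J(t)=\tau_D\hat g^{-1}\partial^*\hat\kappa\rho(t)$, $Q(\beta,\tau_D,\gamma)=\int_0^1\mathbf J(t)\,dt$, and $Q_\beta(\gamma)=\lim_{\tau_D\to\infty}Q(\beta,\tau_D,\gamma)\in H_1(\Gamma;\mathbb R)$. Equivalently $Q_\beta(\gamma)=\int_0^1A(\gamma(t),\tfrac{d}{dt}\rho^B(\gamma(t)))\,dt$, where $\rho^B(E,W)=\left(\sum_je^{-\beta E_j}\right)^{-1}\sum_je^{-\beta E_j}j$ and $A(E,W):\tilde C_0(\Gamma;\mathbb R)\to C_1(\Gamma;\mathbb R)$ is the inverse of the isomorphism $-\partial:\mathrm{im}(\hat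 g^{-1}\partial^* )\to\tilde C_0(\Gamma;\mathbb R)$ followed by inclusion. Robust loops. $\gamma\in L\mathcal M_\Gamma$ is intrinsically robust if there is an open neighborhood $U$ of $\gamma$ in $L\mathcal M_\Gamma$ such that $Q:=\lim_{\beta\to\infty}Q_\beta$ is well-defined and constant on $U$. $\check L\mathcal M_\Gamma$ is the subspace of intrinsically robust loops. *)

(* Defs.v *)
From HB Require Import structures.
From mathcomp Require Import all_boot all_order all_algebra.
From mathcomp Require Import all_classical all_reals all_analysis.

Set Implicit Arguments.
Unset Strict Implicit.
Unset Printing Implicit Defensive.

Import Order.TTheory GRing.Theory Num.Theory.
Import numFieldNormedType.Exports.

Local Open Scope classical_set_scope.
Local Open Scope ring_scope.

(* Finite multigraphs, loop edges allowed. The fixed total ordering of the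
   vertex set identifies it with ['I_nv], ordered as a subset of [nat]; the
   edges are enumerated by ['I_ne]. A loop edge is an edge [a] with
   [d0 a = d1 a]. *)
Record graph := Graph {
  nv : nat;
  ne : nat;
  d0 : 'I_ne -> 'I_nv;
  d1 : 'I_ne -> 'I_nv;
  d0_le_d1 : forall a, (d0 a <= d1 a)%N }.

Definition adjacent (G : graph) : rel 'I_(nv G) := fun i j =>
  [exists a : 'I_(ne G), ((d0 a == i) && (d1 a == j))
                         || ((d0 a == j) && (d1 a == i))].

Definition connected_graph (G : graph) : Prop :=
  (0 < nv G)%N /\ forall i j : 'I_(nv G), connect (@adjacent G) i j.

(* Chains are column vectors, parameters [(E, W)] are pairs of row vectors. *)
Definition chain0 (R : realType) (G : graph) := 'cV[R]_(nv G).
Definition chain1 (R : realType) (G : graph) := 'cV[R]_(ne G).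
Notation params R G := ('rV[R]_(nv G) * 'rV[R]_(ne G))%type.

Section MasterEquation.
Variables (R : realType) (G : graph).

Definition boundary : 'M[R]_(nv G, ne G) :=
  \matrix_(i, a) ((i == d0 a)%:R - (i == d1 a)%:R).

(* The adjoint for the standard inner products. *)
Definition coboundary : 'M[R]_(ne G, nv G) := boundary^T.

Definition ghat (beta : R) (x : params R G) : 'M[R]_(ne G) :=
  diag_mx (map_mx (fun w => expR (beta * w)) x.2).

Definition khat (beta : R) (x : params R G) : 'M[R]_(nv G) :=
  diag_mx (map_mx (fun e => expR (beta * e)) x.1).

Definition master (beta : R) (x : params R G) : 'M[R]_(nv G) :=
  - (boundary *m invmx (ghat beta x) *m coboundary *m khat beta x).

(* [rho] matters only through its restriction to [0, 1]: a curve on [0, 1] with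
   one-sided derivatives at the endpoints always extends to one that has
   two-sided derivatives there. *)
Definition periodic_solution (beta tauD : R) (gamma : R -> params R G)
    (rho : R -> chain0 R G) : Prop :=
  [/\ forall t : R, t \in `[0, 1] -> \sum_i rho t i ord0 = 1,
      rho 0 = rho 1
    & forall t : R, t \in `[0, 1] ->
        is_derive t 1 rho (tauD *: (master beta (gamma t) *m rho t))].

(* The periodic solution is unique on [0, 1] for all large [tauD]. *)
Definition periodic_state (beta tauD : R) (gamma : R -> params R G) :
    R -> chain0 R G :=
  xget (fun=> 0) [set rho | periodic_solution beta tauD gamma rho].

Definition current (beta tauD : R) (gamma : R -> params R G) (t : R) :
    chain1 R G :=
  tauD *: (invmx (ghat beta (gamma t)) *m coboundary *m khat beta (gamma t)
           *m periodic_state beta tauD gamma t).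

Definition average_current (beta tauD : R) (gamma : R -> params R G) :
    chain1 R G :=
  \col_a (\int[lebesgue_measure]_(t in `[0, 1]) current beta tauD gamma t a ord0).

Definition adiabatic_current (beta : R) (gamma : R -> params R G) :
    chain1 R G :=
  lim (average_current beta tauD gamma @[tauD --> +oo]).

End MasterEquation.

Section LoopSpace.
Variables (R : realType) (G : graph).

Record loop := Loop {
  loop_fun :> R -> params R G;
  loop_smooth : forall k t, derivable (derive1n k loop_fun) t 1;
  loop_periodic : forall t, loop_fun (t + 1) = loop_fun t }.

HB.instance Definition _ := gen_eqMixin loop.
HB.instance Definition _ := gen_choiceMixin loop.

Definition Ck_ball (gamma : loop) (k : nat) (e : R) : set loop :=
  [set eta : loop | forall j t, (j <= k)%N ->
     `|derive1n j eta t - derive1n j gamma t| < e].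

(* The Whitney C^oo topology. As the circle is compact, it is the topology of
   uniform convergence of all derivatives. *)
Definition whitney_open (U : set loop) : Prop :=
  forall gamma, U gamma ->
    exists k, exists2 e : R, 0 < e & Ck_ball gamma k e `<=` U.

Lemma whitney_openT : whitney_open setT.
Proof. by move=> gamma _; exists 0%N, 1. Qed.

Lemma Ck_ball_le gamma (k l : nat) (e f : R) : (k <= l)%N -> f <= e ->
  Ck_ball gamma l f `<=` Ck_ball gamma k e.
Proof.
move=> kl fe eta H j t jk.
by apply: lt_le_trans fe; apply: H; apply: leq_trans kl.
Qed.

Lemma whitney_openI : setI_closed whitney_open.
Proof.
move=> U V oU oV gamma [/oU[k [e e0 kU]] /oV[l [f f0 lV]]].
exists (maxn k l), (Num.min e f); first by rewrite lt_min e0 f0.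
move=> eta H; split.
- apply: kU; apply: Ck_ball_le H; [exact: leq_maxl|by rewrite ge_min lexx].
- apply: lV; apply: Ck_ball_le H; [exact: leq_maxr|by rewrite ge_min lexx orbT].
Qed.

Lemma whitney_open_bigU (I : Type) (f : I -> set loop) :
  (forall i, whitney_open (f i)) -> whitney_open (\bigcup_i f i).
Proof.
move=> of_ gamma [i _ /of_[k [e e0 H]]].
by exists k, e => // eta /H; exists i.
Qed.

HB.instance Definition _ := isOpenTopological.Build loop
  whitney_openT whitney_openI whitney_open_bigU.

Definition intrinsically_robust (gamma : loop) : Prop :=
  exists2 U : set loop, open_nbhs gamma U &
    exists q : chain1 R G, forall eta : loop, U eta ->
      adiabatic_current beta eta @[beta --> +oo] --> q.

Definition robust_loops : set loop := [set gamma | intrinsically_robust gamma].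

(* The subspace L X of smooth loops with image in X. *)
Definition loops_in (X : set (params R G)) : set loop :=
  [set gamma : loop | range gamma `<=` X].

Definition is_loop_space (A : set loop) : Prop :=
  exists X : set (params R G), A = loops_in X.

End LoopSpace.
Arguments robust_loops : clear implicits.

(* Main.v *)
Require Import Defs.
From mathcomp Require Import all_boot all_order all_algebra.
From mathcomp Require Import all_classical all_reals all_analysis.
From mathcomp Require Import ring lra.

(** The exceptional set is explicit. Call a point (E, W) degenerate if two
    vertices i and j minimise E, two spanning trees f and g minimise the total
    barrier W, and the flows that carry a unit of charge from i to j along f and
    along g differ. A loop is intrinsically robust exactly when it avoids the
    degenerate points; both implications are proved for every smooth loop.

    Adiabatic limit. The current produced by a distribution p is an electrical
    current: it is determined by its divergence and by orthogonality to cycles.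
    By Kirchhoff's theorem ([kirchhoff_basis_flow], [tree_formula]) it is the
    average of the flows along the single spanning trees, with Gibbs weights in
    the total barriers. Along a periodic solution rho of the master equation the
    current is therefore a linear function of the derivative of rho, and after
    an integration by parts over the period only rho itself matters. The
    weighted square norm of the distance from rho to the Boltzmann distribution
    decays at a rate proportional to the driving time ([energy_estimate]).
    This forces rho to be uniformly close to the Boltzmann distribution; it also
    shows that the return map of the master equation has no fixed vector of
    total mass 0, from which periodic solutions exist
    ([exists_periodic_solution]). Hence the adiabatic current is the integral
    over one period of [pump], the current that the derivative of the Boltzmann
    distribution drives ([adiabatic_currentE]).

    Loops of nondegenerate points. Near a nondegenerate point the Boltzmann
    distribution moves, up to an exponentially small amount, only between
    vertices that are minimal at that point, and for such transfers all relevant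
    trees give the same flow. On a short piece of path the integral of [pump]
    thus approaches the tree flow of the change of the Boltzmann distribution
    ([pump_local], [transported_local]). Chaining such pieces around the circle
    with Cousin's principle ([cousin]), where consecutive trees agree on the
    common minima, shows that the current converges and that all uniformly close
    loops have the same limit ([good_loop_robust]).

    Loops through a degenerate point. Arbitrarily small smooth perturbations
    make i and j the only minima at the chosen time and let them cross
    transversally there. A further bump, supported near that time, lowers the
    barriers along f or along g and makes this tree the minimal one at the
    crossing. The two resulting loops agree away from the crossing, where one
    unit of charge moves from i to j along f for the first and along g for the
    second, so their limits cannot both equal the same vector
    ([transported_crossing], [crossing_tree_unique],
    [degenerate_not_robust]). *)

Set Implicit Arguments.
Unset Strict Implicit.
Unset Printing Implicit Defensive.
Import Order.TTheory GRing.Theory Num.Theory.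
Import numFieldNormedType.Exports.
Local Open Scope classical_set_scope.
Local Open Scope ring_scope.

(** * Kirchhoff's laws and basis flows *)

Section BasisFlows.
Variables (F : realFieldType) (N m : nat) (M : 'M[F]_(N, m)).

(** A basis is a choice of columns of [M] with nonzero determinant. Listing a
    basis as a function, once for every ordering of its columns, lets sums over
    bases be reindexed one column at a time; the repetition cancels in all
    quotients. For the boundary of a graph the bases are the spanning trees. *)
Definition basis_det (f : {ffun 'I_N -> 'I_m}) : F := \det (colsub f M).

Definition spread (f : {ffun 'I_N -> 'I_m}) : 'M[F]_(m, N) :=
  \matrix_(a, k) (a == f k)%:R.

(** The flow with given divergence that is supported on the columns [f]. *)
Definition basis_flow f : 'M[F]_(m, N) := spread f *m invmx (colsub f M).

Lemma mul_spread f : M *m spread f = colsub f M.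
Proof.
apply/matrixP => i k; rewrite !mxE (bigD1 (f k)) //= big1 ?mxE ?eqxx ?mulr1 ?addr0 //.
by move=> a /negbTE ne; rewrite mxE ne mulr0.
Qed.

Lemma mul_basis_flow f (v : 'cV_N) : basis_det f != 0 ->
  M *m (basis_flow f *m v) = v.
Proof.
move=> df; rewrite !mulmxA mul_spread mulmxV ?mul1mx //.
by rewrite unitmxE unitfE.
Qed.

Lemma basis_det_inj f : basis_det f != 0 -> injective f.
Proof.
move=> df k l fkl; apply/eqP; apply: contra_neqT df => kl.
rewrite /basis_det -det_tr; apply: (determinant_alternate kl) => i.
by rewrite !mxE fkl.
Qed.

Lemma basis_flow_uniq (f : {ffun 'I_N -> 'I_m}) (y : 'cV_m) : basis_det f != 0 ->
  (forall a, a \notin codom f -> y a ord0 = 0) -> y = basis_flow f *m (M *m y).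
Proof.
move=> df supp.
pose c : 'cV_N := \col_k y (f k) ord0.
have yE : y = spread f *m c.
  apply/colP => a; rewrite mxE.
  have [/codomP[k ->]|na] := boolP (a \in codom f).
    rewrite (bigD1 k) //= !mxE eqxx mul1r big1 ?addr0 // => l lk.
    rewrite !mxE; case: eqP => [/(basis_det_inj df) kl|_]; last by rewrite mul0r.
    by rewrite kl eqxx in lk.
  rewrite supp // big1 // => k _; rewrite !mxE.
  case: eqP => [e|_]; last by rewrite mul0r.
  by rewrite e codom_f in na.
rewrite {2}yE [M *m _]mulmxA mul_spread mulmxA /basis_flow -(mulmxA (spread f)).
by rewrite mulVmx ?mulmx1 // unitmxE unitfE.
Qed.

Lemma basis_flow_supp (f : {ffun 'I_N -> 'I_m}) (v : 'cV_N) a : a \notin codom f ->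
  (basis_flow f *m v) a ord0 = 0.
Proof.
move=> na; rewrite -mulmxA mxE big1 // => k _; rewrite mxE.
case: eqP => [e|_]; last by rewrite mul0r.
  by rewrite e codom_f in na.
Qed.

(** The flow depends only on the set of columns of a basis, because it is
    characterised by its divergence and its support. *)
Lemma basis_flow_codom (f g : {ffun 'I_N -> 'I_m}) (v : 'cV_N) : basis_det f != 0 -> basis_det g != 0 ->
  (forall k, g k \in codom f) -> basis_flow g *m v = basis_flow f *m v.
Proof.
move=> df dg gf.
rewrite (@basis_flow_uniq f (basis_flow g *m v)) ?mul_basis_flow // => a na.
apply: basis_flow_supp; apply: contra na => /codomP[k ->]; exact: gf.
Qed.

Definition upd (f : {ffun 'I_N -> 'I_m}) k a : {ffun 'I_N -> 'I_m} :=
  [ffun l => if l == k then a else f l].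

(** The map sending [(f, a)] to [(upd f k a, f k)] is an involution, so the
    double sum of [Phi (upd f k a)] counts each value of [Phi] equally often. *)
Lemma sum_upd0 (k : 'I_N) (Phi : {ffun 'I_N -> 'I_m} -> F) :
  (forall f, \sum_a Phi (upd f k a) = 0) -> \sum_f Phi f = 0.
Proof.
move=> H.
pose h (p : {ffun 'I_N -> 'I_m} * 'I_m) := (upd p.1 k p.2, p.1 k).
have hK : involutive h.
  move=> [f a]; rewrite /h /= !ffunE eqxx; congr pair.
  by apply/ffunP => l; rewrite !ffunE; case: eqP => [->|].
have /eqP : (\sum_f Phi f) *+ m = 0.
  have -> : (\sum_f Phi f) *+ m = \sum_f \sum_(a < m) Phi f.
    by rewrite -sumrMnl; apply: eq_bigr => f _; rewrite sumr_const card_ord.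
  rewrite pair_bigA /= (reindex_inj (inv_inj hK)) /=.
  rewrite -(pair_bigA _ (fun f a => Phi (upd f k a))) /=.
  by rewrite big1 // => f _; rewrite H.
rewrite mulrn_eq0 => /orP[/eqP m0|/eqP//].
by rewrite big1 // => f _; have := f k; rewrite m0 => -[].
Qed.

Variable x : 'I_m -> F.
Hypothesis x_gt0 : forall a, 0 < x a.

Definition basis_weight (f : {ffun 'I_N -> 'I_m}) :=
  (basis_det f) ^+ 2 * \prod_k x (f k).

Lemma basis_weight_ge0 f : 0 <= basis_weight f.
Proof. by rewrite mulr_ge0 ?sqr_ge0 // prodr_ge0 // => k _; exact: ltW. Qed.

Lemma basis_weight_gt0 f : basis_det f != 0 -> 0 < basis_weight f.
Proof.
by move=> df; rewrite mulr_gt0 ?exprn_even_gt0 // prodr_gt0.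
Qed.

(** Multiplying by the squared determinant turns the inverse into an adjugate,
    whose entries are polynomial and meaningful for all choices of columns. *)
Lemma weight_basis_flow f (v : 'cV_N) a :
  basis_weight f * (basis_flow f *m v) a ord0 =
  (\prod_k x (f k)) * basis_det f *
    \sum_k (a == f k)%:R * (\adj (colsub f M) *m v) k ord0.
Proof.
rewrite /basis_weight; have [d0|dn0] := eqVneq (basis_det f) 0.
  by rewrite d0 expr0n /= mul0r mulr0 !mul0r.
have u : colsub f M \in unitmx by rewrite unitmxE unitfE.
have -> : \adj (colsub f M) = basis_det f *: invmx (colsub f M).
  by rewrite /invmx u /basis_det scalerA divff ?scale1r.
rewrite -scalemxAl -mulmxA; move: (invmx _ *m v) => w.
move: (basis_det f) => d; rewrite mxE !mulr_sumr; apply: eq_bigr => k _.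
by rewrite !mxE; ring.
Qed.

(** Fix all columns of [f] but the [k]-th. The determinant and the [k]-th
    coordinate of the adjugate are both expanded in the same cofactors; summing
    over the [k]-th column then produces the cofactor expansion of [M *m z],
    which vanishes. *)
Lemma sum_basis_flow_orth (v : 'cV_N) (z : 'cV_m) : M *m z = 0 ->
  \sum_a (x a)^-1 * z a ord0 *
     (\sum_f basis_weight f * (basis_flow f *m v) a ord0) = 0.
Proof.
move=> Mz.
transitivity (\sum_k \sum_(f : {ffun 'I_N -> 'I_m}) (x (f k))^-1 * z (f k) ord0 *
   ((\prod_l x (f l)) * basis_det f * (\adj (colsub f M) *m v) k ord0)).
  rewrite exchange_big /=.
  under eq_bigr do rewrite mulr_sumr.
  rewrite exchange_big /=; apply: eq_bigr => f _.
  under eq_bigr do rewrite weight_basis_flow 2!mulr_sumr.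
  rewrite exchange_big /=; apply: eq_bigr => k _.
  rewrite (bigD1 (f k)) //= eqxx mul1r [X in _ + X]big1 ?addr0; first by ring.
  by move=> a /negbTE->; rewrite mul0r; ring.
rewrite big1 // => k _; apply: (@sum_upd0 k) => f.
pose X := \prod_(l | l != k) x (f l).
pose cof i := cofactor (colsub f M) i k.
have cofE a i : cofactor (colsub (upd f k a) M) i k = cof i.
  congr (_ * \det _); apply/matrixP => p q; rewrite !mxE ffunE.
  by rewrite eq_sym (negbTE (neq_lift k q)).
transitivity (\sum_a z a ord0 * (X * (\sum_i M i a * cof i) *
    (\sum_i cof i * v i ord0))).
  apply: eq_bigr => a _.
  have -> : \prod_l x (upd f k a l) = x a * X.
    rewrite (bigD1 k) //= ffunE eqxx; congr (_ * _).
    by apply: eq_bigr => l /negbTE lk; rewrite ffunE lk.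
  have -> : basis_det (upd f k a) = \sum_i M i a * cof i.
    rewrite /basis_det (expand_det_col _ k); apply: eq_bigr => i _.
    by rewrite cofE mxE ffunE eqxx.
  have -> : (\adj (colsub (upd f k a) M) *m v) k ord0 =
      \sum_i cof i * v i ord0.
    by rewrite mxE; apply: eq_bigr => i _; rewrite mxE cofE.
  by rewrite ffunE eqxx; field; exact: lt0r_neq0.
transitivity ((\sum_i cof i * (M *m z) i ord0) * (X * (\sum_i cof i * v i ord0))).
  move: X cof {cofE} (\sum_i cof i * v i ord0) => X cof c; rewrite [RHS]mulr_suml.
  under [RHS]eq_bigr do rewrite mxE mulr_sumr mulr_suml.
  rewrite [RHS]exchange_big /=; apply: eq_bigr => a _.
  rewrite mulr_sumr mulr_suml mulr_sumr; apply: eq_bigr => i _.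
  ring.
by rewrite Mz big1 ?mul0r // => i _; rewrite mxE mulr0.
Qed.

(** The difference of two solutions lies in the kernel of [M] and is orthogonal
    to this kernel for the energy form, which is positive definite. *)
Lemma kirchhoff_uniq (y1 y2 : 'cV_m) : M *m y1 = M *m y2 ->
  (forall z : 'cV_m, M *m z = 0 -> \sum_a (x a)^-1 * z a ord0 * y1 a ord0 = 0) ->
  (forall z : 'cV_m, M *m z = 0 -> \sum_a (x a)^-1 * z a ord0 * y2 a ord0 = 0) ->
  y1 = y2.
Proof.
move=> My o1 o2; have Mz : M *m (y1 - y2) = 0 by rewrite mulmxBr My subrr.
have := o1 _ Mz; rewrite -[RHS](o2 _ Mz) => /eqP.
rewrite -subr_eq0 -sumrB => /eqP e.
have {e}: \sum_a (x a)^-1 * ((y1 - y2) a ord0) ^+ 2 = 0.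
  by rewrite -[RHS]e; apply: eq_bigr => a _; rewrite !mxE; ring.
move=> /eqP; rewrite psumr_eq0 => [/allP e|a _]; last first.
  by rewrite mulr_ge0 ?sqr_ge0 // invr_ge0 ltW.
apply/eqP; rewrite -subr_eq0; apply/eqP; apply/matrixP => a b.
rewrite ord1 [RHS]mxE.
have /= := e a (mem_index_enum _).
by rewrite mulf_eq0 invr_eq0 (gt_eqF (x_gt0 a)) /= sqrf_eq0 => /eqP.
Qed.

(** Kirchhoff's theorem for an arbitrary matrix of full row rank: the solution
    of a weighted least squares problem is the average of the solutions
    supported on the bases. The squared determinants weight the bases of a
    general matrix; for a graph they are all 1. *)
Theorem kirchhoff_basis_flow (y : 'cV_m) :
  (exists f, basis_det f != 0) ->
  (forall z : 'cV_m, M *m z = 0 -> \sum_a (x a)^-1 * z a ord0 * y a ord0 = 0) ->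
  y = \sum_f (basis_weight f / \sum_g basis_weight g) *:
        (basis_flow f *m (M *m y)).
Proof.
move=> [f0 df0] orth; set v := M *m y; set Z := \sum_g basis_weight g.
have Z0 : Z != 0.
  apply: lt0r_neq0; rewrite /Z (bigD1 f0) //= ltr_pwDl ?basis_weight_gt0 //.
  by rewrite sumr_ge0 // => f _; exact: basis_weight_ge0.
apply: kirchhoff_uniq => //.
  rewrite mulmx_sumr -/v.
  transitivity (\sum_f (basis_weight f / Z) *: v); last first.
    apply: eq_bigr => f _; rewrite -scalemxAr.
    have [d0|dn0] := eqVneq (basis_det f) 0; last by rewrite mul_basis_flow.
    by rewrite /basis_weight d0 expr0n /= !mul0r !scale0r.
  by rewrite -scaler_suml -mulr_suml divff // scale1r.
move=> z Mz.
transitivity (Z^-1 * (\sum_a (x a)^-1 * z a ord0 *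
     (\sum_f basis_weight f * (basis_flow f *m v) a ord0))); last first.
  by rewrite sum_basis_flow_orth ?mulr0.
rewrite mulr_sumr; apply: eq_bigr => a _.
rewrite summxE mulr_sumr [in RHS]mulr_sumr mulr_sumr; apply: eq_bigr => f _.
by rewrite !mxE; ring.
Qed.

End BasisFlows.

(** * The boundary operator of a connected graph *)

Lemma row'_mul (F : pzSemiRingType) m n p (i : 'I_m) (A : 'M[F]_(m, n))
    (B : 'M[F]_(n, p)) : row' i (A *m B) = row' i A *m B.
Proof. by apply/matrixP => k j; rewrite !mxE; apply: eq_bigr => l _; rewrite mxE. Qed.

Section GraphAlgebra.
Variables (R : realType) (G : graph).
Hypothesis Gconn : connected_graph G.
Implicit Types (u : 'cV[R]_(nv G)) (x : params R G).

Local Notation bd := (boundary R G).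

Lemma coboundaryE u a :
  (coboundary R G *m u) a ord0 = u (d0 a) ord0 - u (d1 a) ord0.
Proof.
rewrite mxE.
under eq_bigr do rewrite !mxE mulrBl.
rewrite sumrB; congr (_ - _).
  by rewrite (bigD1 (d0 a)) //= eqxx mul1r big1 ?addr0 // => i /negbTE->; rewrite mul0r.
by rewrite (bigD1 (d1 a)) //= eqxx mul1r big1 ?addr0 // => i /negbTE->; rewrite mul0r.
Qed.

Lemma sum_boundary (y : 'cV[R]_(ne G)) : \sum_i (bd *m y) i ord0 = 0.
Proof.
under eq_bigr do rewrite mxE.
rewrite exchange_big big1 //= => a _; rewrite -mulr_suml.
suff -> : \sum_i bd i a = (coboundary R G *m (const_mx 1 : 'cV_(nv G))) a ord0.
  by rewrite coboundaryE !mxE subrr mul0r.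
by rewrite mxE; apply: eq_bigr => i _; rewrite !mxE mulr1.
Qed.

Lemma potential_path u i p : path (@Defs.adjacent G) i p ->
  `|u i ord0 - u (last i p) ord0| <=
    (size p)%:R * \sum_a `|(coboundary R G *m u) a ord0|.
Proof.
set S := \sum_a _.
elim: p i => [i _|j p IH i /= /andP[/existsP[a ija] jp]].
  by rewrite subrr normr0 mul0r.
rewrite -[in leRHS]add1n natrD mulrDl mul1r.
rewrite -(subrKA (u j ord0)) (le_trans (ler_normD _ _)) // lerD ?IH //.
have : `|(coboundary R G *m u) a ord0| <= S.
  by rewrite /S (bigD1 a) //= lerDl sumr_ge0.
rewrite coboundaryE.
by case/orP: ija => /andP[/eqP-> /eqP->] //; rewrite distrC.
Qed.

(** A discrete Poincare inequality: a simple path visits fewer than [nv G] edges. *)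
Lemma potential_diff u i j :
  `|u i ord0 - u j ord0| <= (nv G)%:R * \sum_a `|(coboundary R G *m u) a ord0|.
Proof.
case: Gconn => _ /(_ i j) /connectP[p ip ->].
case/shortenP: ip => q iq uq _.
apply: le_trans (potential_path _ iq) _.
apply: ler_wpM2r; first by rewrite sumr_ge0.
rewrite ler_nat; apply: (@leq_trans (size (i :: q))) => //.
by rewrite -(card_uniqP uq) -[leqRHS]card_ord max_card.
Qed.

Variable i0 : 'I_(nv G).

(** Deleting the row of one vertex removes the linear relation between the rows
    of the boundary, whose sum is 0. *)
Definition reduced_boundary : 'M[R]_((nv G).-1, ne G) := row' i0 bd.

(** A relation between the remaining rows is a potential without differences
    along edges that vanishes at [i0], hence everywhere by connectedness. *)
Lemma reduced_boundary_free : row_free reduced_boundary.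
Proof.
rewrite -kermx_eq0; apply/eqP/row_matrixP => k; rewrite row0.
have /sub_kermxP := row_sub k (kermx reduced_boundary).
move: (row k _) => y yM.
pose u : 'cV[R]_(nv G) := \col_i if unlift i0 i is Some j then y ord0 j else 0.
have cu : coboundary R G *m u = 0.
  apply/matrixP => a b; rewrite ord1 [RHS]mxE mxE (bigD1 i0) //=.
  rewrite [u i0 _]mxE unlift_none mulr0 add0r.
  transitivity ((y *m reduced_boundary) ord0 a); last by rewrite yM mxE.
  rewrite mxE (reindex_onto (lift i0) (fun i => odflt k (unlift i0 i))) /=.
    apply: eq_big => [j|j _]; first by rewrite liftK /= eqxx andbT eq_sym neq_lift.
    by rewrite !mxE liftK mulrC.
  by move=> i ii0; case: unliftP ii0 => [j ->//|->]; rewrite ?eqxx // liftK.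
apply/rowP => j; rewrite mxE.
have := potential_diff u (lift i0 j) i0.
rewrite cu big1 ?mulr0; last by move=> a _; rewrite mxE normr0.
by rewrite normr_le0 subr_eq0 !mxE liftK unlift_none => /eqP.
Qed.

Lemma exists_basis : exists f, basis_det reduced_boundary f != 0.
Proof.
have full : row_full reduced_boundary^T.
  by rewrite /row_full mxrank_tr; exact: reduced_boundary_free.
exists (finfun (fullrankfun full)).
rewrite /basis_det -det_tr.
suff -> : (colsub (finfun (fullrankfun full)) reduced_boundary)^T =
    rowsub (fullrankfun full) reduced_boundary^T.
  by have := fullrowsub_unit full; rewrite unitmxE unitfE.
apply/matrixP => i j; rewrite !mxE.
by rewrite ffunE.
Qed.

(** For a basis [f], the sign makes this a right inverse of minus the boundary on
    chains of total mass 0, so that mass moves from where it decreases to where it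
    increases. *)
Definition tree_flow f : 'M[R]_(ne G, nv G) :=
  - (basis_flow reduced_boundary f *m row' i0 1%:M).

Lemma tree_flowE f (v : 'cV[R]_(nv G)) :
  tree_flow f *m v = - (basis_flow reduced_boundary f *m row' i0 v).
Proof.
rewrite mulNmx -mulmxA; congr (- (_ *m _)).
by rewrite -[in RHS](mul1mx v) row'_mul.
Qed.

(** Gradients are orthogonal to cycles; a cycle of the reduced boundary is a
    cycle, since the coefficients of a boundary add up to 0. *)
Lemma potential_orth u (z : 'cV[R]_(ne G)) : reduced_boundary *m z = 0 ->
  \sum_a (coboundary R G *m u) a ord0 * z a ord0 = 0.
Proof.
move=> Mz.
have bz i : i != i0 -> (bd *m z) i ord0 = 0.
  move=> ii0; case: (unliftP i0 i) ii0 => [j ->|->]; last by rewrite eqxx.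
  move=> _; have := congr1 (fun A : 'cV[R]_(nv G).-1 => A j ord0) Mz.
  by rewrite /reduced_boundary -row'_mul !mxE.
have bz0 : bd *m z = 0.
  apply/matrixP => i b; rewrite ord1 [RHS]mxE.
  have [->|/bz//] := eqVneq i i0.
  have := sum_boundary z; rewrite (bigD1 i0) //= big1 ?addr0 // => i' /bz//.
transitivity ((u^T *m (bd *m z)) ord0 ord0); last by rewrite bz0 mulmx0 mxE.
rewrite mulmxA mxE; apply: eq_bigr => a _; congr (_ * _).
by rewrite -[u in LHS]trmxK -trmx_mul mxE.
Qed.

(** Ohm's law makes [J] orthogonal to cycles for the energy form, so that
    Kirchhoff's theorem expresses it through its own divergence. *)
Lemma tree_formula (c : 'I_(ne G) -> R) u (J : 'cV[R]_(ne G)) :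
  (forall a, 0 < c a) ->
  (forall a, J a ord0 = c a * (coboundary R G *m u) a ord0) ->
  J = \sum_f (basis_weight reduced_boundary c f /
              \sum_g basis_weight reduced_boundary c g) *:
       (tree_flow f *m (- (bd *m J))).
Proof.
move=> c0 JE.
rewrite [LHS](@kirchhoff_basis_flow _ _ _ reduced_boundary c) //.
- apply: eq_bigr => f _; congr (_ *: _).
  rewrite tree_flowE /reduced_boundary -row'_mul.
  have -> : row' i0 (- (bd *m J)) = - row' i0 (bd *m J).
    by apply/matrixP => i j; rewrite !mxE.
  by rewrite mulmxN opprK.
- exact: exists_basis.
- move=> z Mz; rewrite -[RHS](potential_orth u Mz); apply: eq_bigr => a _.
  by rewrite JE; field; exact: lt0r_neq0.
Qed.

End GraphAlgebra.

Section MasterAlgebra.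
Variables (R : realType) (G : graph) (beta : R).
Implicit Types (p : 'cV[R]_(nv G)) (x : params R G).

Lemma invmx_ghat x :
  invmx (ghat beta x) = diag_mx (map_mx (fun w => expR (- (beta * w))) x.2).
Proof.
have e : diag_mx (map_mx (fun w => expR (- (beta * w))) x.2) *m ghat beta x = 1%:M.
  rewrite mulmx_diag; apply/matrixP => i j; rewrite !mxE -expRD addNr expR0.
  by [].
have u : ghat beta x \in unitmx by case: (mulmx1_unit e).
by rewrite -[LHS]mul1mx -e -mulmxA mulmxV ?mulmx1.
Qed.

Definition edge_current x p : 'cV[R]_(ne G) :=
  invmx (ghat beta x) *m coboundary R G *m khat beta x *m p.

Lemma edge_currentE x p a : edge_current x p a ord0 =
  expR (- (beta * x.2 ord0 a)) *
   (expR (beta * x.1 ord0 (d0 a)) * p (d0 a) ord0 -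
    expR (beta * x.1 ord0 (d1 a)) * p (d1 a) ord0).
Proof.
rewrite /edge_current -mulmxA -mulmxA invmx_ghat mul_diag_mx mxE coboundaryE.
by rewrite /khat mul_diag_mx !mxE.
Qed.

Lemma masterE x p :
  master beta x *m p = - (boundary R G *m edge_current x p).
Proof. by rewrite /master /edge_current mulNmx !mulmxA. Qed.

End MasterAlgebra.

(** * Calculus on the real line *)

Section Calculus.
Variable R : realType.
Implicit Types (f g F : R -> R) (t a b c : R).

(** The derivative of a real function, in a form that lets the rules below be
    stated for functions written as lambda terms. *)
Definition dv f t (d : R) := is_derive t 1 f d.

Lemma dv_eq f t a b : dv f t a -> a = b -> dv f t b.
Proof. by move=> fa <-. Qed.

Lemma dv_ext f g t a : (forall s, f s = g s) -> dv f t a -> dv g t a.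
Proof. by move=> /funext->. Qed.

Lemma dv_cst c t : dv (fun=> c) t 0.
Proof. exact: is_derive_cst. Qed.

Lemma dv_id t : dv id t 1.
Proof. exact: is_derive_id. Qed.

Lemma dvD f g t a b : dv f t a -> dv g t b -> dv (fun s => f s + g s) t (a + b).
Proof. exact: is_deriveD. Qed.

Lemma dvN f t a : dv f t a -> dv (fun s => - f s) t (- a).
Proof. exact: is_deriveN. Qed.

Lemma dvB f g t a b : dv f t a -> dv g t b -> dv (fun s => f s - g s) t (a - b).
Proof. by move=> fa /dvN; exact: dvD. Qed.

Lemma dvM f g t a b : dv f t a -> dv g t b ->
  dv (fun s => f s * g s) t (a * g t + f t * b).
Proof.
move=> fa gb; apply: dv_eq (is_deriveM fa gb) _.
by rewrite addrC /GRing.scale /=; congr (_ + _); rewrite mulrC.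
Qed.

Lemma dvZ c f t a : dv f t a -> dv (fun s => c * f s) t (c * a).
Proof. by move=> fa; apply: dv_eq (dvM (dv_cst c t) fa) _; rewrite mul0r add0r. Qed.

Lemma dv_sum (I : Type) (r : seq I) (P : pred I) (h : I -> R -> R) (d : I -> R) t :
  (forall i, P i -> dv (h i) t (d i)) ->
  dv (fun s => \sum_(i <- r | P i) h i s) t (\sum_(i <- r | P i) d i).
Proof.
move=> H; elim: r => [|i r IH].
  rewrite big_nil; apply: dv_ext (dv_cst 0 t) => s; by rewrite big_nil.
rewrite big_cons; case: ifP => Pi.
  apply: dv_ext (dvD (H i Pi) IH) => s; by rewrite big_cons Pi.
by apply: dv_ext IH => s; rewrite big_cons Pi.
Qed.

Lemma dv_comp f g t a b : dv f (g t) a -> dv g t b -> dv (fun s => f (g s)) t (a * b).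
Proof. exact: is_derive1_comp. Qed.

Lemma dv_exp f t a : dv f t a -> dv (fun s => expR (f s)) t (expR (f t) * a).
Proof. by apply: dv_comp; exact: is_derive_expR. Qed.

Lemma dvV f t a : f t != 0 -> dv f t a -> dv (fun s => (f s)^-1) t (- (a / f t ^+ 2)).
Proof.
move=> ft fa; apply: dv_eq (is_deriveV ft fa) _.
by rewrite /GRing.scale /= mulNr mulrC.
Qed.

Lemma dv_near f g t a : (\forall s \near t, f s = g s) -> dv f t a -> dv g t a.
Proof. exact: near_eq_is_derive. Qed.

Lemma dv_continuous f t a : dv f t a -> {for t, continuous f}.
Proof.
by move=> [fd _]; apply: differentiable_continuous; apply/derivable1_diffP.
Qed.

Lemma dv_unique f t a b : dv f t a -> dv f t b -> a = b.
Proof. by move=> [_ <-] [_ <-]. Qed.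

Lemma dv_shift f c t a : dv f (t + c) a -> dv (fun s => f (s + c)) t a.
Proof.
move=> fa; have d := dvD (dv_id t) (dv_cst c t).
by apply: dv_eq (@dv_comp f (fun s => s + c) t a _ fa d) _; rewrite addr0 mulr1.
Qed.

Lemma dv_within F f a b : (forall t, a <= t <= b -> dv F t (f t)) ->
  {within `[a, b], continuous F}.
Proof.
move=> H; apply: derivable_within_continuous => t; rewrite in_itv /= => tab.
by have [] := H t tab.
Qed.

Lemma mvt F f a b : a <= b -> (forall t, a <= t <= b -> dv F t (f t)) ->
  exists2 c, a <= c <= b & F b - F a = f c * (b - a).
Proof.
move=> ab H.
have [|c|c + e] := @MVT_segment R F f a b ab; last by rewrite in_itv; exists c.
  by move=> t; rewrite in_itv /= => /andP[/ltW ta /ltW tb]; apply: H; rewrite ta.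
exact: dv_within H _.
Qed.

Lemma mvt_bound F f a b C : a <= b -> (forall t, a <= t <= b -> dv F t (f t)) ->
  (forall t, a <= t <= b -> `|f t| <= C) -> `|F b - F a| <= C * (b - a).
Proof.
move=> ab /(mvt ab)[c cab ->] /(_ c cab) fC.
by rewrite normrM [X in _ * X]ger0_norm ?subr_ge0 // ler_wpM2r // subr_ge0.
Qed.

Lemma mvt_le F f a b : a <= b -> (forall t, a <= t <= b -> dv F t (f t)) ->
  (forall t, a <= t <= b -> f t <= 0) -> F b <= F a.
Proof.
move=> ab /(mvt ab)[c cab e] /(_ c cab) fC.
by rewrite -subr_le0 e mulr_le0_ge0 // subr_ge0.
Qed.

Lemma mvt_cst F a b : a <= b -> (forall t, a <= t <= b -> dv F t 0) -> F b = F a.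
Proof.
move=> ab /(mvt ab)[c cab /eqP]; by rewrite mul0r subr_eq0 => /eqP.
Qed.

Lemma dv0_cst F : (forall t, dv F t 0) -> forall a b, F a = F b.
Proof.
move=> H a b; have [ab|/ltW ba] := leP a b; last exact: (mvt_cst ba).
by apply/esym; exact: (mvt_cst ab).
Qed.

Lemma primitive_from f a : continuous f ->
  exists F, forall t, a < t -> dv F t (f t).
Proof.
move=> cf; exists (fun x => \int[lebesgue_measure]_(t in `[a, x]) f t) => t at_.
have tt : t < t + 1 by rewrite ltrDl.
have [|d e] := @continuous_FTC1_closed R f a t (t + 1) tt _ at_ (cf t).
  apply: continuous_compact_integrable; first exact: segment_compact.
  exact: continuous_subspaceT.
by split; [exact: d|rewrite -derive1E; exact: e].
Qed.

(** Primitives on half lines are glued: two of them that vanish at 0 agree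
    wherever both are defined. *)
Lemma primitive f : continuous f -> exists F, F 0 = 0 /\ forall t, dv F t (f t).
Proof.
move=> cf.
have H n : exists F, F 0 = 0 /\ forall t, - (n%:R) - 1 < t -> dv F t (f t).
  have [F HF] := primitive_from (- n%:R - 1) cf.
  exists (fun t => F t - F 0); rewrite subrr; split => // t /HF d.
  by apply: dv_eq (dvB d (dv_cst (F 0) t)) _; rewrite subr0.
have [Fs HFs] := choice H.
have same n k t : - n%:R - 1 < t -> - k%:R - 1 < t -> Fs n t = Fs k t.
  move=> nt kt.
  have [n0 nd] := HFs n; have [k0 kd] := HFs k.
  suff : Fs n t - Fs k t = Fs n 0 - Fs k 0.
    by rewrite n0 k0 subrr => /eqP; rewrite subr_eq0 => /eqP.
  have dd s : - n%:R - 1 < s -> - k%:R - 1 < s -> dv (fun s => Fs n s - Fs k s) s 0.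
    by move=> ns ks; apply: dv_eq (dvB (nd s ns) (kd s ks)) _; rewrite subrr.
  have n1 : - n%:R - 1 < 0 :> R by rewrite ltrBlDr add0r ltrNl (lt_le_trans (ltrN10 R)).
  have k1 : - k%:R - 1 < 0 :> R by rewrite ltrBlDr add0r ltrNl (lt_le_trans (ltrN10 R)).
  have [t0|/ltW t0] := leP t 0.
    apply/esym; apply: (@mvt_cst (fun s => Fs n s - Fs k s)) => // s /andP[ts s0].
    by apply: dd; exact: lt_le_trans ts.
  apply: (@mvt_cst (fun s => Fs n s - Fs k s)) => // s /andP[ts s0].
  by apply: dd; exact: lt_le_trans ts.
pose N t := Num.bound `|t|.
have tN t : - (N t)%:R - 1 < t.
  have := archi_boundP (normr_ge0 t); rewrite -/(N t).
  have := ler_norm (- t); rewrite normrN.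
  by lra.
exists (fun t => Fs (N t) t); split; first by have [] := HFs (N 0).
move=> t; apply: (@dv_near (Fs (N t))); last by have [_ h] := HFs (N t); exact: h.
near=> s; apply: same; last exact: tN.
near: s; exact: lt_nbhsr.
Unshelve. all: by end_near. Qed.

(** Composition with this retraction onto the unit interval extends functions
    that are continuous there to the whole line. *)
Definition clamp (t : R) : R := Num.max 0 (Num.min t 1).

Lemma clamp_itv t : 0 <= clamp t <= 1.
Proof. by rewrite /clamp le_max lexx /= ge_max ler01 /= ge_min lexx orbT. Qed.

Lemma clamp_id t : 0 <= t <= 1 -> clamp t = t.
Proof. by move=> /andP[t0 t1]; rewrite /clamp min_l // max_r. Qed.

Lemma clamp_continuous : continuous clamp.
Proof.
move=> t; apply: (@continuous_max _ _ (cst 0) (fun t => Num.min t 1)).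
  exact: cst_continuous.
by apply: (@continuous_min _ _ id (cst 1)); [exact: id|exact: cst_continuous].
Qed.

(** The integrand may be arbitrary outside the interval, as periodic states of
    the master equation are. *)
Lemma Rintegral_primitive f : (forall t, 0 <= t <= 1 -> {for t, continuous f}) ->
  exists F, (forall t, 0 <= t <= 1 -> dv F t (f t)) /\
    \int[lebesgue_measure]_(t in `[0, 1]) f t = F 1 - F 0.
Proof.
move=> cf.
have cfc : continuous (f \o clamp).
  move=> t; apply: continuous_comp; first exact: clamp_continuous.
  exact/cf/clamp_itv.
have [F [_ HF]] := primitive cfc.
have HF01 t : 0 <= t <= 1 -> dv F t (f t).
  by move=> t01; have := HF t; rewrite /= clamp_id.
exists F; split => //.
have -> : \int[lebesgue_measure]_(t in `[0, 1]) f t =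
    \int[lebesgue_measure]_(t in `[0, 1]) (f \o clamp) t.
  apply: eq_Rintegral => t; rewrite inE /= in_itv /= => t01.
  by rewrite clamp_id.
rewrite /Rintegral (@continuous_FTC2 _ (f \o clamp) F) //.
- exact: continuous_subspaceT.
- have cF t : {for t, continuous F} by exact: dv_continuous (HF t).
  split; first by move=> t _; case: (HF t).
    by apply: cvg_at_right_filter; exact: cF.
  by apply: cvg_at_left_filter; exact: cF.
- by move=> t _; rewrite derive1E; case: (HF t).
Qed.

(** Cousin's principle: let [c] be the supremum of the ends [s] for which [P a s]
    holds; a small interval around [c] shows that [c] is one of them and that
    nothing lies beyond it. *)
Lemma cousin (P : R -> R -> Prop) a b : a <= b ->
  (forall r s t, r <= s -> s <= t -> P r s -> P s t -> P r t) ->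
  (forall t, a <= t <= b -> exists2 e, 0 < e & forall r s,
     a <= r -> s <= b -> r <= t <= s -> t - e < r -> s < t + e -> P r s) ->
  P a b.
Proof.
move=> ab Padd Ploc.
pose S := [set s | a <= s <= b /\ P a s].
have Sa : S a.
  split; first by rewrite lexx.
  have [|e e0 H] := Ploc a; first by rewrite lexx.
  by apply: H; rewrite ?lexx // ?ltrDl // ltrBlDr ltrDl.
have Sub : has_ubound S by exists b => s [/andP[_]].
have hS : has_sup S by split => //; exists a.
set c := sup S.
have ac : a <= c by exact: ub_le_sup.
have cb : c <= b by apply: ge_sup; [exists a|move=> s [/andP[_]]].
have [|e e0 H] := Ploc c; first by rewrite ac.
have [s [/andP[as_ sb] Ps] cs] := sup_adherent e0 hS.
have sc : s <= c by apply: ub_le_sup => //; split => //; rewrite as_.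
have Pc u : c <= u -> u <= b -> u < c + e -> P a u.
  move=> cu ub ue; apply: (Padd _ _ _ as_ _ Ps); first exact: le_trans cu.
  by apply: H => //; apply/andP.
have [cbl|] := ltP c b; last first.
  move=> bc; apply: (Pc b) => //; apply: le_lt_trans bc _; by rewrite ltrDl.
pose u := Num.min b (c + e / 2).
have ce : c < c + e / 2 by rewrite ltrDl divr_gt0.
have cu : c < u by rewrite /u lt_min cbl ce.
have Su : S u.
  have ub : u <= b by rewrite /u ge_min lexx.
  split; first by rewrite ub (le_trans ac) // ltW.
  apply: Pc => //; first exact: ltW.
  by rewrite /u gt_min ltrD2l ltr_pdivrMr // ltr_pMr // ltr1n orbT.
by have := ub_le_sup Sub Su; rewrite leNgt cu.
Qed.

(** The quantity [(V - q / p) * expR (p * t)] does not increase. An excess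
    of [V 0] over [q / p] would thus shrink by the factor [expR p] until time 1,
    against [V 0 = V 1]. *)
Lemma periodic_decay (V V' : R -> R) (p q : R) : 0 < p ->
  (forall t, 0 <= t <= 1 -> dv V t (V' t)) ->
  (forall t, 0 <= t <= 1 -> V' t <= - p * V t + q) -> V 0 = V 1 ->
  forall t, 0 <= t <= 1 -> V t <= q / p.
Proof.
move=> p0 dV HV V01.
pose U t := (V t - q / p) * expR (p * t).
have pn0 : p != 0 by exact: lt0r_neq0.
have dU t : 0 <= t <= 1 -> dv U t ((V' t + p * V t - q) * expR (p * t)).
  move=> t01; apply: dv_eq (dvM (dvB (dV t t01) (dv_cst (q / p) t))
    (dv_exp (dvZ p (dv_id t)))) _.
  by field.
have Uni s t : 0 <= s -> s <= t -> t <= 1 -> U t <= U s.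
  move=> s0 st t1; apply: (mvt_le st) => r /andP[sr rt].
    by apply: dU; rewrite (le_trans s0) // (le_trans rt).
  rewrite mulr_le0_ge0 ?expR_ge0 // subr_le0 -lerBrDr addrC -mulNr.
  by apply: HV; rewrite (le_trans s0) // (le_trans rt).
have V0 : V 0 - q / p <= 0.
  have := Uni 0 1 (lexx 0) ler01 (lexx 1).
  rewrite /U V01 mulr0 mulr1 expR0 mulr1 leNgt => H.
  rewrite leNgt; apply: contra H => V0.
  by rewrite ltr_pMr // expR_gt1.
move=> t /andP[t0 t1]; rewrite -subr_le0 -(pmulr_lle0 _ (expR_gt0 (p * t))).
apply: le_trans (Uni 0 t (lexx 0) t0 t1) _.
by rewrite /U mulr0 expR0 mulr1.
Qed.

Lemma exp_growth_pos F f (c mu : R) : 0 < mu -> F 0 = 0 ->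
  (forall t, 0 <= t -> dv F t (f t)) ->
  (forall t, 0 <= t -> f t <= c * mu * expR (mu * t)) ->
  forall t, 0 <= t -> F t <= c * (expR (mu * t) - 1).
Proof.
move=> mu0 F0 dF Hf t t0.
have := @mvt_le (fun s => F s - c * (expR (mu * s) - 1))
  (fun s => f s - c * (mu * expR (mu * s))) 0 t t0.
rewrite F0 mulr0 expR0 subrr mulr0 subr0 subr_le0; apply.
  move=> s /andP[s0 _]; apply: (dvB (dF s s0)); apply: dvZ.
  by apply: dv_eq (dvB (dv_exp (dvZ mu (dv_id s))) (dv_cst 1 s)) _; ring.
by move=> s /andP[s0 _]; rewrite subr_le0 mulrA; exact: Hf.
Qed.

(** The weight [expR (mu * `|t|)] makes integration a contraction by the factor
    [mu^-1], on the whole line at once. *)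
Lemma exp_growth F f (c mu : R) : 0 < mu -> F 0 = 0 ->
  (forall t, dv F t (f t)) ->
  (forall t, `|f t| <= c * mu * expR (mu * `|t|)) ->
  forall t, `|F t| <= c * expR (mu * `|t|).
Proof.
move=> mu0 F0 dF Hf.
have c0 : 0 <= c.
  have := le_trans (normr_ge0 _) (Hf 0).
  by rewrite normr0 mulr0 expR0 mulr1 pmulr_lge0.
have pos F1 f1 t : F1 0 = 0 -> (forall t, dv F1 t (f1 t)) ->
    (forall t, `|f1 t| <= c * mu * expR (mu * `|t|)) ->
    0 <= t -> F1 t <= c * expR (mu * `|t|).
  move=> F10 dF1 Hf1 t0; apply: (@le_trans _ _ (c * (expR (mu * t) - 1))).
    apply: (@exp_growth_pos F1 f1) => // s s0.
    by apply: le_trans (ler_norm _) _; have := Hf1 s; rewrite (ger0_norm s0).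
  by rewrite (ger0_norm t0) ler_wpM2l // gerBl.
have dNN s (F1 : R -> R) f1 : (forall t, dv F1 t (f1 t)) ->
    dv (fun s => F1 (- s)) s (- f1 (- s)).
  by move=> d; apply: dv_eq (dv_comp (d (- s)) (dvN (dv_id s))) _; rewrite mulrN1.
move=> t; rewrite ler_norml; apply/andP; split.
  rewrite lerNl; have [t0|/ltW t0] := leP 0 t.
    apply: (pos (fun s => - F s) (fun s => - f s)) => //.
    - by rewrite F0 oppr0.
    - by move=> s; exact: dvN.
    - by move=> s; rewrite normrN.
  have := pos (fun s => - F (- s)) (fun s => f (- s)) (- t).
  rewrite opprK normrN; apply.
  - by rewrite oppr0 F0 oppr0.
  - by move=> s; apply: dv_eq (dvN (dNN s _ _ dF)) _; rewrite opprK.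
  - by move=> s; have := Hf (- s); rewrite normrN.
  - by rewrite oppr_ge0.
have [t0|/ltW t0] := leP 0 t; first exact: (pos F f).
have := pos (fun s => F (- s)) (fun s => - f (- s)) (- t).
rewrite opprK normrN; apply.
- by rewrite oppr0 F0.
- by move=> s; exact: dNN.
- by move=> s; rewrite normrN; have := Hf (- s); rewrite normrN.
- by rewrite oppr_ge0.
Qed.

End Calculus.

(** * Linear differential equations *)

Section LinearODE.
Variable R : realType.

Lemma small_pow2 (c e : R) : 0 < e -> exists k : nat, c / 2 ^+ k < e.
Proof.
move=> e0; exists (Num.bound `|c / e|).
set k := Num.bound _.
rewrite ltr_pdivrMr ?exprn_gt0 // mulrC -ltr_pdivrMr //.
apply: le_lt_trans (ler_norm _) _; apply: lt_trans (archi_boundP (normr_ge0 _)) _.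
by rewrite -/k -natrX ltr_nat ltn_expl.
Qed.

Lemma geometric_cauchy (u : nat -> R) c :
  (forall k, `|u k.+1 - u k| <= c / 2 ^+ k) ->
  exists l, forall k, `|l - u k| <= 2 * c / 2 ^+ k.
Proof.
move=> H.
(* The intervals of radius [d k] around [u k] are nested. *)
pose d k : R := 2 * c / 2 ^+ k.
have dS k : d k = d k.+1 + c / 2 ^+ k.
  by rewrite /d exprS; field; rewrite expf_neq0.
have zi k m : (k <= m)%N -> u k - d k <= u m - d m.
  move/subnK <-; elim: (m - k)%N => [|j IH] //; rewrite addSn.
  apply: le_trans IH _; have := H (j + k)%N; rewrite (dS (j + k)%N) ler_norml.
  by lra.
have wi k m : (k <= m)%N -> u m + d m <= u k + d k.
  move/subnK <-; elim: (m - k)%N => [|j IH] //; rewrite addSn.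
  apply: le_trans IH; have := H (j + k)%N; rewrite (dS (j + k)%N) ler_norml.
  by lra.
have d0 k : 0 <= d k.
  have c0 : 0 <= c by have := le_trans (normr_ge0 _) (H 0); rewrite expr0 divr1.
  by rewrite divr_ge0 ?exprn_ge0 // mulr_ge0.
have zw k m : u k - d k <= u m + d m.
  have := zi _ _ (leq_maxl k m); have := wi _ _ (leq_maxr k m).
  have := d0 (maxn k m); by lra.
pose S := range (fun k => u k - d k).
have Sub k : ubound S (u k + d k) by move=> _ [m _ <-].
exists (sup S) => k; rewrite -/(d k) ler_distl; apply/andP; split.
  by apply: ub_le_sup; [exists (u 0 + d 0)|exists k].
by apply: ge_sup; [exists (u 0 - d 0); exists 0|exact: Sub].
Qed.

Variables (n : nat) (K : 'I_n -> 'I_n -> R -> R) (L : R).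
Hypothesis K_cont : forall i j, continuous (K i j).
Hypothesis K_bound : forall i j t, `|K i j t| <= L.
Variable v : 'I_n -> R.

Lemma continuous_linear_field (q : 'I_n -> R -> R) i :
  (forall j, continuous (q j)) -> continuous (fun t => \sum_j K i j t * q j t).
Proof.
move=> cq t; apply: cvg_big => [|j _]; first exact: add_continuous.
by apply: cvgM; [exact: K_cont|exact: cq].
Qed.

Lemma linear_field_bound (q : 'I_n -> R) i t (c : R) :
  (forall j, `|q j| <= c) -> `|\sum_j K i j t * q j| <= n%:R * `|L| * c.
Proof.
move=> qc; apply: le_trans (ler_norm_sum _ _ _) _.
apply: (@le_trans _ _ (\sum_(j < n) `|L| * c)); last first.
  by rewrite sumr_const card_ord -mulrA mulr_natl.
apply: ler_sum => j _; rewrite normrM ler_pM //.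
by apply: le_trans (K_bound i j t) (ler_norm _).
Qed.

(** Picard iteration started at 0. In the weighted norm of [exp_growth] with
    [mu] more than twice the norm of the field, successive differences halve;
    the limit is continuous, and it solves the equation because it is fixed by
    one further step. *)
Theorem linear_ode : exists p : 'I_n -> R -> R,
  (forall i, p i 0 = v i) /\
  forall i t, dv (p i) t (\sum_j K i j t * p j t).
Proof.
have [prim Hprim] : exists prim : (R -> R) -> R -> R, forall f, continuous f ->
    prim f 0 = 0 /\ forall t, dv (prim f) t (f t).
  have H (f : R -> R) : exists F : R -> R, continuous f ->
      F 0 = 0 /\ forall t, dv F t (f t).
    by have [/primitive[F HF]|nc] := pselect (continuous f); [exists F|exists f].
  by have [prim Hp] := choice H; exists prim.
pose step (q : 'I_n -> R -> R) (i : 'I_n) (t : R) :=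
  v i + prim (fun s => \sum_j K i j s * q j s) t.
have step0 q i : (forall j, continuous (q j)) -> step q i 0 = v i.
  move=> cq; rewrite /step; have [-> _] := Hprim _ (@continuous_linear_field _ i cq).
  by rewrite addr0.
have dstep q i t : (forall j, continuous (q j)) ->
    dv (step q i) t (\sum_j K i j t * q j t).
  move=> cq; have [_ d] := Hprim _ (@continuous_linear_field _ i cq).
  by apply: dv_eq (dvD (dv_cst (v i) t) (d t)) _; rewrite add0r.
pose S := fix S (k : nat) (i : 'I_n) : R -> R :=
  if k is k'.+1 then step (S k') i else (fun=> 0).
have Sc k i : continuous (S k i).
  case: k i => [|k] i t; first exact: cst_continuous.
  elim: k i t => [|k IH] i t; apply: (dv_continuous (dstep _ _ _ _)) => j s.
    exact: cst_continuous.
  exact: IH.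
(* Twice the norm of the field, made positive. *)
pose mu := 2 * (n%:R * `|L|) + 1.
have mu0 : 0 < mu by rewrite ltr_wpDl // !mulr_ge0.
have muL : n%:R * `|L| <= mu / 2 by rewrite /mu; lra.
pose C := \sum_i `|v i|.
have C0 : 0 <= C by exact: sumr_ge0.
have diff k i t : `|S k.+1 i t - S k i t| <= C / 2 ^+ k * expR (mu * `|t|).
  elim: k i t => [|k IH] i t.
    rewrite subr0 expr0 divr1.
    have -> : S 1 i t = v i.
      rewrite -(step0 (S 0) i (Sc 0)); apply: dv0_cst => s.
      apply: dv_eq (dstep (S 0) i s (Sc 0)) _.
      by rewrite big1 // => j _; rewrite mulr0.
    apply: (@le_trans _ _ C); first by rewrite /C (bigD1 i) //= lerDl sumr_ge0.
    by rewrite ler_peMr // -expR0 ler_expR mulr_ge0 // ltW.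
  apply: (@exp_growth _ (fun t => S k.+2 i t - S k.+1 i t)
    (fun t => \sum_j K i j t * (S k.+1 j t - S k j t))) => //.
  - change (step (S k.+1) i 0 - step (S k) i 0 = 0).
    by rewrite !step0 ?subrr //; exact: Sc.
  - move=> s; apply: dv_eq (dvB (dstep _ i s (Sc k.+1)) (dstep _ i s (Sc k))) _.
    by rewrite -sumrB; apply: eq_bigr => j _; rewrite mulrBr.
  - move=> s; apply: le_trans (linear_field_bound i s (fun j => IH j s)) _.
    rewrite mulrA ler_wpM2r ?expR_ge0 // mulrC exprS invfM.
    rewrite [leRHS](_ : _ = C / 2 ^+ k * (mu / 2)); last by rewrite /=; ring.
    by rewrite ler_wpM2l // divr_ge0 // exprn_ge0.
have [p Hp] : exists p : 'I_n -> R -> R, forall i t k,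
    `|p i t - S k i t| <= 2 * (C * expR (mu * `|t|)) / 2 ^+ k.
  have H (it : 'I_n * R) : exists l, forall k,
      `|l - S k it.1 it.2| <= 2 * (C * expR (mu * `|it.2|)) / 2 ^+ k.
    apply: (@geometric_cauchy (fun k => S k it.1 it.2)) => k.
    by apply: le_trans (diff k it.1 it.2) _; rewrite mulrAC.
  by have [p Hp] := choice H; exists (fun i t => p (i, t)) => i t k; exact: (Hp (i, t)).
have pc i : continuous (p i).
  move=> t; apply/cvgrPdist_lt => e e0.
  have [k Hk] := small_pow2 (2 * (C * expR (mu * (`|t| + 1)))) (divr_gt0 e0 (ltr0n R 3)).
  near=> s.
  have sb : `|s| <= `|t| + 1.
    rewrite -(subrK t s) addrC (le_trans (ler_normD _ _)) // lerD2l distrC.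
    near: s; exact: (@cvgr_dist_le _ _ _ (nbhs t) _ id t).
  have mono r : `|r| <= `|t| + 1 ->
      `|p i r - S k i r| < e / 3.
    move=> rb; apply: le_lt_trans (Hp i r k) (le_lt_trans _ Hk).
    rewrite ler_wpM2r ?invr_ge0 ?exprn_ge0 // ler_wpM2l // ler_wpM2l //.
    by rewrite ler_expR ler_wpM2l // ltW.
  have h1 := mono t _; have h2 := mono s sb.
  have h3 : `|S k i t - S k i s| < e / 3.
    near: s; have /cvgrPdist_lt := Sc k i t; apply.
    by rewrite divr_gt0.
  have {}h1 : `|p i t - S k i t| < e / 3 by apply: h1; rewrite lerDl.
  move: h1 h2 h3; rewrite !ltr_norml => /andP[? ?] /andP[? ?] /andP[? ?].
  by apply/andP; split; lra.
have pE i t : step p i t = p i t.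
  apply/eqP; rewrite -subr_eq0 -normr_eq0 eq_le normr_ge0 andbT leNgt.
  apply/negP => /(small_pow2 (2 * (C * expR (mu * `|t|))))[k].
  rewrite ltNge => /negP; apply.
  have H : `|step p i t - S k.+1 i t| <= C / 2 ^+ k * expR (mu * `|t|).
    apply: (@exp_growth _ (fun t => step p i t - S k.+1 i t)
      (fun t => \sum_j K i j t * (p j t - S k j t))) => //.
    - change (step p i 0 - step (S k) i 0 = 0).
      by rewrite !step0 ?subrr //; exact: Sc.
    - move=> s; apply: dv_eq (dvB (dstep _ i s pc) (dstep _ i s (Sc k))) _.
      by rewrite -sumrB; apply: eq_bigr => j _; rewrite mulrBr.
    - move=> s; apply: le_trans (linear_field_bound i s (fun j => Hp j s k)) _.
      rewrite [leLHS](_ : _ = n%:R * `|L| * (C / 2 ^+ k * expR (mu * `|s|) * 2)).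
        rewrite [leRHS](_ : _ = mu / 2 * (C / 2 ^+ k * expR (mu * `|s|) * 2)).
          rewrite ler_wpM2r // !mulr_ge0 ?expR_ge0 ?invr_ge0 ?exprn_ge0 //.
        by field; rewrite expf_neq0.
      by ring.
  rewrite -(subrKA (S k.+1 i t)); apply: le_trans (ler_normD _ _) _.
  apply: le_trans (lerD H _) _; first by rewrite distrC; exact: Hp.
  rewrite le_eqVlt exprS; apply/orP; left; apply/eqP; field.
  exact: expf_neq0.
exists p; split => [i|i t]; first by rewrite -pE step0.
by apply: dv_ext (dstep p i t pc).
Unshelve. all: by end_near. Qed.

End LinearODE.

(** * Gibbs measures *)

Section Gibbs.
Variables (R : realType) (T : finType) (m : T -> R).
Hypothesis m_ge0 : forall k, 0 <= m k.
Variable k0 : T.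
Hypothesis mk0 : 0 < m k0.
Implicit Types (beta : R) (e : T -> R).

Definition partition_function beta e := \sum_l m l * expR (- (beta * e l)).

Definition gibbs beta e k := m k * expR (- (beta * e k)) / partition_function beta e.

Lemma partition_function_gt0 beta e : 0 < partition_function beta e.
Proof.
rewrite /partition_function (bigD1 k0) //= ltr_pwDl //.
  by rewrite mulr_gt0 ?expR_gt0.
by rewrite sumr_ge0 // => l _; rewrite mulr_ge0 ?expR_ge0.
Qed.

Lemma gibbs_ge0 beta e k : 0 <= gibbs beta e k.
Proof. by rewrite divr_ge0 ?mulr_ge0 ?expR_ge0 // ltW // partition_function_gt0. Qed.

Lemma gibbs_sum1 beta e : \sum_k gibbs beta e k = 1.
Proof. by rewrite -mulr_suml divff // lt0r_neq0 // partition_function_gt0. Qed.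

Lemma gibbs_le1 beta e k : gibbs beta e k <= 1.
Proof.
rewrite -(gibbs_sum1 beta e) (bigD1 k) //= lerDl sumr_ge0 // => l _.
exact: gibbs_ge0.
Qed.

(** The partition function is at least the single term of index [l]. *)
Lemma gibbs_le beta e k l : 0 < m l ->
  gibbs beta e k <= m k / m l * expR (- (beta * (e k - e l))).
Proof.
move=> ml.
have dl : 0 < m l * expR (- (beta * e l)) by rewrite mulr_gt0 ?expR_gt0.
have -> : m k / m l * expR (- (beta * (e k - e l))) =
    m k * expR (- (beta * e k)) / (m l * expR (- (beta * e l))).
  have -> : - (beta * (e k - e l)) = - (beta * e k) + - (- (beta * e l)) by ring.
  by rewrite expRD (expRN (- (beta * e l))) invfM mulrACA.
rewrite ler_wpM2l ?mulr_ge0 ?expR_ge0 // lef_pV2 ?posrE //.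
  rewrite /partition_function (bigD1 l) //= lerDl sumr_ge0 // => j _.
  by rewrite mulr_ge0 ?expR_ge0.
exact: partition_function_gt0.
Qed.

(** The derivative of the Gibbs measure when the energies [e] move with velocity
    [e']. *)
Definition gibbs' beta e e' k :=
  beta * gibbs beta e k * ((\sum_l gibbs beta e l * e' l) - e' k).

Lemma dv_gibbs beta (e e' : T -> R -> R) t k :
  (forall l, dv (e l) t (e' l t)) ->
  dv (fun s => gibbs beta (e ^~ s) k) t (gibbs' beta (e ^~ t) (e' ^~ t) k).
Proof.
move=> de.
pose w l s := m l * expR (- (beta * e l s)).
have dw l : dv (w l) t (- beta * e' l t * w l t).
  apply: dv_eq (dvZ (m l) (dv_exp (dvN (dvZ beta (de l))))) _.
  by rewrite /w; ring.
have Zn0 : \sum_l w l t != 0 by exact: lt0r_neq0 (partition_function_gt0 beta (e ^~ t)).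
have dZ : dv (fun s => \sum_l w l s) t (\sum_l - beta * e' l t * w l t).
  by apply: dv_sum.
apply: dv_eq (dvM (dw k) (dvV Zn0 dZ)) _.
rewrite /gibbs' /gibbs /partition_function -/(w k t).
have -> : \sum_l - beta * e' l t * w l t =
   - beta * (\sum_l w l t) *
      \sum_l m l * expR (- (beta * e l t)) / (\sum_l w l t) * e' l t.
  rewrite mulr_sumr; apply: eq_bigr => l _.
  by rewrite /w; field.
rewrite -/(w k t); move: (\sum_l w l t) Zn0 => Z Zn0.
by move: (\sum_l _) => X; field.
Qed.

Lemma gibbs'_bound beta e e' (S : R) k : (forall l, `|e' l| <= S) ->
  `|gibbs' beta e e' k| <= `|beta| * gibbs beta e k * (S + S).
Proof.
move=> eS; rewrite /gibbs' 2!normrM (ger0_norm (gibbs_ge0 beta e k)).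
apply: ler_wpM2l; first by apply: mulr_ge0 => //; exact: gibbs_ge0.
apply: le_trans (ler_normB _ _) _; rewrite lerD //.
apply: le_trans (ler_norm_sum _ _ _) _.
apply: (@le_trans _ _ (\sum_l gibbs beta e l * S)).
  by apply: ler_sum => l _; rewrite normrM ger0_norm ?gibbs_ge0 // ler_wpM2l ?gibbs_ge0.
by rewrite -mulr_suml gibbs_sum1 mul1r.
Qed.

Lemma gibbs'_sum0 beta e e' : \sum_k gibbs' beta e e' k = 0.
Proof.
rewrite /gibbs'.
under eq_bigr do rewrite -mulrA mulrBr.
rewrite -mulr_sumr sumrB -mulr_suml gibbs_sum1 mul1r.
by rewrite subrr mulr0.
Qed.

Lemma expR_lowtemp (c : R) : 0 <= c ->
  expR (- (beta * c)) @[beta --> +oo] --> ((c == 0)%:R : R).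
Proof.
rewrite le_eqVlt => /orP[/eqP<-|c0].
  rewrite eqxx; under eq_cvg do rewrite mulr0 oppr0 expR0.
  exact: cvg_cst.
rewrite gt_eqF //=.
apply/cvgrPdist_lt => eps eps0; near=> beta.
rewrite sub0r normrN ger0_norm ?expR_ge0 // expRN invf_plt ?posrE ?expR_gt0 //.
apply: (@lt_le_trans _ _ (1 + beta * c)); last exact: expR_ge1Dx.
rewrite -ltrBlDl -ltr_pdivrMr //.
near: beta; apply: nbhs_pinfty_gt; exact: num_real.
Unshelve. all: by end_near. Qed.

(** Multiplying numerator and denominator by the exponential of the minimal
    energy leaves only exponentials of nonpositive numbers. *)
Lemma gibbs_lowtemp e kmin k : 0 < m kmin -> (forall l, e kmin <= e l) ->
  gibbs beta e k @[beta --> +oo] -->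
    m k * (e k == e kmin)%:R / \sum_l m l * (e l == e kmin)%:R.
Proof.
move=> mkmin emin.
have eE beta l : m l * expR (- (beta * e l)) =
    m l * expR (- (beta * (e l - e kmin))) * expR (- (beta * e kmin)).
  by rewrite -mulrA -expRD; congr (_ * expR _); ring.
have cl l : m l * expR (- (beta * (e l - e kmin))) @[beta --> +oo] -->
    m l * (e l == e kmin)%:R.
  by apply: cvgMr; rewrite -subr_eq0; apply: expR_lowtemp; rewrite subr_ge0.
under eq_cvg => beta.
  rewrite /gibbs /partition_function eE.
  under eq_bigr do rewrite eE.
  rewrite -mulr_suml -mulf_div divff ?mulr1; last by rewrite lt0r_neq0 ?expR_gt0.
  over.
apply: cvgM; first exact: cl.
apply: cvgV; last by apply: cvg_big => [|l _]; [exact: add_continuous|exact: cl].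
apply: lt0r_neq0; rewrite (bigD1 kmin) //= eqxx mulr1 ltr_pwDl // sumr_ge0 // => l _.
by rewrite mulr_ge0.
Qed.

End Gibbs.

(** * Coordinates of a loop *)

Section LoopCoordinates.
Variables (R : realType) (G : graph).
Implicit Types (eta : loop R G).

(** Continuous linear forms commute with derivatives; the forms are given as
    plain functions because coordinates of pairs of matrices are such. *)
Lemma dv_linear_form (V : normedModType R) (l : V -> R) (h : R -> V) t :
  (forall a x y, l (a *: (x - y)) = a * (l x - l y)) -> continuous l ->
  derivable h t 1 -> dv (l \o h) t (l (derive1 h t)).
Proof.
move=> llin lc; rewrite derive1E => hd.
have H : s^-1 *: ((l \o h) (s *: 1 + t) - (l \o h) t) @[s --> 0^'] -->
    l ('D_1 h t).
  under eq_cvg do rewrite /= -[_ *: _]llin.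
  by apply: (@cvg_comp _ _ _ _ l _ _ _ hd); exact: lc.
split; last exact: cvg_lim H.
by apply/cvg_ex; exists (l ('D_1 h t)).
Qed.

Definition coordE eta i t := (eta t).1 ord0 i.
Definition coordW eta a t := (eta t).2 ord0 a.
Definition coordE' eta i t := (derive1 eta t).1 ord0 i.
Definition coordW' eta a t := (derive1 eta t).2 ord0 a.

Let coord1_lin i (a : R) (x y : params R G) :
  (a *: (x - y)).1 ord0 i = a * (x.1 ord0 i - y.1 ord0 i).
Proof. by rewrite !mxE. Qed.

Let coord2_lin i (a : R) (x y : params R G) :
  (a *: (x - y)).2 ord0 i = a * (x.2 ord0 i - y.2 ord0 i).
Proof. by rewrite !mxE. Qed.

Let coord1_cont i : continuous (fun x : params R G => x.1 ord0 i : R).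
Proof.
move=> x; apply: (@cvg_comp _ _ _ fst (fun M : 'rV[R]_(nv G) => M ord0 i) _ (nbhs x.1)).
  exact: cvg_fst.
exact: coord_continuous.
Qed.

Let coord2_cont i : continuous (fun x : params R G => x.2 ord0 i : R).
Proof.
move=> x; apply: (@cvg_comp _ _ _ snd (fun M : 'rV[R]_(ne G) => M ord0 i) _ (nbhs x.2)).
  exact: cvg_snd.
exact: coord_continuous.
Qed.

Let loop_derivable eta t : derivable (eta : R -> params R G) t 1.
Proof. exact: (@loop_smooth _ _ eta 0). Qed.

Lemma dv_coordE eta i t : dv (coordE eta i) t (coordE' eta i t).
Proof.
exact: (dv_linear_form (@coord1_lin i) (@coord1_cont i) (@loop_derivable eta t)).
Qed.

Lemma dv_coordW eta a t : dv (coordW eta a) t (coordW' eta a t).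
Proof.
exact: (dv_linear_form (@coord2_lin a) (@coord2_cont a) (@loop_derivable eta t)).
Qed.

Lemma coordE'_continuous eta i : continuous (coordE' eta i).
Proof.
move=> t; apply: (@dv_continuous _ (coordE' eta i)).
exact: (dv_linear_form (@coord1_lin i) (@coord1_cont i) (@loop_smooth _ _ eta 1 t)).
Qed.

Lemma coordW'_continuous eta i : continuous (coordW' eta i).
Proof.
move=> t; apply: (@dv_continuous _ (coordW' eta i)).
exact: (dv_linear_form (@coord2_lin i) (@coord2_cont i) (@loop_smooth _ _ eta 1 t)).
Qed.

End LoopCoordinates.

(** * Bounds for functions on the circle *)

Section Bounds.
Variable R : realType.

Lemma finite_bound (I : finType) (T : Type) (D : set T) (f : I -> T -> R) :
  (forall i, exists B, forall t, D t -> `|f i t| <= B) ->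
  exists2 B, 0 <= B & forall i t, D t -> `|f i t| <= B.
Proof.
move=> /choice[B HB]; exists (\sum_i `|B i|); first exact: sumr_ge0.
move=> i t Dt; apply: le_trans (HB i t Dt) _; apply: le_trans (ler_norm _) _.
by rewrite (bigD1 i) //= lerDl sumr_ge0.
Qed.

Lemma continuous_bound (f : R -> R) a b : a <= b -> continuous f ->
  exists B, forall t, a <= t <= b -> `|f t| <= B.
Proof.
move=> ab cf.
have cn : {within `[a, b], continuous (fun t => `|f t|)}.
  apply: continuous_subspaceT => t; apply: cvg_norm; exact: cf.
have [c _ Hc] := EVT_max ab cn.
by exists `|f c| => t tab; apply: Hc; rewrite in_itv.
Qed.

(** Shifting by the integer part brings the argument into the unit interval. *)
Lemma periodic_bound (f : R -> R) : continuous f ->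
  (forall t, f (t + 1) = f t) -> exists B, forall t, `|f t| <= B.
Proof.
move=> cf pf; have [B HB] := continuous_bound ler01 cf.
have pn n t : f (t + n%:R) = f t.
  by elim: n => [|n IH]; rewrite ?addr0 // -natr1 addrA pf.
have pz z t : f (t + z%:~R) = f t.
  case: z => n; first exact: pn.
  by rewrite NegzE mulrNz -[in RHS](subrK (n.+1%:R) t) pn.
exists B => t; rewrite -(subrK (Num.floor t)%:~R t) pz; apply: HB.
by rewrite subr_ge0 floor_le_tmp lerBlDl -intrD1 ltW // lt_succ_floor.
Qed.

Lemma is_derive_col n (rho : R -> 'cV[R]_n) t (D : 'cV[R]_n) :
  (forall i, dv (fun s => rho s i ord0) t (D i ord0)) <-> is_derive t 1 rho D.
Proof.
split=> [H|[hd hD] i].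
  have hd : derivable rho t 1.
    by apply/derivable_mxP => i j; rewrite ord1; have [] := H i.
  split => //; rewrite derive_mx //; apply/matrixP => i j.
  by rewrite mxE ord1; have [_ <-] := H i.
split; first by have /derivable_mxP := hd; apply.
by rewrite -hD derive_mx // mxE.
Qed.

Lemma sqr_sum_le (I : finType) (x : I -> R) :
  (\sum_i x i) ^+ 2 <= #|I|%:R * \sum_i x i ^+ 2.
Proof.
rewrite expr2 mulr_suml.
apply: (@le_trans _ _ (\sum_i \sum_j (x i ^+ 2 + x j ^+ 2) / 2)).
  apply: ler_sum => i _; rewrite mulr_sumr; apply: ler_sum => j _.
  rewrite -subr_ge0.
  have -> : (x i ^+ 2 + x j ^+ 2) / 2 - x i * x j = (x i - x j) ^+ 2 / 2 by field.
  by rewrite divr_ge0 ?sqr_ge0.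
rewrite le_eqVlt; apply/orP; left; apply/eqP.
under eq_bigr do rewrite -mulr_suml big_split /= sumr_const.
rewrite -mulr_suml big_split /= sumr_const sumrMnl -[in RHS]mulr_natl.
by rewrite mulr_natl; field.
Qed.

End Bounds.

(** * The current of a distribution and its dissipation *)

Section Adiabatic.
Variables (R : realType) (G : graph) (Gconn : connected_graph G) (i0 : 'I_(nv G)).

Local Notation bT := {ffun 'I_(nv G).-1 -> 'I_(ne G)}.
Local Notation M := (reduced_boundary R i0).

Definition tree_mass (f : bT) : R := basis_det M f ^+ 2.
Definition tree_energy (w : 'I_(ne G) -> R) (f : bT) : R := \sum_k w (f k).
(** Kirchhoff's weights form a Gibbs measure on trees, so the estimates for the
    Boltzmann distribution apply to them as well. *)
Definition tree_prob (beta : R) (w : 'I_(ne G) -> R) : bT -> R :=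
  gibbs tree_mass beta (tree_energy w).
Definition boltzmann (beta : R) (e : 'I_(nv G) -> R) : 'I_(nv G) -> R :=
  gibbs (fun=> 1) beta e.

Lemma tree_mass_ge0 f : 0 <= tree_mass f. Proof. exact: sqr_ge0. Qed.

Lemma tree_mass_gt0 f : (0 < tree_mass f) = (basis_det M f != 0).
Proof. by rewrite /tree_mass exprn_even_gt0. Qed.

Lemma tree_massP : exists f, 0 < tree_mass f.
Proof.
by have [f df] := exists_basis R Gconn i0; exists f; rewrite tree_mass_gt0.
Qed.

Lemma tree_weightE beta (w : 'I_(ne G) -> R) f :
  basis_weight M (fun a => expR (- (beta * w a))) f =
  tree_mass f * expR (- (beta * tree_energy w f)).
Proof.
congr (_ * _); rewrite -expR_sum; congr expR.
by rewrite mulr_sumr sumrN.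
Qed.

(** The current driven by the rate of change [q] of a distribution. *)
Definition current_form beta w (q : 'I_(nv G) -> R) a : R :=
  \sum_f tree_prob beta w f * \sum_i tree_flow R i0 f a i * q i.

Lemma edge_current_form beta (x : params R G) (p : 'cV[R]_(nv G)) a :
  edge_current beta x p a ord0 =
  current_form beta (x.2 ord0) (fun i => (master beta x *m p) i ord0) a.
Proof.
have := @tree_formula R G Gconn i0 (fun a => expR (- (beta * x.2 ord0 a)))
  (khat beta x *m p) (edge_current beta x p).
move=> ->; first last.
- by move=> b; rewrite edge_currentE coboundaryE /khat mul_diag_mx !mxE.
- by move=> b; exact: expR_gt0.
rewrite summxE; apply: eq_bigr => f _; rewrite mxE masterE; congr (_ * _).
  rewrite /tree_prob /gibbs tree_weightE /partition_function.
  by under eq_bigr do rewrite tree_weightE.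
by rewrite mxE.
Qed.

(** Detailed balance: the Boltzmann distribution carries no current. *)
Lemma master_boltzmann beta (x : params R G) :
  master beta x *m (\col_i boltzmann beta (x.1 ord0) i) = 0.
Proof.
rewrite masterE; suff -> : edge_current beta x (\col_i boltzmann beta (x.1 ord0) i) = 0.
  by rewrite mulmx0 oppr0.
apply/matrixP => a b; have -> : b = ord0 := ord1 b; rewrite edge_currentE !mxE /boltzmann /gibbs !mul1r.
have c z : expR z * (expR (- z) / partition_function (fun=> 1) beta (x.1 ord0)) =
    (partition_function (fun=> 1) beta (x.1 ord0))^-1.
  by rewrite mulrA -expRD subrr expR0 mul1r.
by rewrite !c subrr mulr0.
Qed.

Lemma master_sum beta (x : params R G) (p : 'cV[R]_(nv G)) :
  \sum_i (master beta x *m p) i ord0 = 0.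
Proof.
rewrite masterE; under eq_bigr do rewrite mxE.
by rewrite sumrN sum_boundary oppr0.
Qed.

(** Half the rate at which the master equation decreases the sum of
    [expR (beta * E i) * p i ^+ 2] when the parameters are kept fixed. *)
Definition dissipation beta (x : params R G) (p : 'cV[R]_(nv G)) : R :=
  \sum_a expR (- (beta * x.2 ord0 a)) *
   (expR (beta * x.1 ord0 (d0 a)) * p (d0 a) ord0 -
    expR (beta * x.1 ord0 (d1 a)) * p (d1 a) ord0) ^+ 2.

Lemma dissipationE beta (x : params R G) (p : 'cV[R]_(nv G)) :
  \sum_i expR (beta * x.1 ord0 i) * p i ord0 * (master beta x *m p) i ord0 =
  - dissipation beta x p.
Proof.
have uE i : expR (beta * x.1 ord0 i) * p i ord0 = (khat beta x *m p) i ord0.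
  by rewrite /khat mul_diag_mx !mxE.
transitivity (- \sum_a (coboundary R G *m (khat beta x *m p)) a ord0 *
     edge_current beta x p a ord0).
  rewrite masterE.
  transitivity (((khat beta x *m p)^T *m - (boundary R G *m edge_current beta x p))
     ord0 ord0).
    by rewrite [RHS]mxE; apply: eq_bigr => i _; rewrite uE [in RHS]mxE.
  rewrite mulmxN [in LHS]mulmxA [LHS]mxE; congr (- _); rewrite [LHS]mxE; apply: eq_bigr => a _.
  by congr (_ * _); rewrite -[khat beta x *m p in RHS]trmxK -trmx_mul [in RHS]mxE.
congr (- _); apply: eq_bigr => a _.
by rewrite edge_currentE coboundaryE -!uE; ring.
Qed.

(** With [u i = expR (beta * E i) * p i], mass 0 says that a positive weighted
    mean of [u] vanishes, so [u] is bounded by its oscillation. The oscillation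
    is bounded by the differences of [u] along edges, which the dissipation
    controls. *)
Lemma dissipation_coercive beta (x : params R G) (p : 'cV[R]_(nv G)) b :
  \sum_i p i ord0 = 0 ->
  (forall i, expR (- (beta * x.1 ord0 i)) <= b) ->
  (forall a, expR (beta * x.2 ord0 a) <= b) ->
  \sum_i expR (beta * x.1 ord0 i) * p i ord0 ^+ 2 <=
    (nv G)%:R ^+ 3 * (ne G)%:R * b ^+ 2 * dissipation beta x p.
Proof.
move=> p0 Eb Wb.
set n := (nv G)%:R : R; set m := (ne G)%:R : R.
pose u i := expR (beta * x.1 ord0 i) * p i ord0.
have pE i : p i ord0 = expR (- (beta * x.1 ord0 i)) * u i.
  by rewrite /u mulrA -expRD addNr expR0 mul1r.
have b0 : 0 <= b by apply: le_trans (Eb i0); exact: expR_ge0.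
pose D a := u (d0 a) - u (d1 a).
have uij i j : `|u i - u j| <= n * \sum_a `|D a|.
  have := potential_diff Gconn (\col_i u i) i j; rewrite !mxE.
  by under eq_bigr do rewrite coboundaryE !mxE.
have ub i : `|u i| <= n * \sum_a `|D a|.
  pose Z := \sum_j expR (- (beta * x.1 ord0 j)).
  have Z0 : 0 < Z.
    by rewrite /Z (bigD1 i0) //= ltr_pwDl ?expR_gt0 // sumr_ge0 // => j _; exact: expR_ge0.
  have : u i * Z = \sum_j expR (- (beta * x.1 ord0 j)) * (u i - u j).
    under [RHS]eq_bigr do rewrite mulrBr -pE.
    by rewrite sumrB p0 subr0 -mulr_suml mulrC.
  move=> e; rewrite -(ler_pM2r Z0) -[X in `|_| * X](gtr0_norm Z0) -normrM e.
  apply: le_trans (ler_norm_sum _ _ _) _; rewrite mulr_sumr; apply: ler_sum => j _.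
  by rewrite normrM ger0_norm ?expR_ge0 // mulrC ler_wpM2r ?expR_ge0.
have D2 : (\sum_a `|D a|) ^+ 2 <= m * b * dissipation beta x p.
  apply: le_trans (sqr_sum_le _) _; rewrite card_ord -mulrA ler_wpM2l //.
  rewrite /dissipation mulr_sumr; apply: ler_sum => a _.
  rewrite -/(D a) mulrA real_normK ?num_real // -[leLHS]mul1r ler_wpM2r ?sqr_ge0 //.
  apply: (@le_trans _ _ (expR (beta * x.2 ord0 a) * expR (- (beta * x.2 ord0 a)))).
    by rewrite -expRD subrr expR0.
  by rewrite ler_wpM2r ?expR_ge0.
apply: (@le_trans _ _ (\sum_(i < nv G) b * (n ^+ 2 * (m * b * dissipation beta x p)))).
  apply: ler_sum => i _.
  have -> : expR (beta * x.1 ord0 i) * p i ord0 ^+ 2 =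
      expR (- (beta * x.1 ord0 i)) * u i ^+ 2.
    by rewrite /u exprMn expr2 !mulrA -expRD addNr expR0 mul1r.
  apply: ler_pM; rewrite ?expR_ge0 ?sqr_ge0 //.
  apply: le_trans (_ : (n * \sum_a `|D a|) ^+ 2 <= _).
    by rewrite -real_normK ?num_real // lerXn2r ?nnegrE // mulr_ge0 // sumr_ge0.
  by rewrite exprMn ler_wpM2l // exprn_ge0.
by rewrite sumr_const card_ord -mulr_natl -/n le_eqVlt; apply/orP; left; apply/eqP; ring.
Qed.

End Adiabatic.

(** * Decay of the free energy *)

Section PeriodicState.
Variables (R : realType) (G : graph) (Gconn : connected_graph G) (i0 : 'I_(nv G)).
Variables (beta : R) (eta : loop R G).

(** The free energy [V] of [q], the sum of [expR (beta * E i) * q i ^+ 2], satisfies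
    [V' <= - c * tau * V + c' * S ^+ 2 / tau] for large [tau]: the dissipation
    dominates the drift of the weights, and the forcing [s] is absorbed by
    Young's inequality with parameter proportional to [tau]. Periodicity turns
    this into a bound. Taking [S = 0] gives uniqueness of periodic states. *)
Lemma energy_estimate : exists C tau0 : R, [/\ 0 <= C, 0 < tau0 &
  forall (tau S : R) (q : R -> 'cV[R]_(nv G)) (s : 'I_(nv G) -> R -> R),
  tau0 <= tau -> 0 <= S ->
  (forall t, 0 <= t <= 1 -> \sum_i q t i ord0 = 0) -> q 0 = q 1 ->
  (forall t i, 0 <= t <= 1 -> dv (fun t => q t i ord0) t
     (tau * (master beta (eta t) *m q t) i ord0 - s i t)) ->
  (forall t i, 0 <= t <= 1 -> `|s i t| <= S) ->
  forall t i, 0 <= t <= 1 -> `|q t i ord0| <= C * S / tau].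
Proof.
have [B B0 HB] : exists2 B, 0 <= B & forall i t, 0 <= t <= 1 ->
    `|coordE' eta i t| <= B.
  apply: (@finite_bound _ _ _ [set t | 0 <= t <= 1]) => i.
  exact: continuous_bound ler01 (@coordE'_continuous _ _ eta i).
have [BE BE0 HBE] : exists2 B, 0 <= B & forall i t, 0 <= t <= 1 ->
    `|coordE eta i t| <= B.
  apply: (@finite_bound _ _ _ [set t | 0 <= t <= 1]) => i.
  apply: (continuous_bound ler01) => t; exact: dv_continuous (dv_coordE eta i t).
have [BW BW0 HBW] : exists2 B, 0 <= B & forall i t, 0 <= t <= 1 ->
    `|coordW eta i t| <= B.
  apply: (@finite_bound _ _ _ [set t | 0 <= t <= 1]) => i.
  apply: (continuous_bound ler01) => t; exact: dv_continuous (dv_coordW eta i t).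
pose b := expR (`|beta| * (BE + BW)).
have b1 : 1 <= b by rewrite -expR0 ler_expR mulr_ge0 // addr_ge0.
have b0 : 0 < b by exact: expR_gt0.
have bE y : `|y| <= BE + BW -> expR (beta * y) <= b /\ expR (- (beta * y)) <= b.
  move=> yB; have h : `|beta * y| <= `|beta| * (BE + BW) by rewrite normrM ler_wpM2l.
  by rewrite !ler_expR; move: h; rewrite ler_norml => /andP[]; split; lra.
have kB t i : 0 <= t <= 1 -> expR (beta * coordE eta i t) <= b /\
    expR (- (beta * coordE eta i t)) <= b.
  by move=> t01; apply: bE; apply: le_trans (HBE i t t01) _; rewrite lerDl.
set n := (nv G)%:R : R; set m := (ne G)%:R : R.
have n0 : 0 < n by rewrite /n ltr0n; case: Gconn.
(* The constant of [dissipation_coercive], made positive. *)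
pose P := n ^+ 3 * m * b ^+ 2 + 1.
have P0 : 0 < P by rewrite ltr_wpDl // !mulr_ge0 // ?exprn_ge0 // ltW.
(* For [tau] beyond this threshold the drift of the weights is at most half of
   the decay rate [tau / P]. *)
exists (2 * n * b * P), (2 * P * `|beta| * B + 1); split.
- by rewrite !mulr_ge0 // ltW.
- by rewrite ltr_wpDl // !mulr_ge0 // ltW.
move=> tau S q s tau0 S0 qsum q01 dq sS.
have taup : 0 < tau.
  by apply: lt_le_trans tau0; rewrite ltr_wpDl // !mulr_ge0 // ltW.
pose k i t := expR (beta * coordE eta i t).
pose V t := \sum_i k i t * q t i ord0 ^+ 2.
pose V' t := \sum_i ((k i t * (beta * coordE' eta i t)) * q t i ord0 ^+ 2 + k i t *
  (2 * q t i ord0 * (tau * (master beta (eta t) *m q t) i ord0 - s i t))).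
have dV t : 0 <= t <= 1 -> dv V t (V' t).
  move=> t01; apply: dv_sum => i _; apply: dvM.
    exact: dv_exp (dvZ beta (dv_coordE eta i t)).
  by apply: dv_eq (dvM (dq t i t01) (dq t i t01)) _; ring.
have HV t : 0 <= t <= 1 -> V' t <= - (tau / (2 * P)) * V t + n * b * P * S ^+ 2 / tau.
  move=> t01.
  have V'E : V' t = \sum_i (beta * coordE' eta i t) * (k i t * q t i ord0 ^+ 2)
      - 2 * tau * dissipation beta (eta t) (q t)
      - \sum_i k i t * (2 * q t i ord0 * s i t).
    rewrite -mulrN -dissipationE mulr_sumr -big_split /= -sumrB.
    by apply: eq_bigr => i _; rewrite /k /coordE; ring.
  have coer : V t <= P * dissipation beta (eta t) (q t).
    have d0 : 0 <= dissipation beta (eta t) (q t).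
      by apply: sumr_ge0 => a _; rewrite mulr_ge0 ?expR_ge0 ?sqr_ge0.
    apply: le_trans (@dissipation_coercive R G Gconn i0 beta (eta t) (q t) b _ _ _) _.
    - exact: qsum.
    - by move=> i; case: (kB t i t01).
    - move=> a; apply: (bE ((eta t).2 ord0 a) _).1.
      by apply: le_trans (HBW a t t01) _; rewrite lerDr.
    - by rewrite /P -/n -/m mulrDl mul1r lerDl.
  have first : \sum_i (beta * coordE' eta i t) * (k i t * q t i ord0 ^+ 2) <=
      `|beta| * B * V t.
    rewrite /V mulr_sumr; apply: ler_sum => i _.
    apply: ler_wpM2r; first by rewrite mulr_ge0 ?expR_ge0 ?sqr_ge0.
    by apply: le_trans (ler_norm _) _; rewrite normrM ler_wpM2l // HB.
  have last : - \sum_i k i t * (2 * q t i ord0 * s i t) <=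
      tau / P * V t + n * b * P * S ^+ 2 / tau.
    apply: (@le_trans _ _ (\sum_i (tau / P * (k i t * q t i ord0 ^+ 2) +
       b * P * S ^+ 2 / tau))); last first.
      rewrite big_split /= -mulr_sumr sumr_const card_ord -[X in _ + X]mulr_natl -/n.
      by rewrite -/(V t) le_eqVlt; apply/orP; left; apply/eqP; ring.
    rewrite -sumrN; apply: ler_sum => i _.
    apply: (@le_trans _ _ (k i t * (tau / P * q t i ord0 ^+ 2 + P / tau * S ^+ 2))).
      rewrite -mulrN ler_wpM2l ?expR_ge0 //.
      apply: (@le_trans _ _ (tau / P * q t i ord0 ^+ 2 + P / tau * s i t ^+ 2)).
        rewrite -subr_ge0.
        have -> : tau / P * q t i ord0 ^+ 2 + P / tau * s i t ^+ 2 -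
            - (2 * q t i ord0 * s i t) =
            (tau * q t i ord0 + P * s i t) ^+ 2 / (P * tau).
          by field; rewrite !lt0r_neq0.
        by rewrite divr_ge0 ?sqr_ge0 // mulr_ge0 // ltW.
      rewrite lerD2l ler_wpM2l ?divr_ge0 ?(ltW P0) ?(ltW taup) //.
      by rewrite -real_normK ?num_real // lerXn2r ?nnegrE // sS.
    rewrite mulrDr mulrCA lerD2l.
    have -> : b * P * S ^+ 2 / tau = b * (P / tau * S ^+ 2) by ring.
    rewrite ler_wpM2r ?mulr_ge0 ?sqr_ge0 ?invr_ge0 ?(ltW P0) ?(ltW taup) //.
    by case: (kB t i t01).
  have V0 : 0 <= V t.
    by apply: sumr_ge0 => i _; rewrite mulr_ge0 ?expR_ge0 ?sqr_ge0.
  have h1 : `|beta| * B * V t <= tau / (2 * P) * V t.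
    rewrite ler_wpM2r // ler_pdivlMr ?mulr_gt0 //.
    by apply: le_trans tau0; rewrite -subr_ge0 [X in 0 <= X](_ : _ = 1) //; ring.
  have h2 : 2 * tau * V t / P <= 2 * tau * dissipation beta (eta t) (q t).
    by rewrite ler_pdivrMr // -[leRHS]mulrA ler_wpM2l ?mulr_ge0 ?(ltW taup) // [leRHS]mulrC.
  rewrite V'E.
  have e1 : 2 * tau * V t / P = 2 * (tau / P * V t) by field; rewrite lt0r_neq0.
  have e2 : tau / (2 * P) * V t = tau / P * V t / 2 by field; rewrite lt0r_neq0.
  rewrite mulNr e2; move: h1 h2 first last; rewrite e1 e2.
  by lra.
move=> t i t01.
have Vt := @periodic_decay _ V V' (tau / (2 * P)) (n * b * P * S ^+ 2 / tau)
  _ dV HV _ t t01.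
have {}Vt : V t <= n * b * P * S ^+ 2 / tau / (tau / (2 * P)).
  apply: Vt; first by rewrite divr_gt0 // mulr_gt0.
  rewrite /V; apply: eq_bigr => j _; rewrite /k /coordE.
  by have := loop_periodic eta 0; rewrite add0r q01 => ->.
have qV : q t i ord0 ^+ 2 <= b * V t.
  apply: (@le_trans _ _ (b * (k i t * q t i ord0 ^+ 2))); last first.
    rewrite ler_wpM2l ?(ltW b0) // /V (bigD1 i) //= lerDl sumr_ge0 // => j _.
    by rewrite mulr_ge0 ?expR_ge0 ?sqr_ge0.
  rewrite mulrA -[leLHS]mul1r ler_wpM2r ?sqr_ge0 //.
  apply: (@le_trans _ _ (expR (- (beta * coordE eta i t)) * k i t)).
    by rewrite /k -expRD addNr expR0.
  by rewrite ler_wpM2r ?expR_ge0 //; case: (kB t i t01).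
have C0 : 0 <= 2 * n * b * P * S / tau.
  by rewrite divr_ge0 ?(ltW taup) // !mulr_ge0 // ltW.
rewrite -(@ler_pXn2r _ 2) ?nnegrE // real_normK ?num_real //.
apply: le_trans qV _; apply: le_trans (ler_wpM2l (ltW b0) Vt) _.
have -> : b * (n * b * P * S ^+ 2 / tau / (tau / (2 * P))) =
    (n * 2) * (b * P * S / tau) ^+ 2.
  by field; rewrite !lt0r_neq0.
have -> : (2 * n * b * P * S / tau) ^+ 2 = (n * 2) ^+ 2 * (b * P * S / tau) ^+ 2.
  by field; rewrite lt0r_neq0.
rewrite ler_wpM2r ?sqr_ge0 // expr2 ler_peMr //; first by rewrite mulr_ge0 // ltW.
have : (1 <= nv G)%N by case: Gconn.
by rewrite -(ler_nat R) -/n; lra.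
Qed.

End PeriodicState.

(** * Periodic solutions and the adiabatic limit *)

Section AdiabaticLimit.
Variables (R : realType) (G : graph) (Gconn : connected_graph G) (i0 : 'I_(nv G)).
Variables (beta : R) (eta : loop R G).

Lemma master_entry (x : params R G) i j : master beta x i j =
  - (\sum_a boundary R G i a * expR (- (beta * x.2 ord0 a)) * boundary R G j a)
    * expR (beta * x.1 ord0 j).
Proof.
rewrite /master mxE /khat mul_mx_diag mxE [RHS]mulNr; congr (- (_ * _)); last first.
  by rewrite mxE.
rewrite mxE; apply: eq_bigr => a _.
by rewrite invmx_ghat mul_mx_diag !mxE.
Qed.

Lemma master_entry_continuous i j : continuous (fun t => master beta (eta t) i j).
Proof.
move=> t.
have [d dd] : exists d, dv (fun t =>
   - (\sum_a boundary R G i a * expR (- (beta * coordW eta a t)) * boundary R G j a)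
    * expR (beta * coordE eta j t)) t d.
  eexists; apply: dvM; last exact: dv_exp (dvZ beta (dv_coordE eta j t)).
  apply: dvN; apply: dv_sum => a _; apply: dvM; last exact: dv_cst.
  by apply: dvZ; apply: dv_exp; apply: dvN; apply: dvZ; exact: dv_coordW.
have -> : (fun t => master beta (eta t) i j) = (fun t =>
   - (\sum_a boundary R G i a * expR (- (beta * coordW eta a t)) * boundary R G j a)
    * expR (beta * coordE eta j t)) by apply/funext => s; rewrite master_entry.
exact: dv_continuous dd.
Qed.

(** The return map [Phi] of the equation preserves total mass, so the rows of
    [Phi - 1] are dependent and [Phi] has a fixed vector. It cannot have mass 0
    by [energy_estimate], hence it can be normalised. *)
Lemma exists_periodic_solution : exists2 tau0 : R, 0 < tau0 &
  forall tau, tau0 <= tau -> exists rho, periodic_solution beta tau eta rho.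
Proof.
have [C [tau0 [C0 tau00 H]]] := energy_estimate Gconn i0 beta eta.
exists tau0 => // tau tau0tau.
have taup : 0 < tau by exact: lt_le_trans tau0tau.
pose K i j t := tau * master beta (eta t) i j.
have Kc i j : continuous (K i j).
  move=> t; apply: cvgM; first exact: cvg_cst.
  exact: master_entry_continuous.
have [L L0 HL] : exists2 L, 0 <= L & forall (ij : 'I_(nv G) * 'I_(nv G)) t, setT t ->
    `|K ij.1 ij.2 t| <= L.
  apply: (@finite_bound _ _ _ setT (fun ij => K ij.1 ij.2)) => -[i j] /=.
  have [|B HB] := periodic_bound (Kc i j); last by exists B => t _.
  by move=> t; rewrite /K loop_periodic.
have [Phi HPhi] : exists Phi : 'I_(nv G) -> 'I_(nv G) -> R -> R, forall j,
    (forall i, Phi j i 0 = (i == j)%:R) /\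
    forall i t, dv (Phi j i) t (\sum_l K i l t * Phi j l t).
  have ex j := linear_ode Kc (fun i l t => HL (i, l) t I) (fun i => (i == j)%:R).
  by have [Phi HPhi] := choice ex; exists Phi.
have Phisum j t : \sum_i Phi j i t = 1.
  have <- : \sum_i Phi j i 0 = 1.
    rewrite (bigD1 j) //= big1 => [|i /negbTE ij].
      by case: (HPhi j) => -> _; rewrite eqxx addr0.
    by case: (HPhi j) => -> _; rewrite ij.
  apply: (@dv0_cst R (fun t => \sum_i Phi j i t)) => s.
  apply: dv_eq; first by apply: dv_sum => i _; exact: (HPhi j).2.
  rewrite exchange_big big1 //= => l _; rewrite -mulr_suml -mulr_sumr.
  have := master_sum beta (eta s) (delta_mx l ord0).
  under eq_bigr do rewrite -colE mxE.
  by move=> ->; rewrite mulr0 mul0r.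
pose A : 'M[R]_(nv G) := \matrix_(j, i) (Phi j i 1 - (i == j)%:R).
have [v v0 Av] : exists2 v : 'rV_(nv G), v != 0 & v *m A = 0.
  apply/det0P/eqP; rewrite -det_tr; apply/eqP/det0P.
  exists (const_mx 1).
    apply/eqP => /matrixP/(_ ord0 i0); rewrite !mxE => /eqP; by rewrite oner_eq0.
  apply/matrixP => i j; rewrite !mxE.
  under eq_bigr do rewrite !mxE mul1r.
  rewrite sumrB Phisum (bigD1 j) //= eqxx big1 ?addr0 ?subrr //.
  by move=> l /negbTE->.
pose p t : 'cV[R]_(nv G) := \col_i \sum_j v ord0 j * Phi j i t.
have p0 i : p 0 i ord0 = v ord0 i.
  rewrite mxE (bigD1 i) //= big1 => [|j ji].
    by case: (HPhi i) => -> _; rewrite eqxx mulr1 addr0.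
  by case: (HPhi j) => -> _; rewrite eq_sym (negbTE ji) mulr0.
have p1 : p 0 = p 1.
  apply/colP => i; apply/esym/eqP; rewrite -subr_eq0; apply/eqP.
  have e : \sum_j v ord0 j * (Phi j i 1 - (i == j)%:R) = 0.
    have := congr1 (fun B : 'rV_(nv G) => B ord0 i) Av; rewrite /= mxE [RHS]mxE => h; rewrite -[RHS]h.
    by apply: eq_bigr => j _; rewrite mxE.
  rewrite -[RHS]e !mxE -sumrB; apply: eq_bigr => j _; rewrite -mulrBr; congr (_ * (_ - _)).
  by case: (HPhi j) => ->.
have dp i t : dv (fun t => p t i ord0) t (tau * (master beta (eta t) *m p t) i ord0).
  apply: (@dv_ext _ (fun t => \sum_j v ord0 j * Phi j i t)).
    by move=> s; rewrite mxE.
  apply: dv_eq; first by apply: dv_sum => j _; apply: dvZ; exact: (HPhi j).2.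
  rewrite mxE mulr_sumr.
  under eq_bigr do rewrite mulr_sumr.
  rewrite exchange_big /=; apply: eq_bigr => l _.
  rewrite [p t l ord0]mxE !mulr_sumr; apply: eq_bigr => j _; rewrite /K; ring.
pose c := \sum_j v ord0 j.
have psum t : \sum_i p t i ord0 = c.
  under eq_bigr do rewrite mxE.
  rewrite exchange_big; apply: eq_bigr => j _.
  by rewrite -mulr_sumr Phisum mulr1.
have cn0 : c != 0.
  apply: contra v0 => /eqP c0; apply/eqP/rowP => i; rewrite [RHS]mxE -p0.
  have h1 (t : R) : 0 <= t <= 1 -> \sum_i p t i ord0 = 0 by rewrite psum.
  have h2 (t : R) j : 0 <= t <= 1 -> dv (fun t => p t j ord0) t
      (tau * (master beta (eta t) *m p t) j ord0 - (fun _ _ => 0) j t).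
    by move=> _; rewrite subr0; exact: dp.
  have h3 (t : R) (j : 'I_(nv G)) : 0 <= t <= 1 -> `|(fun _ _ => 0 : R) j t| <= 0.
    by rewrite normr0.
  have := H tau 0 p (fun _ _ => 0) tau0tau (lexx 0) h1 p1 h2 h3 0 i.
  by rewrite mulr0 mul0r normr_le0 lexx ler01 => /(_ isT)/eqP.
exists (fun t => c^-1 *: p t); split.
- move=> t _; under eq_bigr do rewrite mxE.
  by rewrite -mulr_sumr psum mulVf.
- by rewrite p1.
- move=> t _; apply/is_derive_col => i.
  apply: (@dv_ext _ (fun t => c^-1 * p t i ord0)); first by move=> s; rewrite [RHS]mxE.
  apply: dv_eq (dvZ c^-1 (dp i t)) _.
  rewrite -scalemxAr; move: (master _ _ *m _) => w; rewrite !mxE; ring.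
Qed.

Local Notation bT := {ffun 'I_(nv G).-1 -> 'I_(ne G)}.

Definition boltzmann' i t : R :=
  gibbs' (fun=> 1) beta (coordE eta ^~ t) (coordE' eta ^~ t) i.

(** The integrand of the adiabatic current: what the Boltzmann distribution
    drives as it follows the parameters. *)
Definition pump a t : R := current_form i0 beta (coordW eta ^~ t) (boltzmann' ^~ t) a.

Definition current_coef a i t : R :=
  \sum_f tree_prob i0 beta (coordW eta ^~ t) f * tree_flow R i0 f a i.

Lemma current_formE a t (q : 'I_(nv G) -> R) :
  current_form i0 beta (coordW eta ^~ t) q a = \sum_i current_coef a i t * q i.
Proof.
rewrite /current_form.
under eq_bigr do rewrite mulr_sumr.
rewrite exchange_big /=; apply: eq_bigr => i _; rewrite mulr_suml.
by apply: eq_bigr => f _; rewrite mulrA.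
Qed.

Lemma dv_boltzmann i t :
  dv (fun t => boltzmann beta (coordE eta ^~ t) i) t (boltzmann' i t).
Proof.
apply: (@dv_gibbs R _ (fun=> 1) _ i0) => //.
by move=> j; exact: dv_coordE.
Qed.

Lemma current_coef_C1 : exists2 B : R, 0 <= B & exists c' : 'I_(ne G) -> 'I_(nv G) -> R -> R,
  forall a i t, 0 <= t <= 1 -> dv (current_coef a i) t (c' a i t) /\ `|c' a i t| <= B.
Proof.
have [B B0 HB] : exists2 B, 0 <= B & forall a t, 0 <= t <= 1 ->
    `|coordW' eta a t| <= B.
  apply: (@finite_bound _ _ _ [set t | 0 <= t <= 1]) => a.
  exact: continuous_bound ler01 (@coordW'_continuous _ _ eta a).
have [f0 mf0] := tree_massP R Gconn i0.
pose e' (f : bT) t := \sum_k coordW' eta (f k) t.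
pose p' f t := gibbs' (tree_mass R i0) beta (fun f => tree_energy (coordW eta ^~ t) f)
  (e' ^~ t) f.
have dp' f t : dv (fun t => tree_prob i0 beta (coordW eta ^~ t) f) t (p' f t).
  apply: (@dv_gibbs R _ (tree_mass R i0) (tree_mass_ge0 R i0) f0 mf0 beta
    (fun f t => tree_energy (coordW eta ^~ t) f) e') => g.
  by apply: dv_sum => k _; exact: dv_coordW.
pose S := (nv G).-1%:R * B.
have S0 : 0 <= S by rewrite mulr_ge0.
have p'B f t : 0 <= t <= 1 -> `|p' f t| <= `|beta| * (S + S).
  move=> t01; have e'B g : `|e' g t| <= S.
    apply: le_trans (ler_norm_sum _ _ _) _.
    apply: (@le_trans _ _ (\sum_(k < (nv G).-1) B)); first by apply: ler_sum => k _; exact: HB.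
    by rewrite sumr_const card_ord /S mulr_natl.
  have := gibbs'_bound (tree_mass_ge0 R i0) mf0 beta
    (tree_energy (coordW eta ^~ t)) f e'B.
  move=> h; apply: le_trans h _; apply: ler_wpM2r; first exact: addr_ge0.
  by apply: ler_piMr => //; exact: gibbs_le1 (tree_mass_ge0 R i0) _ mf0 _ _ _.
exists (\sum_f `|beta| * (S + S) * \sum_a \sum_i `|tree_flow R i0 f a i|).
  apply: sumr_ge0 => f _; rewrite mulr_ge0 ?mulr_ge0 ?addr_ge0 //.
  by apply: sumr_ge0 => a _; exact: sumr_ge0.
exists (fun a i t => \sum_f p' f t * tree_flow R i0 f a i) => a i t t01; split.
  apply: dv_sum => f _; apply: dv_eq (dvM (dp' f t) (dv_cst (tree_flow R i0 f a i) t)) _.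
  by rewrite mulr0 addr0.
apply: le_trans (ler_norm_sum _ _ _) _; apply: ler_sum => f _.
rewrite normrM ler_pM ?p'B //.
rewrite (bigD1 a) //= (bigD1 i) //= -addrA lerDl addr_ge0 ?sumr_ge0 // => b _.
exact: sumr_ge0.
Qed.

(** For the periodic state [rho] and [q] its distance from the Boltzmann
    distribution, the current minus [pump] is the current of the derivative of
    [q]. By the product rule it is the derivative of a periodic function, linear
    in [q], minus a term linear in [q] without derivatives, which is of order
    [tau^-1] by [energy_estimate]. *)
Theorem adiabatic_estimate a (Psi : R -> R) : (forall t, dv Psi t (pump a t)) ->
  exists C tau0 : R, forall tau, tau0 <= tau ->
    `|average_current beta tau eta a ord0 - (Psi 1 - Psi 0)| <= C / tau.
Proof.
move=> dPsi.
have [C [tau1 [C0 tau10 H]]] := energy_estimate Gconn i0 beta eta.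
have [tau2 tau20 Hex] := exists_periodic_solution.
have [B B0 [c' Hc']] := current_coef_C1.
have [S S0 HS] : exists2 S, 0 <= S & forall i t, 0 <= t <= 1 -> `|boltzmann' i t| <= S.
  have [E' E'0 HE'] : exists2 B, 0 <= B & forall a t, 0 <= t <= 1 ->
      `|coordE' eta a t| <= B.
    apply: (@finite_bound _ _ _ [set t | 0 <= t <= 1]) => i.
    exact: continuous_bound ler01 (@coordE'_continuous _ _ eta i).
  exists (`|beta| * (E' + E')) => [|i t t01]; first by rewrite mulr_ge0 ?addr_ge0.
  have g0 (k : 'I_(nv G)) : 0 <= (fun=> 1 : R) k by exact: ler01.
  have := @gibbs'_bound R _ (fun=> 1) g0 i0 ltr01 beta (coordE eta ^~ t)
    (coordE' eta ^~ t) E' i (fun l => HE' l t t01).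
  move=> h; apply: le_trans h _; apply: ler_wpM2r; first exact: addr_ge0.
  apply: ler_piMr => //; exact: (@gibbs_le1 R _ (fun=> 1) g0 i0 ltr01).
exists ((nv G)%:R * B * (C * S)), (Num.max tau1 tau2) => tau.
rewrite ge_max => /andP[tau1tau tau2tau].
have taup : 0 < tau by exact: lt_le_trans tau1tau.
pose rho := periodic_state beta tau eta.
have [rsum r01 rd] : periodic_solution beta tau eta rho by exact: xgetPex (Hex tau tau2tau).
have tin t : (t \in `[0, 1]) = (0 <= t <= 1 :> bool) by rewrite in_itv.
pose rho' i t := tau * (master beta (eta t) *m rho t) i ord0.
have drho i t : 0 <= t <= 1 -> dv (fun t => rho t i ord0) t (rho' i t).
  move=> t01; have h : t \in `[0, 1] by rewrite tin.
  by have /is_derive_col/(_ i) := rd t h; rewrite mxE.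
pose pi t : 'cV[R]_(nv G) := \col_i boltzmann beta (coordE eta ^~ t) i.
pose q t := rho t - pi t.
have qE i t : q t i ord0 = rho t i ord0 - boltzmann beta (coordE eta ^~ t) i.
  by rewrite !mxE.
have dq t i : 0 <= t <= 1 -> dv (fun t => q t i ord0) t (rho' i t - boltzmann' i t).
  move=> t01; apply: (@dv_ext _
    (fun t => rho t i ord0 - boltzmann beta (coordE eta ^~ t) i)).
    by move=> s; rewrite qE.
  by apply: dvB; [exact: drho|exact: dv_boltzmann].
have q01 : q 0 = q 1.
  rewrite /q r01; congr (_ - _); apply/colP => i; rewrite !mxE.
  by rewrite /coordE -[1]add0r loop_periodic.
have qB t i : 0 <= t <= 1 -> `|q t i ord0| <= C * S / tau.
  apply: (H tau S q boltzmann') => //.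
  - move=> s s01; under eq_bigr do rewrite qE.
    rewrite sumrB rsum ?tin // (@gibbs_sum1 _ _ _ _ i0) ?subrr //.
  - move=> s j s01; apply: dv_eq (dq s j s01) _; congr (_ * _ - _).
    by rewrite /q mulmxBr master_boltzmann subr0.
  - by move=> s j s01; exact: HS.
have JE b r : current beta tau eta r b ord0 =
    \sum_i current_coef b i r * rho' i r.
  rewrite /current mxE.
  have := edge_current_form Gconn i0 beta (eta r) (rho r) b.
  rewrite /edge_current => ->; rewrite -[(eta r).2 ord0]/(fun c => coordW eta c r).
  by rewrite current_formE mulr_sumr; apply: eq_bigr => i _; rewrite /rho'; ring.
have Jc t : 0 <= t <= 1 -> {for t, continuous (fun t => current beta tau eta t a ord0)}.
  move=> t01.
  have -> : (fun t => current beta tau eta t a ord0) = fun t => tau *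
    (expR (- (beta * coordW eta a t)) *
   (expR (beta * coordE eta (d0 a) t) * rho t (d0 a) ord0 -
    expR (beta * coordE eta (d1 a) t) * rho t (d1 a) ord0)).
    apply/funext => s; rewrite mxE -[X in _ * X]/(edge_current beta (eta s) (rho s) a ord0).
    by rewrite edge_currentE.
  have [d dd] : exists d, dv (fun t => tau *
    (expR (- (beta * coordW eta a t)) *
   (expR (beta * coordE eta (d0 a) t) * rho t (d0 a) ord0 -
    expR (beta * coordE eta (d1 a) t) * rho t (d1 a) ord0))) t d.
    eexists; apply: dvZ; apply: dvM.
      exact: dv_exp (dvN (dvZ beta (dv_coordW eta a t))).
    apply: dvB; apply: dvM; try exact: drho.
      exact: dv_exp (dvZ beta (dv_coordE eta _ t)).
    exact: dv_exp (dvZ beta (dv_coordE eta _ t)).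
  exact: dv_continuous dd.
have [F [dF FE]] := Rintegral_primitive Jc.
rewrite mxE FE.
(* The last term is the integration by parts. *)
pose D t := F t - Psi t - \sum_i current_coef a i t * q t i ord0.
have dD t : 0 <= t <= 1 -> dv D t (- \sum_i c' a i t * q t i ord0).
  move=> t01.
  have dS : dv (fun t => \sum_i current_coef a i t * q t i ord0) t
     (\sum_i (c' a i t * q t i ord0 +
         current_coef a i t * (rho' i t - boltzmann' i t))).
    by apply: dv_sum => i _; apply: dvM; [exact: (Hc' a i t t01).1|exact: dq].
  apply: dv_eq (dvB (dvB (dF t t01) (dPsi t)) dS) _.
  rewrite JE /pump current_formE big_split /=.
  have -> : \sum_i current_coef a i t * (rho' i t - boltzmann' i t) =
    \sum_i current_coef a i t * rho' i t - \sum_i current_coef a i t * boltzmann' i t.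
    by rewrite -sumrB; apply: eq_bigr => i _; rewrite mulrBr.
  ring.
have := mvt_bound ler01 dD (C := (nv G)%:R * (B * (C * S / tau))) _.
have -> : D 1 - D 0 = F 1 - F 0 - (Psi 1 - Psi 0).
  rewrite /D q01.
  have -> : \sum_i current_coef a i 1 * q 1 i ord0 = \sum_i current_coef a i 0 * q 1 i ord0.
    apply: eq_bigr => i _; rewrite /current_coef; congr (_ * _); apply: eq_bigr => f _.
    by rewrite /coordW -[1]add0r loop_periodic.
  ring.
rewrite subr0 mulr1 => h.
have -> : (nv G)%:R * B * (C * S) / tau = (nv G)%:R * (B * (C * S / tau)) by ring.
apply: h => t t01; rewrite normrN.
apply: le_trans (ler_norm_sum _ _ _) _.
apply: (@le_trans _ _ (\sum_(i < nv G) B * (C * S / tau))).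
  apply: ler_sum => i _; rewrite normrM ler_pM ?qB //.
  exact: (Hc' a i t t01).2.
by rewrite sumr_const card_ord mulr_natl.
Qed.

Lemma pump_continuous a : continuous (pump a).
Proof.
have Z0 : exists f, 0 < tree_mass R i0 f := tree_massP R Gconn i0.
have [f0 mf0] := Z0.
have cE' i : continuous (coordE' eta i) := @coordE'_continuous _ _ eta i.
have cpi i : continuous (fun t => boltzmann beta (coordE eta ^~ t) i).
  by move=> t; exact: dv_continuous (dv_boltzmann i t).
have cp f : continuous (fun t => tree_prob i0 beta (coordW eta ^~ t) f).
  move=> t; apply: (dv_continuous (@dv_gibbs R _ (tree_mass R i0) (tree_mass_ge0 R i0)
    f0 mf0 beta (fun f t => tree_energy (coordW eta ^~ t) f)
    (fun f t => \sum_k coordW' eta (f k) t) t f _)) => g.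
  by apply: dv_sum => k _; exact: dv_coordW.
move=> t; rewrite /pump /current_form.
apply: cvg_big => [|f _]; first exact: add_continuous.
apply: cvgM; first exact: cp.
apply: cvg_big => [|i _]; first exact: add_continuous.
apply: cvgM; first exact: cvg_cst.
rewrite /boltzmann' /gibbs'.
apply: cvgM; first by apply: cvgM; [exact: cvg_cst|exact: cpi].
apply: cvgB; last exact: cE'.
apply: cvg_big => [|j _]; first exact: add_continuous.
by apply: cvgM; [exact: cpi|exact: cE'].
Qed.

Lemma cvg_col n (T : Type) (F : set_system T) (FF : Filter F)
    (u : T -> 'cV[R]_n) (l : 'cV[R]_n) :
  (forall i, u x i ord0 @[x --> F] --> l i ord0) -> u x @[x --> F] --> l.
Proof.
move=> H; apply/cvgrPdist_le => e e0; near=> x.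
rewrite /Num.Def.normr/= mx_normrE (bigmax_le _ (ltW e0))//= => -[i j] _ /=.
rewrite !mxE (ord1 j); move: i; near: x; apply: filter_forall => i.
by have /cvgrPdist_le := H i; apply.
Unshelve. all: by end_near. Qed.

Theorem adiabatic_currentE (Psi : 'I_(ne G) -> R -> R) :
  (forall a t, dv (Psi a) t (pump a t)) ->
  adiabatic_current beta eta = \col_a (Psi a 1 - Psi a 0).
Proof.
move=> dPsi; apply: cvg_lim => //; apply: cvg_col => a; rewrite mxE.
have [C [tau0 H]] := adiabatic_estimate (dPsi a).
apply/cvgrPdist_le => e e0; near=> tau.
have tau1 : 0 < tau by near: tau; apply: nbhs_pinfty_gt; exact: num_real.
rewrite distrC; apply: le_trans (H tau _) _.
  by near: tau; apply: nbhs_pinfty_ge; exact: num_real.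
have : C / e <= tau by near: tau; apply: nbhs_pinfty_ge; exact: num_real.
by rewrite ler_pdivrMr // ler_pdivrMr // mulrC.
Unshelve. all: by end_near. Qed.

End AdiabaticLimit.

(** * Low temperature near a nondegenerate point *)

Section FiniteGap.
Variable R : realType.

Lemma finite_lower_bound (I : finType) (P : pred I) (h : I -> R) :
  (forall i, P i -> 0 < h i) -> exists2 d, 0 < d & forall i, P i -> d <= h i.
Proof.
move=> H; exists (\big[Num.min/1]_(i | P i) h i).
  by elim/big_ind : _ => // x y x0 y0; rewrite lt_min x0.
by move=> i Pi; exact: bigmin_le_cond.
Qed.

(** A small change of finitely many energies keeps every strict inequality
    between them, with a uniform margin. *)
Lemma strict_gap (T : finType) (e : T -> R) :
  exists d, 0 < d /\ forall e' : T -> R, (forall k, `|e' k - e k| < d) ->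
    forall k l, e l < e k -> d <= e' k - e' l.
Proof.
have [d d0 Hd] := @finite_lower_bound (T * T)%type (fun kl => e kl.2 < e kl.1)
  (fun kl => e kl.1 - e kl.2) (fun kl => ltac:(by rewrite subr_gt0)).
exists (d / 3); split; first by rewrite divr_gt0.
move=> e' He' k l kl; have := Hd (k, l) kl; have := He' k; have := He' l.
by rewrite /= !ltr_norml => /andP[? ?] /andP[? ?]; lra.
Qed.

Lemma beta_exp_cvg0 (d : R) : 0 < d ->
  beta * expR (- (beta * d)) @[beta --> +oo] --> 0.
Proof.
move=> d0.
have e2 : 2^-1 * d != 0 by rewrite mulf_neq0 // gt_eqF.
have h : expR (- (beta * (2^-1 * d))) @[beta --> +oo] --> 0.
  have := @expR_lowtemp R (2^-1 * d); rewrite (negbTE e2); apply.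
  by rewrite mulr_ge0 // ltW.
apply/cvgrPdist_le => e e0.
have /cvgrPdist_le/(_ (e * (2^-1 * d))) := h.
rewrite !mulr_gt0 // => /(_ isT) hh.
near=> beta.
have b0 : 0 <= beta by near: beta; apply: nbhs_pinfty_ge; exact: num_real.
have : `|0 - expR (- (beta * (2^-1 * d)))| <= e * (2^-1 * d) by near: beta.
rewrite !sub0r !normrN (ger0_norm (expR_ge0 _)) => he.
rewrite ger0_norm ?mulr_ge0 ?expR_ge0 //.
have -> : - (beta * d) = - (beta * (2^-1 * d)) + - (beta * (2^-1 * d)) by field.
rewrite expRD mulrA.
have hb : beta * (2^-1 * d) * expR (- (beta * (2^-1 * d))) <= 1.
  rewrite expRN ler_pdivrMr ?expR_gt0 // mul1r.
  by apply: le_trans (expR_ge1Dx _); rewrite lerDr.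
have p0 : 0 < 2^-1 * d by rewrite mulr_gt0.
rewrite -(ler_pM2r p0); apply: le_trans he.
rewrite -[leRHS]mul1r.
have -> : beta * expR (- (beta * (2^-1 * d))) * expR (- (beta * (2^-1 * d))) * (2^-1 * d)
  = beta * (2^-1 * d) * expR (- (beta * (2^-1 * d))) * expR (- (beta * (2^-1 * d))).
  by ring.
by rewrite ler_wpM2r ?expR_ge0.
Unshelve. all: by end_near. Qed.

Lemma squeeze0 (u v : R -> R) (C : R) :
  v b @[b --> +oo] --> 0 ->
  (forall b, 0 <= b -> `|u b| <= C * v b) -> u b @[b --> +oo] --> 0.
Proof.
move=> v0 H; apply/cvgrPdist_le => e e0.
have /cvgrPdist_le : C * v b @[b --> +oo] --> 0.
  by rewrite -(mulr0 C); apply: cvgM => //; exact: cvg_cst.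
move=> /(_ e e0) h; near=> b.
have b0 : 0 <= b by near: b; apply: nbhs_pinfty_ge; exact: num_real.
have : `|0 - C * v b| <= e by near: b.
rewrite !sub0r !normrN; apply: le_trans; apply: le_trans (H b b0) _.
exact: ler_norm.
Unshelve. all: by end_near. Qed.

End FiniteGap.

Section LocalAnalysis.
Variables (R : realType) (G : graph) (Gconn : connected_graph G) (i0 : 'I_(nv G)).

Local Notation bT := {ffun 'I_(nv G).-1 -> 'I_(ne G)}.
Local Notation M := (reduced_boundary R i0).
Local Notation tf := (tree_flow R i0).

Definition is_min (e : 'I_(nv G) -> R) i := forall j, e i <= e j.

Definition is_mst (w : 'I_(ne G) -> R) (f : bT) := 0 < tree_mass R i0 f /\
  forall g, 0 < tree_mass R i0 g -> tree_energy w f <= tree_energy w g.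

(** The exceptional set. At a nondegenerate point the minimal trees may be many,
    but they agree on how charge moves between minimal vertices. *)
Definition degenerate : set (params R G) := [set x : params R G | exists i j f g,
  [/\ is_min (x.1 ord0) i, is_min (x.1 ord0) j, is_mst (x.2 ord0) f,
      is_mst (x.2 ord0) g & exists a, tf f a i - tf f a j <> tf g a i - tf g a j]].

Definition close_params (x y : params R G) r := (forall i, `|y.1 ord0 i - x.1 ord0 i| < r) /\
  (forall a, `|y.2 ord0 a - x.2 ord0 a| < r).

Lemma exists_min e : exists i, is_min e i.
Proof.
exists [arg min_(i < i0) e i]%O => j.
by case: arg_minP => // i _; apply.
Qed.

Lemma exists_mst w : exists f, is_mst w f.
Proof.
have [f0 mf0] := tree_massP R Gconn i0.
exists [arg min_(f < f0 | 0 < tree_mass R i0 f) tree_energy w f]%O.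
by case: arg_minP => // f mf H; split.
Qed.

Lemma boltzmann_le beta (e : 'I_(nv G) -> R) i j : boltzmann beta e i <= expR (- (beta * (e i - e j))).
Proof.
have := @gibbs_le R _ (fun=> 1) (fun=> ler01) i0 ltr01 beta e i j ltr01.
by rewrite divr1 mul1r.
Qed.

Lemma boltzmann_ge0 beta (e : 'I_(nv G) -> R) i : 0 <= boltzmann beta e i.
Proof. exact: (@gibbs_ge0 R _ (fun=> 1) (fun=> ler01) i0 ltr01). Qed.

Lemma boltzmann_sum1 beta (e : 'I_(nv G) -> R) : \sum_i boltzmann beta e i = 1.
Proof. exact: (@gibbs_sum1 R _ (fun=> 1) (fun=> ler01) i0 ltr01). Qed.

Lemma boltzmann_le1 beta (e : 'I_(nv G) -> R) i : boltzmann beta e i <= 1.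
Proof. exact: (@gibbs_le1 R _ (fun=> 1) (fun=> ler01) i0 ltr01). Qed.

Lemma close_gap (x : params R G) : exists r d : R, [/\ 0 < r, 0 < d &
  forall y, close_params x y r ->
   (forall i i1, is_min (x.1 ord0) i1 -> ~ is_min (x.1 ord0) i ->
      d <= y.1 ord0 i - y.1 ord0 i1) /\
   (forall f f1, is_mst (x.2 ord0) f1 -> 0 < tree_mass R i0 f -> ~ is_mst (x.2 ord0) f ->
      d <= tree_energy (y.2 ord0) f - tree_energy (y.2 ord0) f1)].
Proof.
have [d1 [d10 H1]] := strict_gap (x.1 ord0).
have [d2 [d20 H2]] := strict_gap (tree_energy (x.2 ord0) : bT -> R).
pose n : R := (nv G).-1%:R + 1.
have n0 : 0 < n by rewrite ltr_wpDl.
exists (Num.min d1 (d2 / n)), (Num.min d1 d2); split.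
- by rewrite lt_min d10 divr_gt0.
- by rewrite lt_min d10.
move=> y [yE yW]; split.
  move=> i i1 mi1 mi; rewrite ge_min H1 //.
    by move=> k; have := yE k; rewrite lt_min => /andP[].
  rewrite ltNge; apply/negP => h; apply: mi => j; exact: le_trans (mi1 j).
move=> f f1 [mf1 Hf1] mf nf; rewrite ge_min H2 ?orbT //.
  move=> g; rewrite -sumrB; apply: le_lt_trans (ler_norm_sum _ _ _) _.
  apply: (@le_lt_trans _ _ (\sum_(k < (nv G).-1) d2 / n)).
    apply: ler_sum => k _; apply: ltW; apply: lt_le_trans (yW _) _.
    by rewrite ge_min lexx orbT.
  rewrite sumr_const card_ord -mulr_natl mulrCA gtr_pMr //.
  by rewrite ltr_pdivrMr // mul1r /n ltrDl.
rewrite ltNge; apply/negP => h; apply: nf; split => // g mg.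
by apply: le_trans h _; exact: Hf1.
Qed.

Lemma close_mst (x y : params R G) (d : R) :
   (forall f f1, is_mst (x.2 ord0) f1 -> 0 < tree_mass R i0 f -> ~ is_mst (x.2 ord0) f ->
      d <= tree_energy (y.2 ord0) f - tree_energy (y.2 ord0) f1) -> 0 < d ->
   forall f, is_mst (y.2 ord0) f -> is_mst (x.2 ord0) f.
Proof.
move=> H d0 f [mf Hf]; apply: contrapT => ni; have [f1 mf1] := exists_mst (x.2 ord0).
have := H f f1 mf1 mf ni; have := Hf f1 mf1.1; by lra.
Qed.

(** Subtracting the flow of [f0] and normalising at a vertex [i1] minimal at
    [x], the difference is a sum over trees and vertices. A term with a minimal
    tree and a minimal vertex vanishes by nondegeneracy; every other one
    contains a Gibbs weight of size [expR (- (beta * d))]. The factor [beta] comes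
    from the derivative of the Boltzmann distribution. *)
Lemma pump_local (x : params R G) f0 : ~ degenerate x -> is_mst (x.2 ord0) f0 ->
  exists r d C : R, [/\ 0 < r, 0 < d, 0 <= C & forall beta y e' S a,
    0 <= beta -> close_params x y r -> (forall i, `|e' i| <= S) ->
    `|current_form i0 beta (y.2 ord0) (gibbs' (fun=> 1) beta (y.1 ord0) e') a -
       \sum_i tf f0 a i * gibbs' (fun=> 1) beta (y.1 ord0) e' i| <=
      C * S * (beta * expR (- (beta * d)))].
Proof.
move=> nD mf0.
have [r [d [r0 d0 gap]]] := close_gap x.
have [i1 mi1] := exists_min (x.1 ord0).
pose T := \sum_f \sum_a \sum_i `|tf f a i|.
have TB f a i : `|tf f a i| <= T.
  rewrite /T (bigD1 f) //= (bigD1 a) //= (bigD1 i) //= -!addrA lerDl.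
  rewrite !addr_ge0 ?sumr_ge0 // => *; rewrite ?sumr_ge0 // => *.
  by rewrite sumr_ge0.
have T0 : 0 <= T by do 3 (apply: sumr_ge0 => ? _).
pose Q := 1 + \sum_f tree_mass R i0 f / tree_mass R i0 f0.
have QB f : tree_mass R i0 f / tree_mass R i0 f0 <= Q.
  rewrite /Q (bigD1 f) //= addrCA lerDl addr_ge0 // sumr_ge0 // => g _.
  by rewrite divr_ge0 ?tree_mass_ge0.
have Q1 : 1 <= Q.
  by rewrite lerDl sumr_ge0 // => g _; rewrite divr_ge0 ?tree_mass_ge0.
pose K := #|{: bT}|%:R * ((nv G)%:R * (Q * (4 * T) * 2)).
exists r, d, K; split => //.
  by rewrite !mulr_ge0 // (le_trans ler01).
move=> beta y e' S a b0 xy e'S; set v := gibbs' _ _ _ _.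
have S0 : 0 <= S by exact: le_trans (e'S i1).
have [gapE gapW] := gap y xy.
have vsum : \sum_i v i = 0.
  exact: (@gibbs'_sum0 R _ (fun=> 1) (fun=> ler01) i0 ltr01).
have vB i : `|v i| <= beta * boltzmann beta (y.1 ord0) i * (S + S).
  have := @gibbs'_bound R _ (fun=> 1) (fun=> ler01) i0 ltr01 beta (y.1 ord0) e' S i e'S.
  by rewrite (ger0_norm b0).
pose p f := tree_prob i0 beta (y.2 ord0) f.
have p0 f : 0 <= p f by exact: gibbs_ge0 (tree_mass_ge0 R i0) _ mf0.1 _ _ _.
have p1 f : p f <= 1 by exact: gibbs_le1 (tree_mass_ge0 R i0) _ mf0.1 _ _ _.
have psum : \sum_f p f = 1 by exact: gibbs_sum1 (tree_mass_ge0 R i0) _ mf0.1 _ _.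
pose D f i := tf f a i - tf f0 a i.
have -> : current_form i0 beta (y.2 ord0) v a - \sum_i tf f0 a i * v i =
    \sum_f \sum_i p f * ((D f i - D f i1) * v i).
  transitivity (\sum_f p f * (\sum_i tf f a i * v i - \sum_i tf f0 a i * v i)).
    under [RHS]eq_bigr do rewrite mulrBr.
    by rewrite sumrB -mulr_suml psum mul1r.
  apply: eq_bigr => f _; rewrite -mulr_sumr; congr (_ * _).
  under [RHS]eq_bigr do rewrite mulrBl.
  rewrite sumrB -mulr_sumr vsum mulr0 subr0 -sumrB.
  by apply: eq_bigr => i _; rewrite mulrBl.
pose X := Q * (4 * T) * 2 * S * (beta * expR (- (beta * d))).
apply: (@le_trans _ _ (\sum_(f : bT) \sum_(i < nv G) X)); last first.
  rewrite !sumr_const card_ord -[_ *+ nv G]mulr_natl -[_ *+ #|_|]mulr_natl.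
  by rewrite /X /K le_eqVlt; apply/orP; left; apply/eqP; ring.
apply: le_trans (ler_norm_sum _ _ _) _; apply: ler_sum => f _.
apply: le_trans (ler_norm_sum _ _ _) _; apply: ler_sum => i _.
have D4 : `|D f i - D f i1| <= 4 * T.
  apply: le_trans (ler_normB _ _) _.
  have h j : `|D f j| <= T + T.
    by apply: le_trans (ler_normB _ _) _; rewrite lerD ?TB.
  by have := h i; have := h i1; lra.
have small (u w : R) : 0 <= u -> 0 <= w -> u * w <= Q * expR (- (beta * d)) ->
    p f = u -> boltzmann beta (y.1 ord0) i = w ->
    `|p f * ((D f i - D f i1) * v i)| <= X.
  move=> u0 w0 uw pu bw; rewrite normrM (ger0_norm (p0 f)) normrM.
  apply: (@le_trans _ _ (p f * (4 * T * (beta * boltzmann beta (y.1 ord0) i * (S + S))))).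
    by rewrite ler_wpM2l // ler_pM.
  rewrite pu bw.
  have -> : u * (4 * T * (beta * w * (S + S))) = (u * w) * (4 * T * 2 * S * beta) by ring.
  have -> : X = Q * expR (- (beta * d)) * (4 * T * 2 * S * beta) by rewrite /X; ring.
  by rewrite ler_wpM2r // !mulr_ge0.
have Q0 : 0 <= Q by exact: le_trans Q1.
have [mi|ni] := pselect (is_min (x.1 ord0) i); last first.
  apply: small (p0 f) (boltzmann_ge0 _ _ _) _ erefl erefl.
  apply: ler_pM; rewrite ?boltzmann_ge0 //; first exact: le_trans (p1 f) Q1.
  apply: le_trans (boltzmann_le _ _ _ i1) _.
  by rewrite ler_expR lerN2 ler_wpM2l // gapE.
have [mf|nf] := pselect (is_mst (x.2 ord0) f).
  have -> : D f i - D f i1 = 0.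
    apply: contrapT => ne; apply: nD; exists i, i1, f, f0; split => //.
    by exists a => e; apply: ne; rewrite /D; move: e; lra.
  by rewrite mul0r mulr0 normr0 /X !mulr_ge0 ?expR_ge0.
have [m0|mp] := eqVneq (tree_mass R i0 f) 0.
  have -> : p f = 0 by rewrite /p /tree_prob /gibbs m0 !mul0r.
  by rewrite mul0r normr0 /X !mulr_ge0 ?expR_ge0.
have {}mp : 0 < tree_mass R i0 f by rewrite lt_def mp tree_mass_ge0.
apply: small (p0 f) (boltzmann_ge0 _ _ _) _ erefl erefl.
rewrite -[leRHS]mulr1; apply: ler_pM; rewrite ?boltzmann_ge0 ?boltzmann_le1 //.
apply: le_trans (gibbs_le (tree_mass_ge0 R i0) mf0.1 beta _ f mf0.1) _.
apply: ler_pM; rewrite ?expR_ge0 ?divr_ge0 ?tree_mass_ge0 ?QB //.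
by rewrite ler_expR lerN2 ler_wpM2l // gapW.
Qed.

End LocalAnalysis.

(** * Loops of nondegenerate points are robust *)

Section PumpedCurrent.
Variables (R : realType) (G : graph) (Gconn : connected_graph G) (i0 : 'I_(nv G)).

Local Notation bT := {ffun 'I_(nv G).-1 -> 'I_(ne G)}.
Local Notation tf := (tree_flow R i0).
Local Notation bz beta eta t i := (boltzmann beta (coordE eta ^~ t) i).
Implicit Types (eta gam : loop R G) (s t : R).

Definition pumped (beta : R) eta a : R -> R :=
  sval (cid (primitive (@pump_continuous R G Gconn i0 beta eta a))).

(** The integral of [pump] over a time interval. *)
Definition transported beta eta a s t := pumped beta eta a t - pumped beta eta a s.

Lemma dv_pumped beta eta a t : dv (pumped beta eta a) t (pump i0 beta eta a t).
Proof. by rewrite /pumped; case: cid => F [_ H] /=. Qed.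

Lemma transportedD beta eta a r s t :
  transported beta eta a r t = transported beta eta a r s + transported beta eta a s t.
Proof. by rewrite /transported; ring. Qed.

Lemma adiabatic_current_transported beta eta :
  adiabatic_current beta eta = \col_a transported beta eta a 0 1.
Proof.
exact: (adiabatic_currentE Gconn (fun a t => dv_pumped beta eta a t)).
Qed.

(** Integrate [pump_local]; the tree flow of the derivative of the Boltzmann
    distribution is an exact derivative. *)
Lemma transported_local (x : params R G) f0 : ~ degenerate i0 x ->
  is_mst i0 (x.2 ord0) f0 -> exists2 r, 0 < r & forall eta s t a, s <= t ->
   (forall u, s <= u <= t -> close_params x (eta u) r) ->
   transported beta eta a s t - \sum_i tf f0 a i * (bz beta eta t i - bz beta eta s i)
     @[beta --> +oo] --> 0.
Proof.
move=> nD mf0; have [r [d [C [r0 d0 C0 H]]]] := pump_local nD mf0.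
exists r => // eta s t a st Hu.
have [S S0 HS] : exists2 S, 0 <= S & forall i u, s <= u <= t -> `|coordE' eta i u| <= S.
  apply: (@finite_bound _ _ _ [set u | s <= u <= t]) => i.
  exact: continuous_bound st (@coordE'_continuous _ _ eta i).
apply: (@squeeze0 R _ _ (C * S * (t - s)) (beta_exp_cvg0 d0)) => beta b0.
pose D u := pumped beta eta a u - \sum_i tf f0 a i * bz beta eta u i.
have dD u : dv D u (pump i0 beta eta a u - \sum_i tf f0 a i * boltzmann' beta eta i u).
  apply: dvB; first exact: dv_pumped.
  apply: dv_sum => i _; apply: dvZ; exact: dv_boltzmann.
have -> : transported beta eta a s t -
    \sum_i tf f0 a i * (bz beta eta t i - bz beta eta s i) = D t - D s.
  rewrite /D /transported; under eq_bigr do rewrite mulrBr.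
  by rewrite sumrB; ring.
have -> : C * S * (t - s) * (beta * expR (- (beta * d))) =
   C * S * (beta * expR (- (beta * d))) * (t - s) by ring.
apply: (mvt_bound st (fun u _ => dD u)) => u su.
exact: (H beta (eta u) (coordE' eta ^~ u) S a b0 (Hu u su) (fun i => HS i u su)).
Qed.

Lemma boltzmann_cvg (e : 'I_(nv G) -> R) i :
  exists l, boltzmann beta e i @[beta --> +oo] --> (l : R).
Proof.
have [k mk] := exists_min i0 e; eexists.
exact: (@gibbs_lowtemp R _ (fun=> 1) (fun=> ler01) e k i ltr01 mk).
Qed.

Lemma boltzmann_cvg_unique (e : 'I_(nv G) -> R) k i :
  (forall j, j != k -> e k < e j) ->
  boltzmann beta e i @[beta --> +oo] --> ((i == k)%:R : R).
Proof.
move=> H.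
have mk j : e k <= e j by have [->//|/H/ltW] := eqVneq j k.
have kE j : (e j == e k) = (j == k).
  apply/eqP/eqP => [e1|-> //]; apply/eqP; rewrite -[_ == _]negbK; apply/negP => /H.
  by rewrite e1 ltxx.
have := @gibbs_lowtemp R _ (fun=> 1) (fun=> ler01) e k i ltr01 mk.
rewrite kE mul1r.
rewrite (bigD1 k) //= kE eqxx mul1r big1 ?addr0 ?divr1 // => j /negbTE jk.
by rewrite kE jk mulr0.
Qed.

Lemma cvg_ext (f g : R -> R) (l : R) : f b @[b --> +oo] --> l ->
  (forall b, f b = g b) -> g b @[b --> +oo] --> l.
Proof. by move=> fl /funext <-. Qed.

Lemma cvg_addy (f g : R -> R) (l m : R) : f b @[b --> +oo] --> l ->
  g b @[b --> +oo] --> m -> f b + g b @[b --> +oo] --> l + m.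
Proof. by move=> fl gm; exact: cvgD. Qed.

Lemma cvg_suby (f g : R -> R) (l m : R) : f b @[b --> +oo] --> l ->
  g b @[b --> +oo] --> m -> f b - g b @[b --> +oo] --> l - m.
Proof. by move=> fl gm; exact: cvgB. Qed.

Lemma cvg_sumr (I : Type) (r : seq I) (P : pred I) (h : I -> R -> R) (l : I -> R) :
  (forall i, P i -> h i b @[b --> +oo] --> l i) ->
  \sum_(i <- r | P i) h i b @[b --> +oo] --> \sum_(i <- r | P i) l i.
Proof. by move=> H; apply: cvg_big => //; exact: add_continuous. Qed.

Lemma close_norm (x y : params R G) r : `|y - x| < r -> close_params x y r.
Proof.
move=> xy; split => i.
  have : `|(y - x).1| < r.
    by apply: le_lt_trans xy; rewrite [leRHS]/Num.Def.normr /= le_max lexx.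
  apply: le_lt_trans; rewrite [leRHS]/Num.Def.normr /= mx_normrE.
  by have := le_bigmax 0 (fun k => `|(y - x).1 k.1 k.2|) (ord0, i); rewrite /= !mxE.
have : `|(y - x).2| < r.
  by apply: le_lt_trans xy; rewrite [leRHS]/Num.Def.normr /= le_max lexx orbT.
apply: le_lt_trans; rewrite [leRHS]/Num.Def.normr /= mx_normrE.
by have := le_bigmax 0 (fun k => `|(y - x).2 k.1 k.2|) (ord0, i); rewrite /= !mxE.
Qed.

Lemma loop_close eta t r : 0 < r ->
  exists2 e, 0 < e & forall u, `|u - t| < e -> close_params (eta t) (eta u) r.
Proof.
move=> r0.
have c : {for t, continuous (eta : R -> params R G)}.
  apply: differentiable_continuous; apply/derivable1_diffP.
  exact: (@loop_smooth _ _ eta 0).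
have /cvgrPdist_lt/(_ r r0)/nbhs_ballP[e e0 H] := c.
exists e => // u ut; apply: close_norm; rewrite distrC; apply: H.
by rewrite /ball /= distrC.
Qed.

Lemma closeD (x y z : params R G) r s :
  close_params x y r -> close_params y z s -> close_params x z (r + s).
Proof.
move=> [xyE xyW] [yzE yzW]; split => i.
  have := xyE i; have := yzE i; rewrite !ltr_norml => /andP[? ?] /andP[? ?].
  by apply/andP; split; lra.
have := xyW i; have := yzW i; rewrite !ltr_norml => /andP[? ?] /andP[? ?].
by apply/andP; split; lra.
Qed.

Lemma close_le (x y : params R G) r s : r <= s -> close_params x y r -> close_params x y s.
Proof.
by move=> rs [xE xW]; split => i; apply: lt_le_trans rs.
Qed.

(** Both distributions have mass 1 and concentrate on the minima of [x], where
    the form [D] is constant. *)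
Lemma boltzmann_diff_cvg0 (x : params R G) : exists2 r, 0 < r &
  forall (D : 'I_(nv G) -> R), (forall i j, is_min (x.1 ord0) i -> is_min (x.1 ord0) j ->
      D i = D j) ->
  forall y z, close_params x y r -> close_params x z r ->
  \sum_i D i * (boltzmann beta (y.1 ord0) i - boltzmann beta (z.1 ord0) i)
    @[beta --> +oo] --> 0.
Proof.
have [r [d [r0 d0 gap]]] := close_gap i0 x.
have [i1 mi1] := exists_min i0 (x.1 ord0).
exists r => // D HD y z xy xz.
have E beta : \sum_i D i * (boltzmann beta (y.1 ord0) i - boltzmann beta (z.1 ord0) i) =
  \sum_i (D i - D i1) * (boltzmann beta (y.1 ord0) i - boltzmann beta (z.1 ord0) i).
  under [RHS]eq_bigr do rewrite mulrBl.
  rewrite sumrB -mulr_sumr sumrB !(boltzmann_sum1 i0).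
  by rewrite subrr mulr0 subr0.
under eq_cvg do rewrite E.
have Z : \sum_(i < nv G) (0 : R) = 0 by rewrite big1.
have := @cvg_sumr _ (index_enum 'I_(nv G)) xpredT (fun i beta => (D i - D i1) *
  (boltzmann beta (y.1 ord0) i - boltzmann beta (z.1 ord0) i)) (fun=> 0).
rewrite Z; apply => i _.
have [mi|ni] := pselect (is_min (x.1 ord0) i).
  under eq_cvg do rewrite (HD i i1 mi mi1) subrr mul0r.
  exact: cvg_cst.
have small w : close_params x w r -> boltzmann beta (w.1 ord0) i @[beta --> +oo] --> 0.
  move=> xw; have h : expR (- (beta * d)) @[beta --> +oo] --> 0.
    by have := @expR_lowtemp R d (ltW d0); rewrite (gt_eqF d0).
  apply: (@squeeze0 R _ _ 1 h) => beta b0; rewrite mul1r.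
  rewrite ger0_norm ?(boltzmann_ge0 i0) //.
  apply: le_trans (boltzmann_le i0 _ _ _ i1) _.
  by rewrite ler_expR lerN2 ler_wpM2l // (gap w xw).1.
rewrite -(mulr0 (D i - D i1)) -[X in _ * X](subrr 0).
by apply: cvgM; [exact: cvg_cst|apply: cvgB; exact: small].
Qed.

Lemma telescope_forms n (f0 fq fp eq ep gq gp : 'I_n -> R) (A B : R) :
  A - \sum_i f0 i * (eq i - ep i) - (B - \sum_i f0 i * (gq i - gp i)) -
  (\sum_i (fq i - f0 i) * (eq i - gq i) - \sum_i (fp i - f0 i) * (ep i - gp i)) =
  A - B - (\sum_i fq i * (eq i - gq i) - \sum_i fp i * (ep i - gp i)).
Proof.
have lin (f x y : 'I_n -> R) : \sum_i f i * (x i - y i) =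
    \sum_i f i * x i - \sum_i f i * y i.
  by rewrite -sumrB; apply: eq_bigr => i _; rewrite mulrBr.
have lin2 (f g x : 'I_n -> R) : \sum_i (f i - g i) * x i =
    \sum_i f i * x i - \sum_i g i * x i.
  by rewrite -sumrB; apply: eq_bigr => i _; rewrite mulrBl.
rewrite (lin2 fq f0 (fun i => eq i - gq i)) (lin2 fp f0 (fun i => ep i - gp i)).
rewrite !lin; ring.
Qed.

Section GoodLoop.
Variable gam : loop R G.
Hypothesis gam_good : forall t, ~ degenerate i0 (gam t).

(** The tree is chosen from the barriers alone, so that it is the same at both
    ends of the period. *)
Definition mst_of (w : 'I_(ne G) -> R) : bT := sval (cid (exists_mst Gconn i0 w)).

Lemma mst_ofP w : is_mst i0 w (mst_of w).
Proof. by rewrite /mst_of; case: cid. Qed.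

Lemma small_interval (e r s t u : R) : r <= t <= s -> t - e < r -> s < t + e ->
  r <= u <= s -> `|u - t| < e.
Proof.
by move=> /andP[? ?] ? ? /andP[? ?]; rewrite ltr_norml; apply/andP; split; lra.
Qed.

Lemma transported_cvg a s t : s <= t ->
  exists l, transported beta gam a s t @[beta --> +oo] --> (l : R).
Proof.
move=> st; apply: (@cousin R (fun s t => exists l : R,
    transported beta gam a s t @[beta --> +oo] --> l)) => //.
  move=> r u v _ _ [l1 H1] [l2 H2]; exists (l1 + l2).
  by under eq_cvg do rewrite (transportedD _ _ _ _ u); exact: cvgD.
move=> u _.
have [r r0 H] := transported_local (gam_good (t:=u)) (mst_ofP ((gam u).2 ord0)).
have [e e0 He] := loop_close gam u r0.
exists e => // p q _ _ puq pe qe.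
have pq : p <= q by case/andP: puq => /le_trans h /h.
have {}H := H gam p q a pq (fun v pv => He v (small_interval puq pe qe pv)).
have [lq Hq] : exists l : R, \sum_i tf (mst_of ((gam u).2 ord0)) a i *
    (bz beta gam q i - bz beta gam p i) @[beta --> +oo] --> l.
  have [l1 H1] := choice (boltzmann_cvg (coordE gam ^~ q)).
  have [l2 H2] := choice (boltzmann_cvg (coordE gam ^~ p)).
  eexists; apply: cvg_sumr => i _; apply: cvgM; first exact: cvg_cst.
  by apply: cvgB; [exact: H1|exact: H2].
by exists (0 + lq); apply: (cvg_ext (cvg_addy H Hq)) => b /=; rewrite subrK.
Qed.

(** With a tree chosen at each time, the difference of the two currents is, up
    to terms tending to 0, the difference of the boundary terms at the two ends.
    This is additive in the interval. On a short interval it is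
    [transported_local] for both loops with one common tree; replacing this tree
    at an end by the chosen one is harmless, since both are minimal at the
    centre and so agree on its minima. *)
Lemma transported_stable (mst : R -> bT) s t :
  (forall t, is_mst i0 ((gam t).2 ord0) (mst t)) -> s <= t -> exists2 r, 0 < r &
  forall eta, (forall u, s <= u <= t -> close_params (gam u) (eta u) r) -> forall a,
  transported beta eta a s t - transported beta gam a s t -
   (\sum_i tf (mst t) a i * (bz beta eta t i - bz beta gam t i) -
    \sum_i tf (mst s) a i * (bz beta eta s i - bz beta gam s i))
   @[beta --> +oo] --> 0.
Proof.
move=> mstP st; pose P s t := exists2 r, 0 < r &
  forall eta, (forall u, s <= u <= t -> close_params (gam u) (eta u) r) -> forall a,
  transported beta eta a s t - transported beta gam a s t -
   (\sum_i tf (mst t) a i * (bz beta eta t i - bz beta gam t i) -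
    \sum_i tf (mst s) a i * (bz beta eta s i - bz beta gam s i))
   @[beta --> +oo] --> 0.
apply: (@cousin R P) => //.
  move=> p q v pq qv [r1 r10 H1] [r2 r20 H2].
  exists (Num.min r1 r2); first by rewrite lt_min r10.
  move=> eta He a.
  have h1 : forall u, p <= u <= q -> close_params (gam u) (eta u) r1.
    move=> u /andP[pu uq]; apply: (@close_le _ _ (Num.min r1 r2)).
      by rewrite ge_min lexx.
    by apply: He; rewrite pu (le_trans uq).
  have h2 : forall u, q <= u <= v -> close_params (gam u) (eta u) r2.
    move=> u /andP[qu uv]; apply: (@close_le _ _ (Num.min r1 r2)).
      by rewrite ge_min lexx orbT.
    by apply: He; rewrite uv (le_trans pq).
  have h := cvg_addy (H1 eta h1 a) (H2 eta h2 a); rewrite addr0 in h.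
  apply: (cvg_ext h) => b /=.
  rewrite (transportedD _ _ _ p q v) (transportedD _ gam _ p q v).
  have alg (A B C D X Y Z : R) : (A - C - (Z - Y)) + (B - D - (X - Z)) =
    A + B - (C + D) - (X - Y) by ring.
  exact: alg.
move=> u _; set f0 := mst u.
have [r1 r10 H1] := transported_local (gam_good (t:=u)) (mstP u).
have [r2 r20 H2] := boltzmann_diff_cvg0 (gam u).
have [r3 [d [r30 d0 gap]]] := close_gap i0 (gam u).
pose r := Num.min r1 (Num.min r2 r3).
have r0 : 0 < r by rewrite !lt_min r10 r20.
have rr1 : r <= r1 by rewrite ge_min lexx.
have rr2 : r <= r2 by rewrite !ge_min lexx orbT.
have rr3 : r <= r3 by rewrite !ge_min lexx !orbT.
have r20' : 0 < r / 2 by rewrite divr_gt0.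
have rrr : r / 2 <= r by lra.
have [e e0 He] := loop_close gam u r20'.
exists e => // p q _ _ puq pe qe.
have pq : p <= q by case/andP: puq => /le_trans h /h.
exists (r / 2) => // eta Heta a.
have cg v : p <= v <= q -> close_params (gam u) (gam v) (r / 2).
  by move=> pv; apply: He; exact: small_interval pv.
have ce v : p <= v <= q -> close_params (gam u) (eta v) r.
  by move=> pv; rewrite (splitr r); apply: closeD (cg v pv) (Heta v pv).
have Te := H1 eta p q a pq (fun v pv => close_le rr1 (ce v pv)).
have Tg := H1 gam p q a pq (fun v pv => close_le (le_trans rrr rr1) (cg v pv)).
have B v : p <= v <= q ->
  \sum_i (tf (mst v) a i - tf f0 a i) *
     (bz beta eta v i - bz beta gam v i) @[beta --> +oo] --> 0.
  move=> pv; apply: (H2 (fun i => tf (mst v) a i - tf f0 a i) _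
    (eta v) (gam v)).
  - move=> i j mi mj; apply: contrapT => ne; apply: (gam_good (t:=u)).
    exists i, j, (mst v), f0; split => //.
    + apply: (close_mst Gconn (gap _ _).2 d0); last exact: mstP.
      exact: close_le (le_trans rrr rr3) (cg v pv).
    + by exists a => h; apply: ne; move: h; lra.
  - exact: close_le rr2 (ce v pv).
  - exact: close_le (le_trans rrr rr2) (cg v pv).
have h := fun hq hp => cvg_suby (cvg_suby Te Tg) (cvg_suby (B q hq) (B p hp));
have {}h := h (introT andP (conj pq (lexx q))) (introT andP (conj (lexx p) pq)).
rewrite !subr0 in h; apply: (cvg_ext h) => b /=.
exact: (@telescope_forms _ (tf f0 a) (tf (mst q) a) (tf (mst p) a)
  (fun i => bz b eta q i) (fun i => bz b eta p i)
  (fun i => bz b gam q i) (fun i => bz b gam p i)).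
Qed.

(** Over a full period the boundary terms of [transported_stable] cancel. *)
Lemma good_loop_robust : intrinsically_robust gam.
Proof.
have [r r0 H] := transported_stable (fun t => mst_ofP ((gam t).2 ord0)) ler01.
have [q Hq] := choice (fun a => transported_cvg a ler01).
(* Asking for a margin in the uniform distance makes this set open. *)
pose U := [set eta : loop R G | exists2 r', r' < r & forall t, `|eta t - gam t| <= r'].
exists U.
  split; last by exists 0 => // t; rewrite subrr normr0.
  move=> eta [r' r'r Hr]; exists 0%N, ((r - r') / 2); first by rewrite divr_gt0 // subr_gt0.
  move=> xi Hxi; exists ((r + r') / 2); first by lra.
  move=> t; have := Hxi 0%N t (leqnn _); rewrite !derive1n0 => /ltW h.
  rewrite -(subrKA (eta t)); apply: le_trans (ler_normD _ _) _.
  by have := lerD h (Hr t); lra.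
exists (\col_a q a) => eta [r' r'r Hr].
under eq_cvg do rewrite adiabatic_current_transported.
apply: cvg_col => a; rewrite mxE.
have hc u : 0 <= u <= 1 -> close_params (gam u) (eta u) r.
  by move=> _; apply: close_norm; apply: le_lt_trans (Hr u) r'r.
have h := cvg_addy (H eta hc a) (Hq a); rewrite add0r in h.
apply: (cvg_ext h) => b /=; rewrite mxE.
have per (ga : loop R G) : (coordE ga ^~ 1) = (coordE ga ^~ 0).
  by apply/funext => i; rewrite /coordE -[1]add0r loop_periodic.
have -> : gam 1 = gam 0 by rewrite -[1]add0r loop_periodic.
rewrite (per eta) (per gam).
have alg (A B X : R) : A - B - (X - X) + B = A by ring.
exact: alg.
Qed.

End GoodLoop.

End PumpedCurrent.

(** * Smooth periodic perturbations *)

Section SmoothFunctions.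
Variable R : realType.

(** These functions are closed under differentiation up to linear combinations;
    [flat 0] is the standard smooth function that vanishes on the negative
    axis. *)
Definition flat (k : nat) (x : R) : R :=
  if 0 < x then x^-1 ^+ k * expR (- x^-1) else 0.

Lemma flat_gt0 k x : 0 < x -> 0 < flat k x.
Proof. by move=> x0; rewrite /flat x0 mulr_gt0 ?expR_gt0 // exprn_gt0 // invr_gt0. Qed.

Lemma flat_le0 k x : x <= 0 -> flat k x = 0.
Proof. by move=> x0; rewrite /flat ltNge x0. Qed.

(** For positive [x] and [N = k + 2] the exponential of [x^-1] is at least
    [(x * N%:R) ^- N]. *)
Lemma flat_quadratic k : exists C : R, forall x, `|flat k x| <= C * x ^+ 2.
Proof.
pose N := k.+2; exists (N%:R ^+ N) => x.
have [x0|x0] := leP x 0.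
  rewrite flat_le0 // normr0; apply: mulr_ge0; last exact: sqr_ge0.
  by apply: exprn_ge0; exact: ler0n.
rewrite gtr0_norm ?flat_gt0 // /flat x0 expRN.
have N0 : 0 < N%:R :> R by rewrite ltr0n.
pose y := (x * N%:R)^-1.
have y0 : 0 < y by rewrite invr_gt0 mulr_gt0.
have e : y ^+ N <= expR x^-1.
  have -> : x^-1 = N%:R * y by rewrite /y; field; rewrite !lt0r_neq0.
  rewrite expRM_natl lerXn2r ?nnegrE ?expR_ge0 ?(ltW y0) //.
  by apply: le_trans (expR_ge1Dx _); rewrite lerDr.
rewrite ler_pdivrMr ?expR_gt0 //.
apply: (@le_trans _ _ (N%:R ^+ N * x ^+ 2 * y ^+ N)); last first.
  apply: ler_wpM2l => //; apply: mulr_ge0; last exact: sqr_ge0.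
  by apply: exprn_ge0; exact: ler0n.
rewrite le_eqVlt; apply/orP; left; apply/eqP.
rewrite /y invfM exprMn -[x^-1 ^+ N]/(x^-1 ^+ k.+2) !exprS exprVn.
rewrite exprVn.
rewrite -/N; field.
by rewrite !expf_neq0 // ?lt0r_neq0.
Qed.

Lemma dv_quadratic (f : R -> R) C : (forall x, `|f x| <= C * x ^+ 2) -> dv f 0 0.
Proof.
move=> H.
have f0 : f 0 = 0.
  by have := H 0; rewrite expr0n mulr0 normr_le0 => /eqP.
have c : h^-1 *: ((f \o shift 0) (h *: 1) - f 0) @[h --> 0^'] --> 0.
  apply/cvgrPdist_le => e e0; near=> h.
  have h0 : h != 0 by near: h; exact: nbhs_dnbhs_neq.
  rewrite sub0r normrN f0 subr0 /= addr0 /GRing.scale /= mulr1 normrM normfV.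
  rewrite mulrC ler_pdivrMr ?normr_gt0 //.
  apply: le_trans (H h) _; apply: (@le_trans _ _ (`|C| * `|h| * `|h|)).
    rewrite -mulrA -expr2 real_normK ?num_real // ler_wpM2r ?sqr_ge0 //.
    exact: ler_norm.
  apply: ler_wpM2r => //.
  apply: (@le_trans _ _ ((`|C| + 1) * `|h|)).
    by rewrite ler_wpM2r // lerDl.
  rewrite mulrC -ler_pdivlMr ?ltr_wpDl //.
  near: h; apply: dnbhs0_le; by rewrite divr_gt0 // ltr_wpDl.
split; last exact: cvg_lim c.
by apply/cvg_ex; exists 0.
Unshelve. all: by end_near. Qed.

Lemma dv_flat k x : dv (flat k) x (flat k.+2 x - k%:R * flat k.+1 x).
Proof.
have [x0|x0|->] := ltgtP x 0.
- rewrite !flat_le0 ?(ltW x0) // mulr0 subr0.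
  apply: (@dv_near _ (fun=> 0)); last exact: dv_cst.
  near=> y; rewrite flat_le0 //; apply: ltW; near: y; exact: lt_nbhsl.
- have xn0 : x != 0 by exact: lt0r_neq0.
  apply: (@dv_near _ (fun y => y^-1 ^+ k * expR (- y^-1))).
    near=> y; rewrite /flat ifT //; near: y; exact: lt_nbhsr.
  have dV : dv (fun y : R => y^-1) x (- x^-1 ^+ 2).
    by apply: dv_eq (@dvV _ id x 1 xn0 (dv_id x)) _; rewrite div1r exprVn.
  have dX : dv (fun y : R => y^-1 ^+ k) x (- (k%:R * x^-1 ^+ k.+1)).
    elim: k => [|k IH].
      by rewrite mul0r oppr0; apply: dv_ext (dv_cst 1 x) => s; rewrite expr0.
    apply: (@dv_ext _ (fun y => y^-1 * y^-1 ^+ k)) => [s|]; first by rewrite exprS.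
    by apply: dv_eq (dvM dV IH) _; rewrite -natr1 !exprS; ring.
  apply: dv_eq (dvM dX (dv_exp (dvN dV))) _.
  by rewrite /flat x0 opprK !exprS; ring.
- rewrite !flat_le0 // mulr0 subr0.
  have [C HC] := flat_quadratic k; exact: dv_quadratic HC.
Unshelve. all: by end_near. Qed.

Definition phase (t0 t : R) : R := (t - t0) * (pi *+ 2).

Lemma dv_phase t0 t : dv (phase t0) t (pi *+ 2).
Proof.
by apply: dv_eq (dvM (dvB (dv_id t) (dv_cst t0 t)) (dv_cst (pi *+ 2) t)) _; ring.
Qed.

Lemma phaseD1 t0 t : phase t0 (t + 1) = phase t0 t + pi *+ 2.
Proof. by rewrite /phase; ring. Qed.

(** An inductive class of smooth functions, so that periodicity and stability
    under differentiation are proved by induction. Composing [flat] with a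
    shifted cosine gives periodic bumps. *)
Inductive smooth_periodic : (R -> R) -> Prop :=
| SP_cst c : smooth_periodic (fun=> c)
| SP_sin t0 : smooth_periodic (fun t => sin (phase t0 t))
| SP_cos t0 : smooth_periodic (fun t => cos (phase t0 t))
| SP_flat k t0 c : smooth_periodic (fun t => flat k (cos (phase t0 t) - c))
| SP_add f g : smooth_periodic f -> smooth_periodic g ->
    smooth_periodic (fun t => f t + g t)
| SP_mul f g : smooth_periodic f -> smooth_periodic g ->
    smooth_periodic (fun t => f t * g t).

Lemma dv_sin_phase t0 t : dv (fun t => sin (phase t0 t)) t (cos (phase t0 t) * (pi *+ 2)).
Proof. exact: dv_comp (is_derive_sin _) (dv_phase t0 t). Qed.

Lemma dv_cos_phase t0 t :
  dv (fun t => cos (phase t0 t)) t (- sin (phase t0 t) * (pi *+ 2)).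
Proof. exact: dv_comp (is_derive_cos _) (dv_phase t0 t). Qed.

Lemma smooth_periodic_derive f : smooth_periodic f ->
  exists2 f', smooth_periodic f' & forall t, dv f t (f' t).
Proof.
elim=> [c|t0|t0|k t0 c|{}f g _ [f' sf' df] _ [g' sg' dg]
  |{}f g sf [f' sf' df] sg [g' sg' dg]].
- by exists (fun=> 0) => [|t]; [exact: SP_cst|exact: dv_cst].
- exists (fun t => cos (phase t0 t) * (pi *+ 2)); last exact: dv_sin_phase.
  by apply: SP_mul; [exact: SP_cos|exact: SP_cst].
- exists (fun t => (-1 * sin (phase t0 t)) * (pi *+ 2)).
    apply: SP_mul; last exact: SP_cst.
    by apply: SP_mul; [exact: SP_cst|exact: SP_sin].
  by move=> t; rewrite mulN1r; exact: dv_cos_phase.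
- exists (fun t => (flat k.+2 (cos (phase t0 t) - c) +
      - k%:R * flat k.+1 (cos (phase t0 t) - c)) *
      ((-1 * sin (phase t0 t)) * (pi *+ 2))).
    apply: SP_mul.
      apply: SP_add; first exact: SP_flat.
      by apply: SP_mul; [exact: SP_cst|exact: SP_flat].
    apply: SP_mul; last exact: SP_cst.
    by apply: SP_mul; [exact: SP_cst|exact: SP_sin].
  move=> t; rewrite mulN1r.
  apply: dv_eq (dv_comp (dv_flat k _) (dvB (dv_cos_phase t0 t) (dv_cst c t))) _.
  by rewrite subr0 mulNr.
- by exists (fun t => f' t + g' t) => [|t]; [exact: SP_add|exact: dvD].
- exists (fun t => f' t * g t + f t * g' t); last by move=> t; exact: dvM.
  by apply: SP_add; exact: SP_mul.
Qed.

Lemma smooth_periodicP f : smooth_periodic f -> forall t, f (t + 1) = f t.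
Proof.
elim=> [//|t0|t0|k t0 c|{}f g _ Hf _ Hg|{}f g _ Hf _ Hg] t.
- by rewrite phaseD1 sinD2pi.
- by rewrite phaseD1 cosD2pi.
- by rewrite phaseD1 cosD2pi.
- by rewrite Hf Hg.
- by rewrite Hf Hg.
Qed.

Lemma smooth_periodic_bound f : smooth_periodic f -> exists B, forall t, `|f t| <= B.
Proof.
move=> sf; apply: periodic_bound (smooth_periodicP sf).
by have [f' _ df] := smooth_periodic_derive sf; move=> t; exact: dv_continuous (df t).
Qed.

Lemma smooth_periodic_derive1n f k : smooth_periodic f -> smooth_periodic (derive1n k f).
Proof.
move=> sf; elim: k => [|k IH]; first by rewrite derive1n0.
rewrite derive1nS; have [g sg dg] := smooth_periodic_derive IH.
suff -> : derive1 (derive1n k f) = g by [].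
by apply/funext => t; rewrite derive1E; have [_ ->] := dg t.
Qed.

Lemma smooth_periodic_dv f t : smooth_periodic f -> dv f t (derive1 f t).
Proof.
move=> sf; have [g _ dg] := smooth_periodic_derive sf.
by apply: dv_eq (dg t) _; rewrite derive1E; have [_ ->] := dg t.
Qed.

End SmoothFunctions.

Section Perturbation.
Variables (R : realType) (G : graph).
Variables (eta : loop R G) (phi : R -> R) (sphi : smooth_periodic phi).

Definition perturb_fun (u : params R G) t : params R G := eta t + phi t *: u.

Lemma is_derive_scale_vector (V : normedModType R) (f : R -> R) t a (u : V) :
  dv f t a -> is_derive t 1 (fun t => f t *: u) (a *: u).
Proof.
move=> [fd fe].
have c : h^-1 *: (f (h *: 1 + t) *: u - f t *: u) @[h --> 0^'] --> a *: u.
  under eq_cvg do rewrite -scalerBl scalerA.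
  apply: cvgZr_tmp; rewrite -fe; exact: fd.
split; last exact: cvg_lim c.
by apply/cvg_ex; exists (a *: u).
Qed.

Lemma perturb_derive1n u k : derive1n k (perturb_fun u) =
  fun t => derive1n k eta t + derive1n k phi t *: u.
Proof.
elim: k => [|k IH]; first by rewrite !derive1n0.
rewrite !derive1nS IH; apply/funext => t.
have := is_deriveD (derivableP (@loop_smooth _ _ eta k t))
  (is_derive_scale_vector u (smooth_periodic_dv t (smooth_periodic_derive1n k sphi))).
move=> [_ e]; rewrite [LHS]derive1E (derive1E (derive1n k eta)); exact: e.
Qed.

Lemma perturb_smooth u k t : derivable (derive1n k (perturb_fun u)) t 1.
Proof.
rewrite perturb_derive1n.
by case: (is_deriveD (derivableP (@loop_smooth _ _ eta k t))
  (is_derive_scale_vector u (smooth_periodic_dv t (smooth_periodic_derive1n k sphi)))).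
Qed.

Lemma perturb_periodic u t : perturb_fun u (t + 1) = perturb_fun u t.
Proof. by rewrite /perturb_fun loop_periodic (smooth_periodicP sphi). Qed.

Definition perturb u : loop R G := Loop (@perturb_smooth u) (perturb_periodic u).

Lemma perturb_coordE u i t : coordE (perturb u) i t = coordE eta i t + phi t * u.1 ord0 i.
Proof. by rewrite /coordE /= /perturb_fun !mxE. Qed.

Lemma perturb_coordW u a t : coordW (perturb u) a t = coordW eta a t + phi t * u.2 ord0 a.
Proof. by rewrite /coordW /= /perturb_fun !mxE. Qed.

Lemma perturb_open (U : set (loop R G)) u : whitney_open U -> U eta ->
  exists2 e0, 0 < e0 & forall e, 0 <= e <= e0 -> U (perturb (e *: u)).
Proof.
move=> oU /oU[k [r r0 H]].
have [B B0 HB] : exists2 B, 0 <= B & forall (j : 'I_k.+1) t, setT t ->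
    `|derive1n j phi t| <= B.
  apply: (@finite_bound _ _ _ setT (fun (j : 'I_k.+1) => derive1n j phi)) => j.
  have [B HB] := smooth_periodic_bound (smooth_periodic_derive1n j sphi).
  by exists B => t _.
exists (r / (B * `|u| + 1)); first by rewrite divr_gt0 // ltr_wpDl // mulr_ge0.
move=> e /andP[e0 er]; apply: H => j t jk.
rewrite [derive1n j (perturb _)]perturb_derive1n addrAC subrr add0r scalerA normrZ normrM.
rewrite (ger0_norm e0).
have Bj : `|derive1n j phi t| <= B by apply: (HB (Ordinal (_ : (j < k.+1)%N))).
apply: (@le_lt_trans _ _ (B * `|u| * e)).
  rewrite [leRHS](_ : _ = B * (e * `|u|)); last by ring.
  rewrite [leLHS](_ : _ = `|derive1n j phi t| * (e * `|u|)); last by ring.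
  by rewrite ler_wpM2r // mulr_ge0.
rewrite ler_pdivlMr in er; last by rewrite ltr_wpDl // mulr_ge0.
have [->|en0] := eqVneq e 0; first by rewrite mulr0.
have ep : 0 < e by rewrite lt_def en0.
apply: lt_le_trans er; rewrite [ltRHS](_ : _ = B * `|u| * e + e); last by ring.
by rewrite ltrDl.
Qed.

End Perturbation.

(** * Crossings of two ground states *)

Section BadLoop.
Variables (R : realType) (G : graph) (Gconn : connected_graph G) (i0 : 'I_(nv G)).

Local Notation bT := {ffun 'I_(nv G).-1 -> 'I_(ne G)}.
Local Notation tf := (tree_flow R i0).
Local Notation bz beta eta t i := (boltzmann beta (coordE eta ^~ t) i).
Local Notation tr := (transported Gconn i0).
Implicit Types (eta gam : loop R G) (s t : R).

Lemma exchange_sub (A B C D : R) : A - C = B - D -> A - B = C - D.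
Proof. by lra. Qed.

(** Stronger than [is_min]: the inequalities are strict. *)
Definition unique_min (e : 'I_(nv G) -> R) k := forall j, j != k -> e k < e j.

Lemma unique_min_good (x : params R G) k : unique_min (x.1 ord0) k ->
  ~ degenerate i0 x.
Proof.
move=> H [i [j [f [g [mi mj _ _ [a]]]]]].
have e l : is_min (x.1 ord0) l -> l = k.
  move=> ml; apply: contrapT => /eqP /H; rewrite ltNge; by rewrite ml.
by rewrite (e i mi) (e j mj) !subrr.
Qed.

(** Points with a unique minimum are nondegenerate, and locally the Boltzmann distribution tends
    to the same point mass at both ends. *)
Lemma transported_unique_min eta a k s t : s <= t ->
  (forall u, s <= u <= t -> unique_min (coordE eta ^~ u) k) ->
  tr beta eta a s t @[beta --> +oo] --> 0.
Proof.
move=> st; have := @cousin R (fun p q => s <= p -> q <= t ->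
  (forall u, s <= u <= t -> unique_min (coordE eta ^~ u) k) ->
  tr beta eta a p q @[beta --> +oo] --> (0 : R)) s t st.
move=> C H; apply: C => //.
  move=> p q r pq qr H1 H2 sp rt _.
  have h := cvg_addy (H1 sp (le_trans qr rt) H) (H2 (le_trans sp pq) rt H).
  rewrite addr0 in h; apply: (cvg_ext h) => b.
  by rewrite (transportedD _ _ _ _ _ p q r).
move=> u su; have [f mf] := exists_mst Gconn i0 ((eta u).2 ord0).
have [r r0 L] := transported_local Gconn (unique_min_good (H u su)) mf.
have [e e0 He] := loop_close eta u r0.
exists e => // p q _ _ puq pe qe sp qt _.
have pq : p <= q by case/andP: puq => /le_trans h /h.
have {}L := L eta p q a pq (fun v pv => He v (small_interval puq pe qe pv)).
have B v : p <= v <= q -> \sum_i tf f a i * bz beta eta v i @[beta --> +oo] -->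
    \sum_i tf f a i * (i == k)%:R.
  move=> /andP[pv vq]; apply: cvg_sumr => i _; apply: cvgM; first exact: cvg_cst.
  by apply: boltzmann_cvg_unique; apply: H; rewrite (le_trans sp) // (le_trans vq).
have hq : p <= q <= q by rewrite pq lexx.
have hp : p <= p <= q by rewrite pq lexx.
have h := cvg_addy L (cvg_suby (B q hq) (B p hp)).
rewrite subrr addr0 in h; apply: (cvg_ext h) => b.
under eq_bigr do rewrite mulrBr.
by rewrite sumrB subrK.
Qed.

(** Away from [t0] the ground state is constant and no current flows; in a small
    interval around [t0] the Boltzmann distribution passes from [i] to [j] along
    the minimal tree. *)
Lemma transported_crossing eta a i j h t0 d : 0 < d -> ~ degenerate i0 (eta t0) ->
  is_mst i0 ((eta t0).2 ord0) h ->
  (forall t, t0 - d <= t < t0 -> unique_min (coordE eta ^~ t) i) ->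
  (forall t, t0 < t <= t0 + d -> unique_min (coordE eta ^~ t) j) ->
  tr beta eta a (t0 - d) (t0 + d) @[beta --> +oo] --> tf h a j - tf h a i.
Proof.
move=> d0 nD mh Hi Hj.
have [r r0 L] := transported_local Gconn nD mh.
have [e e0 He] := loop_close eta t0 r0.
pose d' := Num.min d (e / 2).
have d'0 : 0 < d' by rewrite lt_min d0 divr_gt0.
have d'd : d' <= d by rewrite ge_min lexx.
have d'e : d' < e by rewrite gt_min ltr_pdivrMr // ltr_pMr // ltr1n orbT.
have L1 : tr beta eta a (t0 - d) (t0 - d') @[beta --> +oo] --> 0.
  apply: (@transported_unique_min eta a i); first by lra.
  by move=> u /andP[? ?]; apply: Hi; apply/andP; split; lra.
have L3 : tr beta eta a (t0 + d') (t0 + d) @[beta --> +oo] --> 0.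
  apply: (@transported_unique_min eta a j); first by lra.
  by move=> u /andP[? ?]; apply: Hj; apply/andP; split; lra.
have le2 : t0 - d' <= t0 + d' by lra.
have L2 : tr beta eta a (t0 - d') (t0 + d') -
    \sum_l tf h a l * (bz beta eta (t0 + d') l - bz beta eta (t0 - d') l)
    @[beta --> +oo] --> 0.
  apply: L => // u /andP[u1 u2]; apply: He.
  by rewrite ltr_norml; apply/andP; split; lra.
have B : \sum_l tf h a l * (bz beta eta (t0 + d') l - bz beta eta (t0 - d') l)
    @[beta --> +oo] --> \sum_l tf h a l * ((l == j)%:R - (l == i)%:R).
  apply: cvg_sumr => l _; apply: cvgM; first exact: cvg_cst.
  apply: cvg_suby; apply: boltzmann_cvg_unique.
    by apply: Hj; apply/andP; split; lra.
  by apply: Hi; apply/andP; split; lra.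
have S : \sum_l tf h a l * ((l == j)%:R - (l == i)%:R) = tf h a j - tf h a i.
  under eq_bigr do rewrite mulrBr.
  rewrite sumrB (bigD1 j) //= eqxx mulr1 [X in _ + X - _]big1 ?addr0; last first.
    by move=> l /negbTE->; rewrite mulr0.
  rewrite (bigD1 i) //= eqxx mulr1 big1 ?addr0 //.
  by move=> l /negbTE->; rewrite mulr0.
rewrite S in B.
have h1 := cvg_addy (cvg_addy L1 (cvg_addy L2 B)) L3.
rewrite !add0r addr0 in h1; apply: (cvg_ext h1) => b.
rewrite (transportedD _ _ _ _ _ (t0 - d) (t0 - d') (t0 + d)).
rewrite (transportedD _ _ _ _ _ (t0 - d') (t0 + d') (t0 + d)).
have alg (A X Y Z : R) : A + (X - Y + Y) + Z = A + (X + Z) by ring.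
exact: alg.
Qed.

Lemma coordE'_eq eta1 eta2 i : coordE eta1 i = coordE eta2 i ->
  coordE' eta1 i = coordE' eta2 i.
Proof.
move=> e; apply/funext => t; apply: dv_unique (dv_coordE eta1 i t) _.
by rewrite e; exact: dv_coordE.
Qed.

Lemma pump_congr beta eta1 eta2 a t1 t2 :
  (forall c, coordW eta1 c t1 = coordW eta2 c t2) ->
  (forall i, coordE eta1 i t1 = coordE eta2 i t2) ->
  (forall i, coordE' eta1 i t1 = coordE' eta2 i t2) ->
  pump i0 beta eta1 a t1 = pump i0 beta eta2 a t2.
Proof.
move=> /funext eW /funext eE /funext eE'.
pose P w e e' := current_form i0 beta w (gibbs' (fun=> 1) beta e e') a.
rewrite -[LHS]/(P (coordW eta1 ^~ t1) (coordE eta1 ^~ t1) (coordE' eta1 ^~ t1)).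
rewrite -[RHS]/(P (coordW eta2 ^~ t2) (coordE eta2 ^~ t2) (coordE' eta2 ^~ t2)).
have cg (P' : _ -> _ -> _ -> R) w1 w2 e1 e2 d1 d2 : w1 = w2 -> e1 = e2 -> d1 = d2 ->
    P' w1 e1 d1 = P' w2 e2 d2 by move=> -> -> ->.
exact: (cg _ _ _ P _ _ _ _ _ _ eW eE eE').
Qed.

Lemma transported_eq beta eta1 eta2 a s t : s <= t ->
  (forall i, coordE eta1 i = coordE eta2 i) ->
  (forall c u, s <= u <= t -> coordW eta1 c u = coordW eta2 c u) ->
  tr beta eta1 a s t = tr beta eta2 a s t.
Proof.
move=> st eE eW.
have E : forall u, s <= u <= t -> pump i0 beta eta1 a u = pump i0 beta eta2 a u.
  move=> u su; apply: pump_congr => [c|i|i]; first exact: eW.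
    by rewrite eE.
  by rewrite (coordE'_eq (eE i)).
have := @mvt_cst R (fun u => pumped Gconn i0 beta eta1 a u -
  pumped Gconn i0 beta eta2 a u) s t st.
move=> h; have {}h := h _; rewrite /transported.
apply: exchange_sub.
apply: h => u su.
apply: dv_eq (dvB (dv_pumped Gconn i0 beta eta1 a u) (dv_pumped Gconn i0 beta eta2 a u)) _.
by rewrite E // subrr.
Qed.

Lemma pump_periodic beta eta a t : pump i0 beta eta a (t + 1) = pump i0 beta eta a t.
Proof.
have pE i s : coordE eta i (s + 1) = coordE eta i s by rewrite /coordE loop_periodic.
apply: pump_congr => [c|i|i]; [by rewrite /coordW loop_periodic|exact: pE|].
apply: (@dv_unique R (coordE eta i) t _ _ _ (dv_coordE eta i t)).
by apply: dv_ext (dv_shift (dv_coordE eta i (t + 1))) => s; rewrite pE.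
Qed.

Lemma transported_period beta eta a s : tr beta eta a 0 1 = tr beta eta a s (s + 1).
Proof.
have := @dv0_cst R (fun u => pumped Gconn i0 beta eta a (u + 1) -
  pumped Gconn i0 beta eta a u).
move=> h; have {}h := h _ 0 s; rewrite /transported -[X in pumped _ _ _ _ _ X - _]add0r.
apply: h => u.
apply: dv_eq (dvB (dv_shift (dv_pumped Gconn i0 beta eta a (u + 1)))
  (dv_pumped Gconn i0 beta eta a u)) _.
by rewrite pump_periodic subrr.
Qed.

(** Lowering the barriers on the edges of [h] favours a tree in proportion to the
    number of edges that it shares with [h]. *)
Lemma mst_selected (w : 'I_(ne G) -> R) (h h' : bT) (s : R) : 0 < s -> is_mst i0 w h ->
  is_mst i0 (fun c => w c - s * (c \in codom h)%:R) h' ->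
  tf h' = tf h.
Proof.
move=> s0 [mh Hh] [mh' Hh'].
have E (f : bT) : tree_energy (fun c => w c - s * (c \in codom h)%:R) f =
    tree_energy w f - s * \sum_k (f k \in codom h)%:R.
  by rewrite /tree_energy sumrB -mulr_sumr.
have all_in : forall k, h' k \in codom h.
  have := Hh' h mh; rewrite !E; have := Hh h' mh' => h1 h2.
  have : \sum_(k < (nv G).-1) (h k \in codom h)%:R <=
      \sum_(k < (nv G).-1) (h' k \in codom h)%:R :> R.
    by rewrite -(ler_pM2l s0); lra.
  move=> h3 k; apply: contraT => nk.
  suff : \sum_(k < (nv G).-1) (h' k \in codom h)%:R <
      \sum_(k < (nv G).-1) (h k \in codom h)%:R :> R by rewrite ltNge h3.
  rewrite (bigD1 k) //= [ltRHS](bigD1 k) //= (negbTE nk) codom_f.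
  rewrite ltr_leD ?ltr01 //; apply: ler_sum => l _.
  by rewrite codom_f ler_nat; case: (_ \in _).
rewrite tree_mass_gt0 in mh; rewrite tree_mass_gt0 in mh'.
apply/matrixP => c i.
have ext f : tf f c i = (tf f *m delta_mx i ord0 : 'cV_(ne G)) c ord0.
  have := congr1 (fun A : 'cV[R]_(ne G) => A c ord0) (colE i (tf f)); by rewrite mxE.
by rewrite !ext !tree_flowE (basis_flow_codom _ mh mh' all_in).
Qed.

Lemma mst_lowered (w : 'I_(ne G) -> R) (h : bT) (s : R) : 0 < s -> is_mst i0 w h ->
  is_mst i0 (fun c => w c - s * (c \in codom h)%:R) h.
Proof.
move=> s0 [mh Hh]; split => // g mg.
have E (f : bT) : tree_energy (fun c => w c - s * (c \in codom h)%:R) f =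
    tree_energy w f - s * \sum_k (f k \in codom h)%:R.
  by rewrite /tree_energy sumrB -mulr_sumr.
rewrite !E lerB ?Hh // ler_wpM2l ?(ltW s0) //; apply: ler_sum => l _.
by rewrite codom_f ler_nat; case: (_ \in _).
Qed.

Definition bump t0 d t : R := flat 0 (cos (phase t0 t) - cos (d * (pi *+ 2))).

Lemma cos_decreasing (x y : R) : 0 <= x -> x <= y -> y <= pi -> cos y <= cos x.
Proof.
move=> x0 xy ypi; have [->//|ne] := eqVneq x y.
apply: ltW; rewrite ltr_cos ?in_itv /= ?x0 ?ypi ?(le_trans x0 xy) ?(le_trans xy ypi) //.
by rewrite lt_def eq_sym ne.
Qed.

Lemma bump_gt0 t0 d : 0 < d -> d <= 2^-1 -> 0 < bump t0 d t0.
Proof.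
move=> d0 d2; apply: flat_gt0.
have pi0 := pi_gt0 R.
have dp : d * (pi *+ 2) <= pi.
  by rewrite -mulr_natl mulrA -[leRHS]mul1r ler_wpM2r ?(ltW pi0) //; lra.
have dp0 : 0 < d * (pi *+ 2) by rewrite mulr_gt0 // mulrn_wgt0.
rewrite /phase subrr mul0r subr_gt0 ltr_cos //.
  by rewrite in_itv /= lexx ltW.
by rewrite in_itv /= dp ltW.
Qed.

(** The cosine is even and decreases on half a period, so the argument of [flat]
    is nonpositive. *)
Lemma bump_out t0 d t : 0 < d -> d <= `|t - t0| <= 2^-1 -> bump t0 d t = 0.
Proof.
move=> d0 /andP[dt t2]; have pi0 := pi_gt0 R; apply: flat_le0; rewrite subr_le0.
have p2 : 0 <= pi *+ 2 :> R by rewrite mulrn_wge0 // ltW.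
rewrite /phase -[cos ((t - t0) * _)]cos_norm normrM (ger0_norm p2).
apply: cos_decreasing; first by rewrite mulr_ge0 // ltW.
  by rewrite ler_wpM2r.
rewrite -mulr_natl mulrA -[leRHS]mul1r ler_wpM2r ?(ltW pi0) //; lra.
Qed.

End BadLoop.

(** * Loops through a degenerate point are not robust *)

Section Degenerate.
Variables (R : realType) (G : graph) (Gconn : connected_graph G) (i0 : 'I_(nv G)).

Local Notation bT := {ffun 'I_(nv G).-1 -> 'I_(ne G)}.
Local Notation tf := (tree_flow R i0).
Local Notation tr := (transported Gconn i0).

(** Near a zero with positive derivative the difference quotient is positive. *)
Lemma simple_zero (D : R -> R) t0 m : 0 < m -> D t0 = 0 -> dv D t0 m ->
  exists2 d, 0 < d & forall t, (0 < t - t0 <= d -> 0 < D t) /\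
    (- d <= t - t0 < 0 -> D t < 0).
Proof.
move=> m0 D0 [Dd De].
have c : h^-1 *: ((D \o shift t0) (h *: 1) - D t0) @[h --> 0^'] --> m.
  by rewrite -De; exact: Dd.
have /cvgrPdist_lt/(_ m m0)/nbhs_ballP[e e0 H] := c.
have e0' : 0 < e := e0.
exists (e / 2); first by rewrite divr_gt0.
have key h : h != 0 -> `|h| < e -> 0 < h^-1 * D (t0 + h).
  move=> hn he; have := H h; rewrite /ball /= sub0r normrN => /(_ he hn).
  rewrite D0 subr0 /GRing.scale /= mulr1 addrC ltr_norml => /andP[_].
  by rewrite [t0 + h]addrC; lra.
move=> t; have tE : t0 + (t - t0) = t by ring.
split => /andP[h1 h2].
  have := key (t - t0); rewrite tE pmulr_rgt0 ?invr_gt0 //; apply.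
    exact: lt0r_neq0.
  by rewrite gtr0_norm //; lra.
have := key (t - t0); rewrite tE nmulr_rgt0 ?invr_lt0 //; apply.
  by rewrite lt_eqF.
by rewrite ltr0_norm //; lra.
Qed.

(** Two perturbations by a bump around [t0], one making [f] and one making [g]
    the only minimal tree there, leave the loop unchanged over the rest of the
    period. The difference of their currents is thus the difference of the
    currents of the crossing, and both currents have the same limit [q]. *)
Lemma crossing_tree_unique (eta : loop R G) (U : set (loop R G)) (q : 'cV[R]_(ne G)) t0 d i j f g a :
  whitney_open U -> U eta ->
  (forall xi, U xi -> adiabatic_current beta xi @[beta --> +oo] --> q) ->
  0 < d -> d <= 4^-1 ->
  (forall t, t0 - d <= t < t0 -> unique_min (coordE eta ^~ t) i) ->
  (forall t, t0 < t <= t0 + d -> unique_min (coordE eta ^~ t) j) ->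
  is_mst i0 (coordW eta ^~ t0) f -> is_mst i0 (coordW eta ^~ t0) g ->
  tf f a j - tf f a i = tf g a j - tf g a i.
Proof.
move=> oU Ueta Hq d0 d4 Hi Hj mf mg.
have d2 : d <= 2^-1 by lra.
have sb : smooth_periodic (bump t0 d) by exact: SP_flat.
pose u (h : bT) : params R G := (0, \row_c - (c \in codom h)%:R).
have [ef ef0 Uf] := perturb_open sb (u f) oU Ueta.
have [eg eg0 Ug] := perturb_open sb (u g) oU Ueta.
pose e := Num.min ef eg.
have e0 : 0 < e by rewrite lt_min ef0.
pose xi h := perturb eta sb (e *: u h).
have xiE h l : coordE (xi h) l = coordE eta l.
  by apply/funext => t; rewrite perturb_coordE !mxE !mulr0 addr0.
have xiW h c t : coordW (xi h) c t =
    coordW eta c t - bump t0 d t * e * (c \in codom h)%:R.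
  by rewrite perturb_coordW !mxE; ring.
have s0 : 0 < bump t0 d t0 * e by rewrite mulr_gt0 ?bump_gt0.
have lim h : U (xi h) -> is_mst i0 (coordW eta ^~ t0) h ->
    tr beta (xi h) a 0 1 @[beta --> +oo] --> q a ord0 /\
    tr beta (xi h) a (t0 - d) (t0 + d) @[beta --> +oo] --> tf h a j - tf h a i.
  move=> Uh mh; split.
    have c := Hq _ Uh.
    have := @cvg_comp _ _ _ (fun b => adiabatic_current b (xi h))
      (fun M : 'cV[R]_(ne G) => M a ord0) _ _ _ c (@coord_continuous R _ _ a ord0 q).
    move=> {}c; apply: (cvg_ext c) => b.
    change ((adiabatic_current b (xi h)) a ord0 = tr b (xi h) a 0 1).
    by rewrite (adiabatic_current_transported Gconn i0 b (xi h)) mxE.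
  have Wt0 : (xi h t0).2 ord0 = (fun c => coordW eta c t0 -
      bump t0 d t0 * e * (c \in codom h)%:R).
    by apply/funext => c; rewrite -xiW.
  apply: transported_crossing => //.
  - move=> [i' [j' [f' [g' [_ _ mf' mg' [a' ne']]]]]]; apply: ne'.
    rewrite Wt0 in mf'; rewrite Wt0 in mg'.
    by rewrite (mst_selected s0 mh mf') (mst_selected s0 mh mg').
  - by rewrite Wt0; exact: mst_lowered.
  - move=> t tt; have -> : (coordE (xi h) ^~ t) = (coordE eta ^~ t).
      by apply/funext => l; rewrite xiE.
    exact: Hi.
  - move=> t tt; have -> : (coordE (xi h) ^~ t) = (coordE eta ^~ t).
      by apply/funext => l; rewrite xiE.
    exact: Hj.
have [Lf Mf] : _ /\ _ := lim f (Uf e ltac:(by rewrite (ltW e0) ge_min lexx)) mf.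
have [Lg Mg] : _ /\ _ := lim g (Ug e ltac:(by rewrite (ltW e0) ge_min lexx orbT)) mg.
have same s t b : s <= t -> (forall v, s <= v <= t -> d <= `|v - t0| <= 2^-1) ->
    tr b (xi f) a s t = tr b (xi g) a s t.
  move=> st out; apply: transported_eq => // c v sv.
  by rewrite !xiW (bump_out d0 (out v sv)) !mul0r.
have eqd b : tr b (xi f) a 0 1 - tr b (xi g) a 0 1 =
    tr b (xi f) a (t0 - d) (t0 + d) - tr b (xi g) a (t0 - d) (t0 + d).
  have split3 h : tr b (xi h) a 0 1 = tr b (xi h) a (t0 - 2^-1) (t0 - d) +
      (tr b (xi h) a (t0 - d) (t0 + d) + tr b (xi h) a (t0 + d) (t0 - 2^-1 + 1)).
    rewrite (transported_period _ _ _ _ _ (t0 - 2^-1)).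
    rewrite (transportedD _ _ _ _ _ (t0 - 2^-1) (t0 - d) (t0 - 2^-1 + 1)).
    by rewrite (transportedD _ _ _ _ _ (t0 - d) (t0 + d) (t0 - 2^-1 + 1)).
  have o1 : tr b (xi f) a (t0 - 2^-1) (t0 - d) = tr b (xi g) a (t0 - 2^-1) (t0 - d).
    apply: same; first by rewrite lerD2l lerN2.
    move=> v /andP[v1 v2]; rewrite ltr0_norm; last by clear -d0 v2; lra.
    by clear -v1 v2 d0; apply/andP; split; lra.
  have o2 : tr b (xi f) a (t0 + d) (t0 - 2^-1 + 1) =
      tr b (xi g) a (t0 + d) (t0 - 2^-1 + 1).
    apply: same; first by clear -d2; lra.
    move=> v /andP[v1 v2]; rewrite gtr0_norm; last by clear -d0 v1; lra.
    by clear -v1 v2 d0; apply/andP; split; lra.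
  have alg (A B C D : R) : A + (B + C) - (A + (D + C)) = B - D by ring.
  rewrite (split3 f) (split3 g) o1 o2; exact: alg.
have l1 := cvg_suby Lf Lg; have l2 := cvg_suby Mf Mg.
have {}l2 := cvg_ext l2 (fun b => esym (eqd b)).
have := cvg_unique (@Rhausdorff R) l1 l2.
by move=> h; apply/eqP; rewrite -subr_eq0 -h subrr.
Qed.

(** A small perturbation reduces to a transversal crossing of exactly two
    minima, to which [crossing_tree_unique] applies. *)
Lemma degenerate_not_robust (gam : loop R G) t0 : degenerate i0 (gam t0) ->
  ~ intrinsically_robust gam.
Proof.
move=> [i [j [f [g [mi mj mf mg [a]]]]]] ne [U [oU Ug] [q Hq]].
(* Exchanging [i] and [j] fixes the sign of their relative velocity. *)
wlog sgn : i j mi mj ne / 0 <= coordE' gam i t0 - coordE' gam j t0.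
  move=> W; have [h|/ltW h] := leP 0 (coordE' gam i t0 - coordE' gam j t0).
    exact: (W i j).
  apply: (W j i) => //; last by rewrite -oppr_le0 opprB.
  by move=> e; apply: ne; rewrite -[LHS]opprB e opprB.
have ij : i != j by apply: contra_notN ne => /eqP->; rewrite !subrr.
(* A constant shift of the energies leaves only [i] and [j] minimal at [t0]. *)
pose u1 : params R G := (\row_l - ((l == i)%:R + (l == j)%:R), 0).
have s1 : smooth_periodic (fun=> 1 : R) by exact: SP_cst.
have [e1 e10 U1] := perturb_open s1 u1 oU Ug.
have {U1} : U (perturb gam s1 (e1 *: u1)) by apply: U1; rewrite ltW //=.
set g1 := perturb _ _ _ => Ug1.
have g1E l t : coordE g1 l t = coordE gam l t - e1 * ((l == i)%:R + (l == j)%:R).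
  by rewrite perturb_coordE !mxE; ring.
have g1W c t : coordW g1 c t = coordW gam c t.
  by rewrite perturb_coordW !mxE; ring.
(* A multiple of a sine that vanishes at [t0] makes [i] and [j] cross
   transversally there; by [sgn] it cannot cancel the given velocity. *)
pose u2 : params R G := (\row_l (l == i)%:R, 0).
have s2 : smooth_periodic (fun t : R => sin (phase t0 t)) by exact: SP_sin.
have [e2 e20 U2] := perturb_open s2 u2 oU Ug1.
have {U2} : U (perturb g1 s2 (e2 *: u2)) by apply: U2; rewrite ltW //=.
set g2 := perturb _ _ _ => Ug2.
have g2E l t : coordE g2 l t = coordE g1 l t + sin (phase t0 t) * (e2 * (l == i)%:R).
  by rewrite perturb_coordE !mxE.
have g2W c t : coordW g2 c t = coordW gam c t.
  by rewrite perturb_coordW g1W !mxE; ring.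
have sin_t0 : sin (phase t0 t0) = 0 by rewrite /phase subrr mul0r sin0.
pose D t := coordE g2 i t - coordE g2 j t.
have ji : (j == i) = false by rewrite eq_sym (negbTE ij).
have DE t : D t = (coordE gam i t - coordE gam j t) + e2 * sin (phase t0 t).
  by rewrite /D !g2E !g1E !eqxx ji (negbTE ij) /=; ring.
have eqij : coordE gam i t0 = coordE gam j t0.
  by apply/eqP; rewrite eq_le; apply/andP; split; [exact: mi|exact: mj].
have D0 : D t0 = 0 by rewrite DE sin_t0 eqij subrr mulr0 addr0.
have dD : dv D t0 ((coordE' gam i t0 - coordE' gam j t0) + e2 * (pi *+ 2)).
  apply: (@dv_ext _ (fun t => (coordE gam i t - coordE gam j t) +
    e2 * sin (phase t0 t))) => [t|]; first by rewrite DE.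
  apply: dv_eq (dvD (dvB (dv_coordE gam i t0) (dv_coordE gam j t0))
    (dvZ e2 (dv_sin_phase t0 t0))) _.
  by rewrite /phase subrr mul0r cos0 mul1r.
have m0 : 0 < (coordE' gam i t0 - coordE' gam j t0) + e2 * (pi *+ 2).
  by rewrite ltr_wpDl // mulr_gt0 // mulrn_wgt0 // pi_gt0.
have [d1 d10 Hd1] := simple_zero m0 D0 dD.
have [r r0 Hr] := loop_close g2 t0 (divr_gt0 e10 (ltr0n R 3)).
pose d := Num.min d1 (Num.min (r / 2) 4^-1).
have d0 : 0 < d by rewrite !lt_min d10 divr_gt0 //= invr_gt0 ltr0n.
have dd1 : d <= d1 by rewrite ge_min lexx.
have dr : d < r.
  by rewrite !gt_min ltr_pdivrMr // ltr_pMr // ltr1n orbT.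
have d4 : d <= 4^-1 by rewrite !ge_min lexx !orbT.
have gap l k t : l != i -> l != j -> (k == i) || (k == j) -> `|t - t0| <= d ->
    coordE g2 k t < coordE g2 l t.
  move=> li lj kij td.
  have [hE _] := Hr t (le_lt_trans td dr).
  have := hE l; have := hE k.
  rewrite -![(g2 _).1 _ _]/(coordE g2 _ _).
  have -> : coordE g2 l t0 = coordE gam l t0.
    by rewrite g2E g1E (negbTE li) (negbTE lj) /=; ring.
  have -> : coordE g2 k t0 = coordE gam i t0 - e1.
    rewrite g2E g1E sin_t0; case/orP: kij => /eqP->.
      by rewrite eqxx (negbTE ij) /=; ring.
    by rewrite eqxx ji -eqij /=; ring.
  have := mi l; rewrite -![(gam _).1 _ _]/(coordE gam _ _).
  move: (coordE gam l t0) (coordE gam i t0) (coordE g2 l t) (coordE g2 k t) => A B X Y.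
  clear -e10; rewrite !ltr_norml => h /andP[h1 h2] /andP[h3 h4].
  by lra.
apply: ne; suff : tf f a j - tf f a i = tf g a j - tf g a i.
  by move=> e; rewrite -[LHS]opprB e opprB.
apply: (@crossing_tree_unique g2 U q t0 d i j f g a) => //.
- move=> t /andP[t1 t2] l li.
  have td : `|t - t0| <= d by rewrite ltr0_norm ?subr_lt0 //; lra.
  have [->|lj] := eqVneq l j; last by apply: gap => //; rewrite eqxx.
  have : D t < 0 by apply: (Hd1 t).2; apply/andP; split; lra.
  by rewrite subr_lt0.
- move=> t /andP[t1 t2] l lj.
  have td : `|t - t0| <= d by rewrite gtr0_norm ?subr_gt0 //; lra.
  have [->|li] := eqVneq l i; last by apply: gap => //; rewrite eqxx orbT.
  have : 0 < D t by apply: (Hd1 t).1; apply/andP; split; lra.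
  by rewrite subr_gt0.
- by have -> : (coordW g2 ^~ t0) = (gam t0).2 ord0 by apply/funext => c; rewrite g2W.
- by have -> : (coordW g2 ^~ t0) = (gam t0).2 ord0 by apply/funext => c; rewrite g2W.
Qed.

End Degenerate.

Theorem theorem2 (R : realType) (G : graph) (Gconn : connected_graph G) :
  (exists D : set (params R G), robust_loops R G = loops_in (~` D)) /\
  is_loop_space (robust_loops R G).
Proof.
have [nv0 _] := Gconn; pose i0 := Ordinal nv0.
have E : robust_loops R G = loops_in (~` degenerate i0).
  apply/seteqP; split => gam.
    move=> rob _ [t _ <-] deg; exact: (degenerate_not_robust Gconn deg rob).
  move=> good; apply: (good_loop_robust Gconn (i0 := i0)) => t deg.
  exact: (good (gam t) (ex_intro2 _ _ t I erefl) deg).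
split; first by exists (degenerate i0).
by exists (~` degenerate i0).
Qed.
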